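(* Let $A$ be an almost locally simple artinian algebra over its center $F$, where $F$ contains at least four elements, let $G$ be a non-abelian subnormal subgroup of $A^\times$, and let $\star$ be an involution of the first kind on $A$. Then the following assertions are equivalent: (1) $T_G\subseteq F$; (2) $T_A\subseteq F$; (3) $N_A\subseteq F$; (4) $N_G\subseteq F$. Moreover, if one of these conditions holds, then $A\cong \mathrm{M}_n(D)$ for some positive integer $n$ and some centrally finite division ring $D$; and either (i) $n=1$, and $A$ is a quaternion division algebra over $F$, or (ii) $n=2$, $D=F$ and $\star$ is the ordinary symplectic involution on $\mathrm{M}_2(F)$.
   Context: Rings are associative with identity $1\neq 0$, and subrings and subalgebras contain the identity. An algebra $A$ over a field $K$ is almost locally simple artinian if every finitely generated $K$-subalgebra of $A$ is contained in a subring of $A$ that is a simple artinian algebra over some field. An involution on a ring $A$ is a map $\star:A\to A$ with $(x+y)^\star=x^\star+y^\star$, $(xy)^\star=y^\star x^\star$ and $(x^\star)^\star=x$ for all $x,y\in A$. It is of the first kind if $z^\star=z$ for every $z$ in the center $Z(A)$. For a subset $X\subseteq A$ (in particular $X=A$ or $X=G$), $T_X=\{x+x^\star\mid x\in X\}$ and $N_X=\{xx^\star\mid x\in X\}$. $A^\times$ is the multiplicative group of $A$. A division ring is centrally finite if it is finite-dimensional over its center. A quaternion division algebra over $F$ is a division ring with center $F$ and of dimension $4$ over $F$. The ordinary symplectic involution on $\mathrm{M}_2(F)$ is $\begin{pmatrix} a & b\\ c& d\end{pmatrix}^\star=\begin{pmatrix} d & -b\\ -c& a\end{pmatrix}$;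 in (ii) $\star$ is regarded as an involution on $\mathrm{M}_2(F)$ via the isomorphism $A\cong\mathrm{M}_2(F)$. *)

(* Defs.v *)
From HB Require Import structures.
From mathcomp Require Import all_boot all_algebra.
From mathcomp Require Import boolp classical_sets.

Set Implicit Arguments.
Unset Strict Implicit.
Unset Printing Implicit Defensive.

Import GRing.Theory.
Local Open Scope classical_set_scope.
Local Open Scope ring_scope.

Definition center (R : nzRingType) : set R :=
  [set z | forall x, GRing.comm z x].
Arguments center : clear implicits.

Definition units (R : unitRingType) : set R := [set x | x \is a GRing.unit].
Arguments units : clear implicits.

Definition left_ideal (R : nzRingType) (I : set R) : Prop :=
  [/\ I 0, forall x y, I x -> I y -> I (x + y) & forall a x, I x -> I (a * x)].

Definition right_ideal (R : nzRingType) (I : set R) : Prop :=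
  [/\ I 0, forall x y, I x -> I y -> I (x + y) & forall a x, I x -> I (x * a)].

Definition simple_ring (R : nzRingType) : Prop :=
  forall I : set R, left_ideal I -> right_ideal I -> I = [set 0] \/ I = setT.

Definition descending_chain_condition (R : nzRingType) (P : set (set R)) :=
  forall I : nat -> set R,
    (forall k, P (I k)) -> (forall k, I k.+1 `<=` I k) ->
    exists m, forall k, (m <= k)%N -> I k = I m.

(* Both one-sided conditions are required; they are equivalent for simple
   rings. *)
Definition artinian_ring (R : nzRingType) : Prop :=
  descending_chain_condition (@left_ideal R) /\
  descending_chain_condition (@right_ideal R).

(* A subring of A is given as the image of an injective ring morphism f; it is
   an algebra over a field K that is unrelated to F. *)
Definition almost_locally_simple_artinian
    (F : fieldType) (A : algType F) : Prop :=
  forall s : seq A,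
    exists (K : fieldType) (S : algType K) (f : {rmorphism S -> A}),
      [/\ simple_ring S, artinian_ring S, injective f &
          smallest [set B : set A | GRing.subalg_closed (mem B)] [set` s]
            `<=` range f].

Definition unit_subgroup (R : unitRingType) (H : set R) : Prop :=
  H `<=` units R /\ GRing.divr_closed (mem H).

Definition normal_in (R : unitRingType) (H K : set R) : Prop :=
  H `<=` K /\ forall h k, H h -> K k -> H (k * h / k).

Definition subnormal_unit_subgroup (R : unitRingType) (G : set R) : Prop :=
  exists (r : nat) (H : nat -> set R),
    [/\ H 0%N = G, H r = units R,
        forall i, (i <= r)%N -> unit_subgroup (H i) &
        forall i, (i < r)%N -> normal_in (H i) (H i.+1)].

Definition nonabelian (R : nzRingType) (G : set R) : Prop :=
  exists x y, [/\ G x, G y & x * y != y * x].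

Definition involution (R : nzRingType) (star : R -> R) : Prop :=
  [/\ {morph star : x y / x + y >-> x + y},
      forall x y, star (x * y) = star y * star x &
      involutive star].

Definition first_kind (R : nzRingType) (star : R -> R) : Prop :=
  forall z, center R z -> star z = z.

Definition traces (R : nzRingType) (star : R -> R) (X : set R) : set R :=
  [set x + star x | x in X].

Definition norms (R : nzRingType) (star : R -> R) (X : set R) : set R :=
  [set x * star x | x in X].

Definition symplectic2 (R : nzRingType) (M : 'M[R]_2) : 'M[R]_2 :=
  \matrix_(i, j)
    nth 0 (nth [::] [:: [::   M 1 1; - M 0 1];
                        [:: - M 1 0;   M 0 0]] i) j.

Definition division_ring (R : unitRingType) : Prop := GRing.field_axiom R.

(* The center of a division ring being a field, a finite spanning family means
   finite dimension. *)
Definition centrally_finite (R : unitRingType) : Prop :=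
  division_ring R /\
  exists s : seq R, forall x, exists c : nat -> R,
    (forall i, center R (c i)) /\ x = \sum_(i < size s) c i * s`_i.

Definition quaternion_division_algebra
    (F : fieldType) (A : unitAlgType F) : Prop :=
  [/\ division_ring A, center A = range (in_alg A) &
      exists v : {linear A -> 'rV[F]_4}, bijective v].

(* Main.v *)
Require Import Defs.
From HB Require Import structures.
From mathcomp Require Import all_boot all_algebra finfield.
From mathcomp Require Import boolp classical_sets cardinality ring.
From Stdlib Require Ncring Ncring_tac.

Set Implicit Arguments.
Unset Strict Implicit.
Unset Printing Implicit Defensive.

Import GRing.Theory.
Local Open Scope classical_set_scope.
Local Open Scope ring_scope.

(** Scalar traces give scalar norms, on [G] as on [A], by a direct computation
    ([norm_comm_of_traces], [traces_norms]): when traces are central, the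
    norm [x * star x = t * x - x * x] commutes with every [y] whose products with
    [x] have central traces. The point is to go back, from scalar norms on the
    subnormal subgroup [G] to scalar traces on the whole ring.

    If [A] has a nonzero noninvertible element, it suffices to work in a simple
    artinian subring, which contains a primitive idempotent [e] and acts on a vector
    space over a division ring. A noncentral subgroup normalized by the
    transvections contains them all ([transvections_in]); going down the subnormal
    chain, [G] contains the transvections. If [w] is off-diagonal with respect to
    [e], the norms of [1 + w] and [1 + a * w] are scalars, whence [star w = - w]
    ([nilpotent_skew]). Off-diagonal elements and products of two of them span the
    subring, and so traces are central ([nondivision_traces]).

    If [A] is a division ring, one finds an element [x] of [G], not fixed by
    [star], and a conjugate [z] of [x] deep in the series of iterated normal closures
    of [x], such that [x] and [z] do not commute ([noncommuting_series],
    [moved_element]). If [v] commutes with [x], so does [v + a] for each scalar [a];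
    because of the depth of [z], the conjugate of [z] by
    [v + a] is in [G], and the resulting scalar norms force the trace of [v] to
    commute with [z] ([centralizer_trace_comm]). It follows that [x] and [z] generate a
    quaternion algebra [L] over the field [C] of the elements that commute with both,
    that [L] is the centralizer of [C], and that traces and norms of elements of [L] are
    in [C]. It remains to see that [C] consists of scalars. If not, the subnormal
    chain leaves [L] at some step, and an element [h] of this step induces a nontrivial
    automorphism of [C]. Since [h] belongs to a subnormal subgroup that normalizes
    [C], sufficiently iterated commutators of elements of [L] with [h] are in
    [C], and they are trivial unless the automorphism has order two
    ([iter_twist_in_fixed]). On a commutative field they cannot all be trivial,
    because an iterated commutator is there a quotient of products of linear factors
    ([iter_twist_trivial]); order two is excluded by the same argument on unitary
    elements of [L] ([no_involutive_normalizer]).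

    Finally, when traces and norms are scalars, [A] has the basis [1], [x], [j],
    [x * j] over its center if it is a division ring ([division_basis]); otherwise a
    noninvertible element yields an idempotent of trace one, which with its image under
    [star] extends to matrix units that [star] permutes up to sign as the symplectic
    involution does ([matrix_structure]). *)

(** * Identities in noncommutative rings *)

(** These instances open rings to the normalization of noncommutative polynomial
    expressions, with Leibniz equality as the ring equality. *)
#[global] Instance nc_ops (R : nzRingType) :
  @Ncring.Ring_ops R 0 1 (@GRing.add R) (@GRing.mul R)
    (fun x y => x - y) (@GRing.opp R) (@eq R) := ltac:(constructor).

#[global] Instance nc_ring (R : nzRingType) :
  @Ncring.Ring R _ _ _ _ _ _ _ (nc_ops R).
Proof.
split; rewrite /=.
- exact: Coq.Classes.RelationClasses.eq_equivalence.
- by move=> x y -> z t ->.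
- by move=> x y -> z t ->.
- by move=> x y -> z t ->.
- by move=> x y ->.
- exact: add0r.
- exact: addrC.
- exact: addrA.
- exact: mul1r.
- exact: mulr1.
- exact: mulrA.
- exact: mulrDl.
- by move=> x y z; exact: mulrDr.
- by [].
- exact: subrr.
Qed.

(** Local definitions are forgotten first, so that they are treated as
    indeterminates. *)
Ltac ncring :=
  repeat match goal with x := _ |- _ => clearbody x end;
  Ncring_tac.non_commutative_ring.

(** * Simple artinian rings: a primitive idempotent *)

Section SimpleRings.
Variable R : nzRingType.
Hypothesis simpleR : simple_ring R.

(** The sums of products [p * b * q] form a nonzero two-sided ideal. *)
Lemma simple_ring_span (b : R) : b != 0 ->
  exists l : seq (R * R), \sum_(p <- l) p.1 * b * p.2 = 1.
Proof.
move=> b0; pose I := [set x | exists l : seq (R * R),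
  \sum_(p <- l) p.1 * b * p.2 = x].
have I0 : I 0 by exists [::]; rewrite big_nil.
have ID x y : I x -> I y -> I (x + y).
  by move=> [l1 <-] [l2 <-]; exists (l1 ++ l2); rewrite big_cat.
have Ib : I b by exists [:: (1, 1)]; rewrite big_seq1 mul1r mulr1.
case: (@simpleR I).
- split=> // a x [l <-]; exists [seq (a * p.1, p.2) | p <- l].
  by rewrite big_map mulr_sumr; apply: eq_bigr => p _; rewrite !mulrA.
- split=> // a x [l <-]; exists [seq (p.1, p.2 * a) | p <- l].
  by rewrite big_map mulr_suml; apply: eq_bigr => p _; rewrite !mulrA.
- by move=> IE; move: Ib b0; rewrite IE => ->; rewrite eqxx.
- by move=> IE; have : I 1 by rewrite IE.
Qed.

Lemma simple_ring_prime (a b : R) : a != 0 -> b != 0 -> exists s, a * s * b != 0.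
Proof.
move=> a0 /eqP b0; have [l l1] := simple_ring_span a0.
apply: contrapT => asb; apply: b0; rewrite -[b]mul1r -l1 mulr_suml big1 // => p _.
rewrite -!mulrA (mulrA a); suff -> : a * p.2 * b = 0 by rewrite mulr0.
by apply: contrapT => /eqP ?; apply: asb; exists p.2.
Qed.

Hypothesis dccR : descending_chain_condition (@left_ideal R).

Lemma minimal_left_ideal : exists I : set R,
  [/\ left_ideal I, I <> [set 0] &
      forall J, left_ideal J -> J `<=` I -> J = [set 0] \/ J = I].
Proof.
apply: contrapT => noI; pose T := {I : set R | left_ideal I /\ I <> [set 0]}.
have step (I : T) : exists J : T, sval J `<=` sval I /\ sval J <> sval I.
  case: I => I [leftI I0] /=; apply: contrapT => noJ; apply: noI.
  exists I; split=> // J leftJ JI; apply: contrapT => /not_orP[J0 JnI].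
  by apply: noJ; exists (exist _ J (conj leftJ J0)).
have [f fP] := choice step.
have leftT : left_ideal (@setT R) by [].
have T0 : @setT R <> [set 0].
  move=> E; have : [set 0] (1 : R) by rewrite -E.
  by move/eqP; rewrite oner_eq0.
pose J k := iter k f (exist _ setT (conj leftT T0)).
have leftJ k : left_ideal (sval (J k)) by have [] := svalP (J k).
have subJ k : sval (J k.+1) `<=` sval (J k) by have [] := fP (J k).
have [m Jm] := dccR leftJ subJ.
by have [_] := fP (J m); apply; exact: (Jm m.+1 (leqnSn m)).
Qed.

(** Brauer's argument: a minimal left ideal [I] of a simple ring does not square
    to zero, so right multiplication by some element of [I] is an automorphism
    of the simple module [I], and it fixes an idempotent generating [I]. *)
Lemma primitive_idempotent : exists e : R, [/\ e != 0, e * e = e &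
  forall u, u != 0 -> e * u = u -> u * e = u ->
    exists v, [/\ v * u = e, u * v = e, e * v = v & v * e = v]].
Proof.
have [I [leftI I0 Imin]] := minimal_left_ideal.
have [Iz ID IM] := leftI.
have [b Ib b0] : exists2 b, I b & b != 0.
  apply: contrapT => nob; apply: I0; apply/seteqP; split=> [x Ix|x ->//] /=.
  by apply: contrapT => /eqP x0; apply: nob; exists x.
have IB x y : I x -> I y -> I (x - y).
  by move=> Ix Iy; apply: ID => //; rewrite -mulN1r; apply: IM.
have [s bsb0] := simple_ring_prime b0 b0.
pose a := s * b; have Ia : I a by exact: IM.
have [e Ie ea] : exists2 e, I e & e * a = a.
  pose J := [set x | exists2 y, I y & y * a = x].
  case: (Imin J).
  - split=> [|x y [x' Ix' <-] [y' Iy' <-]|c x [x' Ix' <-]].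
    + by exists 0 => //; rewrite mul0r.
    + by exists (x' + y'); [exact: ID | rewrite mulrDl].
    + by exists (c * x'); [exact: IM | rewrite mulrA].
  - by move=> x [y _ <-]; exact: IM.
  - move=> J0; have : J (b * a) by exists b.
    by rewrite J0 /= => /eqP; rewrite /a mulrA (negPf bsb0).
  - by move=> JI; move: Ia; rewrite -{1}JI.
have a0 : a != 0 by apply: contra_neq bsb0 => a0; rewrite -mulrA -/a a0 mulr0.
have Ann x : I x -> x * a = 0 -> x = 0.
  pose J := [set x | I x /\ x * a = 0].
  case: (Imin J).
  - split=> [|u w [Iu ua] [Iw wa]|c u [Iu ua]]; first by rewrite /J /= mul0r.
      by split; [exact: ID | rewrite mulrDl ua wa addr0].
    by split; [exact: IM | rewrite -mulrA ua mulr0].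
  - by move=> u [].
  - by move=> J0 Ix xa; have : J x by []; rewrite J0.
  - move=> JI; have : J e by rewrite JI.
    by case=> _; rewrite ea => /eqP; rewrite (negPf a0).
have ee : e * e = e.
  apply/subr0_eq/Ann; first by apply: IB => //; exact: IM.
  by rewrite mulrBl -mulrA ea ea subrr.
have e0 : e != 0 by apply: contra_neq a0 => e0; rewrite -ea e0 mul0r.
exists e; split=> // .
have linv u : u != 0 -> e * u = u -> u * e = u ->
    exists v, [/\ v * u = e, e * v = v & v * e = v].
  move=> u0 eu ue; pose J := [set x | exists c, c * u = x].
  have Iu : I u by rewrite -ue; exact: IM.
  case: (Imin J).
  - split=> [|x y [x' <-] [y' <-]|c x [x' <-]].
    + by exists 0; rewrite mul0r.
    + by exists (x' + y'); rewrite mulrDl.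
    + by exists (c * x'); rewrite mulrA.
  - by move=> x [y <-]; exact: IM.
  - move=> J0; have : J u by exists 1; rewrite mul1r.
    by rewrite J0 /= => /eqP; rewrite (negPf u0).
  - move=> JI; have : J e by rewrite JI.
    case=> c cu; exists (e * c * e); split.
    + by rewrite -mulrA eu -mulrA cu.
    + by rewrite !mulrA ee.
    + by rewrite -!mulrA ee.
move=> u u0 eu ue; have [v [vu ev ve]] := linv u u0 eu ue.
have v0 : v != 0 by apply: contra_neq e0 => v0; rewrite -vu v0 mul0r.
have [w [wv ew we]] := linv v v0 ev ve.
exists v; split=> //; suff -> : u = w by [].
by rewrite -eu -wv -mulrA vu we.
Qed.

End SimpleRings.

(** * Transvections of a simple ring with a primitive idempotent *)

Section Transvections.
Variables (R : nzRingType) (e : R).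
Hypotheses (simpleR : simple_ring R) (e0 : e != 0) (ee : e * e = e).
Hypothesis divD : forall u, u != 0 -> e * u = u -> u * e = u ->
  exists v, [/\ v * u = e, u * v = e, e * v = v & v * e = v].

(** The left ideal [R * e] is viewed as a right vector space over the division ring
    [e * R * e], and [e * R] as the space of its covectors: a vector satisfies
    [x * e = x], a covector [e * y = y], and [y * x] is the value of [y] at [x]. The
    endomorphism [1 + x * y] is a transvection when [y * x = 0]. *)
Lemma dual_vector (x : R) : x != 0 -> x * e = x ->
  exists2 y, e * y = y & y * x = e.
Proof.
move=> x0 xe; have [s esx0] := simple_ring_prime simpleR e0 x0.
have [||v [vu _ ev _]] := divD esx0; rewrite ?mulrA ?ee // -?mulrA ?xe //.
by exists (v * (e * s)); rewrite ?mulrA ?ev // -!mulrA (mulrA e).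
Qed.

Lemma dual_covector (y : R) : y != 0 -> e * y = y ->
  exists2 x, x * e = x & y * x = e.
Proof.
move=> y0 ey; have [s yse0] := simple_ring_prime simpleR y0 e0.
have [||v [_ uv _ ve]] := divD yse0; rewrite ?mulrA ?ey // -?mulrA ?ee //.
by exists (s * e * v); rewrite ?mulrA // -mulrA ve.
Qed.

(** Gram-Schmidt elimination, starting from a covector dual to [x1]. *)
Lemma dual_basis (x1 x2 : R) : x1 != 0 -> x1 * e = x1 -> x2 * e = x2 ->
    (forall d, x2 <> x1 * d) ->
  exists y1 y2, [/\ e * y1 = y1, e * y2 = y2 &
    [/\ y1 * x1 = e, y1 * x2 = 0, y2 * x1 = 0 & y2 * x2 = e]].
Proof.
move=> x10 x1e x2e ind; have [y ey yx1] := dual_vector x10 x1e.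
pose w := x2 - x1 * (y * x2).
have w0 : w != 0 by apply/eqP => /subr0_eq; exact: ind.
have we : w * e = w by rewrite mulrBl x2e -!mulrA x2e.
have [y' ey' y'w] := dual_vector w0 we.
pose y2 := y' - y' * x1 * y.
have ey2 : e * y2 = y2 by rewrite mulrBr !mulrA ey'.
have y2x1 : y2 * x1 = 0 by rewrite mulrBl -!mulrA yx1 x1e subrr.
have y2x2 : y2 * x2 = e by rewrite -y'w mulrBl mulrBr !mulrA.
exists (y - y * x2 * y2), y2; split=> //.
  by rewrite mulrBr !mulrA ey.
split=> //.
  by rewrite mulrBl -(mulrA (y * x2)) y2x1 mulr0 subr0.
by rewrite mulrBl -(mulrA (y * x2)) y2x2 -mulrA x2e subrr.
Qed.

Lemma covector_separation (y1 y2 : R) : y1 != 0 -> e * y1 = y1 -> e * y2 = y2 ->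
    (forall d, y2 <> d * y1) ->
  exists x, [/\ x * e = x, y1 * x = 0 & y2 * x = e].
Proof.
move=> y10 ey1 ey2 ind; have [x xe y1x] := dual_covector y10 ey1.
pose w := y2 - y2 * x * y1.
have w0 : w != 0 by apply/eqP => /subr0_eq; exact: ind.
have ew : e * w = w by rewrite mulrBr !mulrA ey2.
have [x' x'e wx'] := dual_covector w0 ew.
exists (x' - x * (y1 * x')); split.
- by rewrite mulrBl -!mulrA x'e.
- by rewrite mulrBr (mulrA y1 x) y1x mulrA ey1 subrr.
- by rewrite -wx' mulrBl mulrBr !mulrA.
Qed.

(** Inverses are spelled out because [R] carries no inverse operation. *)
Definition unit_group (N : set R) := [/\ N 1, forall g h, N g -> N h -> N (g * h)
  & forall g, N g -> exists g', [/\ N g', g * g' = 1 & g' * g = 1]].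

Definition transvection_normal (N : set R) := forall x y g,
  x * e = x -> e * y = y -> y * x = 0 -> N g ->
  N ((1 + x * y) * g * (1 - x * y)).

Variable N : set R.
Hypotheses (groupN : unit_group N) (normN : transvection_normal N).

Let N1 : N 1. Proof. by case: groupN. Qed.
Let NM g h : N g -> N h -> N (g * h). Proof. by case: groupN => _ + _; apply. Qed.

Let Ninv g g' : N g -> g * g' = 1 -> N g'.
Proof.
case: groupN => _ _ inv Ng gg'; have [h [Nh gh hg]] := inv g Ng.
by rewrite -[g']mul1r -hg -mulrA gg' mulr1.
Qed.

Lemma transvectionK (x y : R) : y * x = 0 -> (1 + x * y) * (1 - x * y) = 1.
Proof.
move=> yx; transitivity (1 - x * (y * x) * y); first by ncring.
by rewrite yx mulr0 mul0r subr0.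
Qed.

Lemma conj_transvection (a b x y : R) :
  (1 + a * b) * (1 + x * y) * (1 - a * b) =
  (1 + a * b) * (1 - a * b) + (1 + a * b) * x * (y * (1 - a * b)).
Proof. by ncring. Qed.

Lemma transvectionKV (x y : R) : y * x = 0 -> (1 - x * y) * (1 + x * y) = 1.
Proof.
move=> yx; transitivity (1 - x * (y * x) * y); first by ncring.
by rewrite yx mulr0 mul0r subr0.
Qed.

(** A transvection group with a fixed hyperplane is carried to any other one by
    conjugation with a transvection. *)
Lemma all_transvections (y : R) : y != 0 -> e * y = y ->
    (forall x, x * e = x -> y * x = 0 -> N (1 + x * y)) ->
  forall x' y', x' * e = x' -> e * y' = y' -> y' * x' = 0 -> N (1 + x' * y').
Proof.
move=> y0 ey Ny x y' xe ey' y'x.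
have [->|y'0] := eqVneq y' 0; first by rewrite mulr0 addr0.
have [[d y'E]|ind] := pselect (exists d, y' = d * y).
  have y'E2 : y' = (e * d * e) * y by rewrite -!mulrA ey -y'E.
  have d0 : e * d * e != 0 by apply: contra_neq y'0 => d0; rewrite y'E2 d0 mul0r.
  have [||d' [d'd _ _ d'e]] := divD d0; rewrite ?mulrA ?ee // -?mulrA ?ee //.
  have yE : y = d' * y' by rewrite y'E2 mulrA d'd ey.
  have yx : y * x = 0 by rewrite yE -mulrA y'x mulr0.
  rewrite y'E2 mulrA; apply: Ny; first by rewrite -!mulrA ee.
  by rewrite mulrA yx mul0r.
have b0 : y' - y != 0.
  by apply/eqP => /subr0_eq E; apply: ind; exists 1; rewrite mul1r.
have indb d : y <> d * (y' - y).
  move=> E; pose c := e * d * e.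
  have yc : y = c * (y' - y).
    by rewrite /c -!mulrA (mulrBr e) ey ey' -E ey.
  have c0 : c != 0 by apply: contra_neq y0 => c0; rewrite yc c0 mul0r.
  have [||d' [d'c _ _ d'e]] := divD c0; rewrite /c ?mulrA ?ee // -?mulrA ?ee //.
  apply: ind; exists (1 + d'); rewrite mulrDl mul1r.
  by rewrite {2}yc mulrA d'c mulrBr ey' ey addrC subrK.
have eb : e * (y' - y) = y' - y by rewrite mulrBr ey' ey.
have [a [ae ba ya]] := covector_separation b0 eb ey indb.
pose a' := - a; pose b := y' - y; pose x0 : R := (1 - a' * b) * x.
have a'e : a' * e = a' by rewrite mulNr ae.
have ba' : b * a' = 0 by rewrite mulrN ba oppr0.
have y'E : y * (1 - a' * b) = y'.
  by rewrite mulrBr mulr1 mulrA mulrN ya mulNr eb opprK addrC subrK.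
have x0e : x0 * e = x0 by rewrite /x0 -mulrA xe.
have yx0 : y * x0 = 0 by rewrite /x0 mulrA y'E y'x.
have := normN a'e eb ba' (Ny x0 x0e yx0); congr N.
rewrite conj_transvection y'E transvectionK // /x0 (mulrA (1 + _)) transvectionK //.
by rewrite mul1r.
Qed.

(** In dimension at least three, where no hyperplane is a line, one transvection
    in [N] is enough. *)
Lemma transvection_spreads (x0 y : R) :
    (forall y x, y != 0 -> e * y = y -> x * e = x -> exists a,
       [/\ a * e = a, y * a = 0 & forall d, a <> x * d]) ->
    x0 != 0 -> x0 * e = x0 -> y != 0 -> e * y = y -> y * x0 = 0 ->
    N (1 + x0 * y) ->
  forall x, x * e = x -> y * x = 0 -> N (1 + x * y).
Proof.
move=> big x00 x0e y0 ey yx0 Nx0.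
have shift a : a * e = a -> y * a = 0 -> (forall d, a <> x0 * d) -> N (1 + a * y).
  move=> ae ya ind; have [b [_ [eb _ [bx0 ba _ _]]]] := dual_basis x00 x0e ae ind.
  have yE : y * (1 - a * b) = y by rewrite mulrBr mulr1 mulrA ya mul0r subr0.
  have := normN ae eb ba Nx0; rewrite conj_transvection transvectionK // yE.
  rewrite mulrDl mul1r -mulrA bx0 ae => Nx0a.
  have := NM Nx0a (Ninv Nx0 (transvectionK yx0)); congr N.
  transitivity (1 + a * y - (x0 + a) * (y * x0) * y); first by ncring.
  by rewrite yx0 mulr0 mul0r subr0.
move=> x xe yx.
have [[d xE]|ind] := pselect (exists d, x = x0 * d); last first.
  by apply: shift => // d xE; apply: ind; exists d.
have [a [ae ya ind]] := big y x0 y0 ey x0e.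
have Nxa : N (1 + (x + a) * y).
  apply: shift; first by rewrite mulrDl xe ae.
    by rewrite mulrDr yx ya addr0.
  move=> c E; apply: (ind (c - d)).
  by rewrite mulrBr -E -xE addrC addKr.
have := NM Nxa (Ninv (shift a ae ya ind) (transvectionK ya)); congr N.
transitivity (1 + x * y - (x + a) * (y * a) * y); first by ncring.
by rewrite ya mulr0 mul0r subr0.
Qed.

(** If both [u] and [u'] were on the line of [x], they would be proportional, which
    the covector [w] excludes. *)
Lemma two_vectors_off_line (y x u u' w w' : R) : x * e = x ->
    u * e = u -> u' * e = u' -> y * u = 0 -> y * u' = 0 ->
    e * w = w -> w * u = e -> w * u' = 0 -> w' * u' = e ->
  exists a, [/\ a * e = a, y * a = 0 & forall d, a <> x * d].
Proof.
move=> xe ue u'e yu yu' ew wu wu' w'u'.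
have [[d uE]|ind] := pselect (exists d, u = x * d); last first.
  by exists u; split=> // d uE; apply: ind; exists d.
exists u'; split=> // d' u'E.
have c0 : w * x != 0.
  by apply: contra_neq e0 => c0; rewrite -wu uE mulrA c0 mul0r.
have [||v [vc _ _ ve]] := divD c0; rewrite ?mulrA ?ew // -?mulrA ?xe //.
have ed' : e * d' = 0 by rewrite -vc -!mulrA -u'E wu' mulr0.
by move/eqP: e0; apply; rewrite -w'u' u'E -xe -(mulrA x) ed' !mulr0.
Qed.

(** The kernel of [y] meets the span of three independent vectors in dimension at
    least two, so it is not contained in a line. *)
Lemma three_vectors_off_line (x1 x2 x3 y1 y2 y3 : R) :
    x1 * e = x1 -> x2 * e = x2 -> x3 * e = x3 ->
    e * y1 = y1 -> e * y2 = y2 ->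
    [/\ y1 * x1 = e, y1 * x2 = 0 & y1 * x3 = 0] ->
    [/\ y2 * x1 = 0, y2 * x2 = e & y2 * x3 = 0] ->
    [/\ y3 * x1 = 0, y3 * x2 = 0 & y3 * x3 = e] ->
  forall y x, y != 0 -> e * y = y -> x * e = x -> exists a,
    [/\ a * e = a, y * a = 0 & forall d, a <> x * d].
Proof.
move=> x1e x2e x3e ey1 ey2 [y11 y12 y13] [y21 y22 y23] [y31 y32 y33].
move=> y x y0 ey xe.
have elim u v w : v * (y * u) = e -> y * u * v = e -> w * e = w ->
    y * (w - u * v * (y * w)) = 0.
  by move=> vu uv we; rewrite mulrBr !mulrA uv ey subrr.
have [yx1|yx1] := eqVneq (y * x1) 0.
  have [yx2|yx2] := eqVneq (y * x2) 0.
    exact: (two_vectors_off_line xe x1e x2e yx1 yx2 ey1 y11 y12 y22).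
  have [||v [vc cv ev ve]] := divD yx2; rewrite ?mulrA ?ey // -?mulrA ?x2e //.
  have ue : (x3 - x2 * v * (y * x3)) * e = x3 - x2 * v * (y * x3).
    by rewrite mulrBl -!mulrA x3e.
  apply: (two_vectors_off_line xe x1e ue yx1 (elim _ _ _ vc cv x3e) ey1 y11 _ (w' := y3)).
    by rewrite mulrBr y13 !mulrA y12 !mul0r subrr.
  by rewrite mulrBr y33 !mulrA y32 !mul0r subr0.
have [||v [vc cv ev ve]] := divD yx1; rewrite ?mulrA ?ey // -?mulrA ?x1e //.
have u2e : (x2 - x1 * v * (y * x2)) * e = x2 - x1 * v * (y * x2).
  by rewrite mulrBl -!mulrA x2e.
have u3e : (x3 - x1 * v * (y * x3)) * e = x3 - x1 * v * (y * x3).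
  by rewrite mulrBl -!mulrA x3e.
apply: (two_vectors_off_line xe u2e u3e (elim _ _ _ vc cv x2e) (elim _ _ _ vc cv x3e) ey2 _ _ (w' := y3)).
- by rewrite mulrBr y22 !mulrA y21 !mul0r subr0.
- by rewrite mulrBr y23 !mulrA y21 !mul0r subr0.
- by rewrite mulrBr y33 !mulrA y31 !mul0r subr0.
Qed.

(** Dimension at least three: the commutator of [g] with a transvection whose
    hyperplane contains [x1] and [g * x1] is a transvection, or yields one after
    a second commutator. *)
Lemma transvections_dim_ge3 (g x1 x2 y1 y2 : R) :
    N g -> g * x1 = x2 -> x1 * e = x1 -> x2 * e = x2 ->
    e * y1 = y1 -> e * y2 = y2 ->
    [/\ y1 * x1 = e, y1 * x2 = 0, y2 * x1 = 0 & y2 * x2 = e] ->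
    x1 * y1 + x2 * y2 <> 1 ->
  forall x y, x * e = x -> e * y = y -> y * x = 0 -> N (1 + x * y).
Proof.
move=> Ng gx1 x1e x2e ey1 ey2 [y11 y12 y21 y22] not1.
pose p := 1 - (x1 * y1 + x2 * y2).
have p0 : p != 0 by apply/eqP => /subr0_eq E; apply: not1.
have px1 : p * x1 = 0.
  by rewrite mulrBl mul1r mulrDl -!mulrA y11 y21 mulr0 addr0 x1e subrr.
have px2 : p * x2 = 0.
  by rewrite mulrBl mul1r mulrDl -!mulrA y12 y22 mulr0 add0r x2e subrr.
have y1p : y1 * p = 0.
  by rewrite mulrBr mulr1 mulrDr !mulrA y11 y12 mul0r addr0 ey1 subrr.
have y2p : y2 * p = 0.
  by rewrite mulrBr mulr1 mulrDr !mulrA y21 y22 mul0r add0r ey2 subrr.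
have pp : p * p = p.
  by rewrite {2}/p mulrBr mulr1 mulrDr !mulrA px1 px2 !mul0r addr0 subr0.
have [s pse0] := simple_ring_prime simpleR p0 e0.
have psee : p * s * e * e = p * s * e by rewrite -mulrA ee.
have [y' ey' y'x3] := dual_vector pse0 psee.
pose x3 := p * s * e; pose y3 := y' * p.
have ey3 : e * y3 = y3 by rewrite mulrA ey'.
have y33 : y3 * x3 = e by rewrite /y3 /x3 -[RHS]y'x3 -!mulrA (mulrA p p) pp.
have y31 : y3 * x1 = 0 by rewrite -mulrA px1 mulr0.
have y32 : y3 * x2 = 0 by rewrite -mulrA px2 mulr0.
have y13 : y1 * x3 = 0 by rewrite /x3 !mulrA y1p !mul0r.
have y23 : y2 * x3 = 0 by rewrite /x3 !mulrA y2p !mul0r.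
have y30 : y3 != 0 by apply: contra_neq e0 => y30; rewrite -y33 y30 mul0r.
have big := three_vectors_off_line x1e x2e psee ey1 ey2
  (And3 y11 y12 y13) (And3 y21 y22 y23) (And3 y31 y32 y33).
suff [x0 [x00 x0e y3x0 Nx0]] : exists x0,
    [/\ x0 != 0, x0 * e = x0, y3 * x0 = 0 & N (1 + x0 * y3)].
  apply: (all_transvections y30 ey3).
  exact: (transvection_spreads big x00 x0e y30 ey3 y3x0).
have [g' [Ng' gg' g'g]] : exists g', [/\ N g', g * g' = 1 & g' * g = 1].
  by case: groupN => _ _ inv; exact: inv.
pose w := y3 * g'.
have wx2 : w * x2 = 0 by rewrite -gx1 /w -mulrA (mulrA g') g'g mul1r.
have Nk : N (g * ((1 + x1 * y3) * g' * (1 - x1 * y3))).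
  exact: NM (normN x1e ey3 y31 Ng').
have kE : g * ((1 + x1 * y3) * g' * (1 - x1 * y3)) =
    1 + x2 * w - x1 * y3 - x2 * (w * x1) * y3.
  transitivity ((g * g' + g * x1 * (y3 * g')) * (1 - x1 * y3)); first by ncring.
  by rewrite gg' gx1 -/w; ncring.
have ew : e * w = w by rewrite mulrA ey3.
have [[d wE]|ind] := pselect (exists d, w = d * y3).
  have wE2 : w = e * d * e * y3 by rewrite -!mulrA ey3 -wE.
  exists (x2 * (e * d * e) - x1); split.
  - apply: contra_neq e0 => x00; have : y1 * (x2 * (e * d * e) - x1) = 0.
      by rewrite x00 mulr0.
    by rewrite mulrBr (mulrA y1) y12 mul0r add0r y11 => /eqP; rewrite oppr_eq0 => /eqP.
  - by rewrite mulrBl x1e -!mulrA ee.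
  - by rewrite mulrBr !mulrA y32 !mul0r y31 subr0.
  move: Nk; rewrite kE; congr N; rewrite wE2 -(mulrA _ y3) y31 !mulr0 mul0r subr0.
  by ncring.
have [x'' [xe'' y3x wx]] :=
  covector_separation y30 ey3 ew (fun d wE => ind (ex_intro _ d wE)).
exists x2; split=> //; first by apply: contra_neq e0 => x20; rewrite -y22 x20 mulr0.
have [k [Nk' kE']] : exists k, N k /\ k = 1 + x2 * w - x1 * y3 - x2 * (w * x1) * y3.
  by eexists; split; [exact: Nk | exact: kE].
have [k' [Nkk kk' k'k]] : exists k', [/\ N k', k * k' = 1 & k' * k = 1].
  by case: groupN => _ _ inv; exact: inv.
have y3k : y3 * k = y3.
  rewrite kE' !mulrBr !mulrDr mulr1 !mulrA y32 y31 !mul0r !subr0.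
  by rewrite addr0.
have y3k' : y3 * k' = y3 by rewrite -{1}y3k -mulrA kk' mulr1.
have kx : k * x'' = x'' + x2.
  rewrite kE'; transitivity (x'' + x2 * (w * x'') - x1 * (y3 * x'')
    - x2 * (w * x1) * (y3 * x'')); first by ncring.
  by rewrite wx y3x !mulr0 !subr0 x2e.
have := NM Nk' (normN xe'' ey3 y3x Nkk); congr N.
transitivity ((k * k' + k * x'' * (y3 * k')) * (1 - x'' * y3)); first by ncring.
rewrite kk' kx y3k'.
transitivity (1 + x2 * y3 - x'' * (y3 * x'') * y3 - x2 * (y3 * x'') * y3); first by ncring.
by rewrite y3x !mulr0 !mul0r !subr0.
Qed.

Section PlaneMatrices.
Variables x1 x2 y1 y2 : R.
Hypotheses (x1e : x1 * e = x1) (x2e : x2 * e = x2).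
Hypotheses (ey1 : e * y1 = y1) (ey2 : e * y2 = y2).
Hypotheses (y11 : y1 * x1 = e) (y12 : y1 * x2 = 0).
Hypotheses (y21 : y2 * x1 = 0) (y22 : y2 * x2 = e).
Hypothesis xy1 : x1 * y1 + x2 * y2 = 1.

Definition plane_mx (a b c d : R) :=
  x1 * a * y1 + x1 * b * y2 + (x2 * c * y1 + x2 * d * y2).

Lemma plane_mxM a b c d a' b' c' d' :
    e * a' = a' -> e * b' = b' -> e * c' = c' -> e * d' = d' ->
  plane_mx a b c d * plane_mx a' b' c' d' =
  plane_mx (a * a' + b * c') (a * b' + b * d') (c * a' + d * c') (c * b' + d * d').
Proof.
move=> ea eb ec ed.
have entry x u i j y t : i * j = t -> x * u * i * (j * y) = x * (u * (t * y)).
  by move=> <-; rewrite !mulrA.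
rewrite /plane_mx !mulrDl !mulrDr -!(mulrA x1 _ y1) -!(mulrA x1 _ y2).
rewrite -!(mulrA x2 _ y1) -!(mulrA x2 _ y2) !mulrA.
rewrite -!(mulrA _ y1 x1) -!(mulrA _ y1 x2) -!(mulrA _ y2 x1) -!(mulrA _ y2 x2).
rewrite y11 y12 y21 y22 !mulr0 !mul0r !addr0 !add0r.
rewrite -!(mulrA _ e a') -!(mulrA _ e b') -!(mulrA _ e c') -!(mulrA _ e d') ea eb ec ed.
by ncring.
Qed.

Lemma plane_mx1 : plane_mx e 0 0 e = 1.
Proof. by rewrite /plane_mx x1e x2e !mulr0 !mul0r addr0 add0r. Qed.

Let upper d := plane_mx e d 0 e.
Let lower d := plane_mx e 0 d e.

Lemma upperE d : upper d = 1 + x1 * d * y2.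
Proof. by rewrite -plane_mx1 /upper /plane_mx !mulr0 !mul0r; ncring. Qed.

Lemma lowerE d : lower d = 1 + x2 * d * y1.
Proof. by rewrite -plane_mx1 /lower /plane_mx !mulr0 !mul0r; ncring. Qed.

Lemma conj_upper d g : d * e = d -> N g -> N (upper d * g * upper (- d)).
Proof.
move=> de Ng; rewrite !upperE mulrN mulNr; apply: normN => //.
  by rewrite -mulrA de.
by rewrite mulrA y21 mul0r.
Qed.

Lemma conj_lower d g : d * e = d -> N g -> N (lower d * g * lower (- d)).
Proof.
move=> de Ng; rewrite !lowerE mulrN mulNr; apply: normN => //.
  by rewrite -mulrA de.
by rewrite mulrA y12 mul0r.
Qed.

Definition in_corner d := e * d = d /\ d * e = d.

Local Notation r0 := (mulr0, mul0r, mulrN, mulNr, opprK, oppr0, addr0, add0r,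
  sub0r, subr0, subrr, addNr, ee).

(** By the Whitehead lemma a diagonal matrix with mutually inverse entries is a
    product of transvections. *)
Lemma conj_diag u u' g : in_corner u -> in_corner u' -> u * u' = e -> u' * u = e ->
  N g -> N (plane_mx u 0 0 u' * g * plane_mx u' 0 0 u).
Proof.
move=> [eu ue] [eu' u'e] uu' u'u Ng.
have weyl v v' : in_corner v -> in_corner v' -> v * v' = e -> v' * v = e ->
    upper v * (lower (- v') * upper v) = plane_mx 0 v (- v') 0.
  move=> [ev ve] [ev' v'e] vv' v'v; rewrite /upper /lower.
  rewrite [X in _ * X]plane_mxM ?(r0, ev, ev', ve, v'e, v'v) //.
  by rewrite plane_mxM ?(r0, ev, ev', ve, v'e, v'v, vv').
have ce : in_corner e by [].
have cN v : in_corner v -> in_corner (- v).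
  by case=> [ev ve]; split; rewrite r0 ?ev ?ve.
have diagE v v' : in_corner v -> in_corner v' -> v * v' = e -> v' * v = e ->
    upper v * (lower (- v') * (upper v * (upper (- e) * (lower e * upper (- e))))) =
    plane_mx v 0 0 v'.
  move=> cv cv' vv' v'v; case: (cv) (cv') => [ev ve] [ev' v'e].
  have := weyl (- e) (- e) (cN _ ce) (cN _ ce); rewrite !r0 => -> //.
  rewrite (mulrA (lower _)) (mulrA (upper _)) weyl //.
  by rewrite plane_mxM ?r0 // ve v'e.
have diagV v v' : in_corner v -> in_corner v' -> v * v' = e -> v' * v = e ->
    upper e * (lower (- e) * (upper e * (upper (- v) * (lower v' * upper (- v))))) =
    plane_mx v' 0 0 v.
  move=> cv cv' vv' v'v; case: (cv) (cv') => [ev ve] [ev' v'e].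
  have := weyl (- v) (- v') (cN _ cv) (cN _ cv'); rewrite !r0 => -> //.
  rewrite (mulrA (lower _)) (mulrA (upper _)) weyl //.
  by rewrite plane_mxM ?r0 // ?ev ?ev'.
have Ne : - e * e = - e by rewrite mulNr ee.
have Nu' : - u' * e = - u' by rewrite mulNr u'e.
have := conj_upper ue (conj_lower Nu' (conj_upper ue
  (conj_upper Ne (conj_lower ee (conj_upper Ne Ng))))).
congr N; rewrite -(diagE u u') // -(diagV u u') // !opprK.
by rewrite !mulrA.
Qed.

Section Shear.
Variables (g b b' d al al' : R).
Hypotheses (eb : e * b = b) (be : b * e = b) (eb' : e * b' = b') (b'e : b' * e = b').
Hypotheses (bb' : b * b' = e) (b'b : b' * b = e) (ed : e * d = d) (de : d * e = d).
Hypotheses (alC : forall s, al * s = s * al) (al'C : forall s, al' * s = s * al').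
Hypothesis alal' : al * al' = 1.

(** Conjugation by the companion matrix turns [diag (al', al)] into a triangular
    matrix with exchanged diagonal entries, which is then multiplied by
    [diag (al, al')]. *)
Lemma shear_commutator : N (plane_mx 0 b e d) ->
  N (plane_mx (al * al * e) 0 ((1 - al' * al') * (d * b')) (al' * al' * e)).
Proof.
move=> Ng.
have al'al : al' * al = 1 by rewrite -alC.
have corner t : (forall s, t * s = s * t) -> in_corner (t * e).
  by move=> tC; split; rewrite ?mulrA -?(tC e) -mulrA ee.
have prod t t' : (forall s, t' * s = s * t') -> t * e * (t' * e) = t * t' * e.
  by move=> t'C; rewrite -mulrA (mulrA e) -t'C -mulrA ee mulrA.
have Ng' : N (plane_mx (- (d * b')) e b' 0).
  apply: (Ninv Ng); rewrite plane_mxM ?r0 ?mulrA ?ed ?eb' //.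
  by rewrite bb' addNr plane_mx1.
have := conj_diag (corner _ alC) (corner _ al'C) _ _ Ng.
rewrite !prod // alal' al'al mul1r => /(_ erefl erefl) /NM /(_ Ng').
congr N.
have [eal ale] := corner _ alC; have [eal' al'e] := corner _ al'C.
have -> : plane_mx (al * e) 0 0 (al' * e) * plane_mx 0 b e d =
    plane_mx 0 (al * b) (al' * e) (al' * d).
  by rewrite plane_mxM ?r0 // -!mulrA eb ee ed.
have -> : plane_mx 0 (al * b) (al' * e) (al' * d) * plane_mx (al' * e) 0 0 (al * e) =
    plane_mx 0 (al * al * b) (al' * al' * e) d.
  rewrite plane_mxM ?r0 // prod // -(mulrA al b) (mulrA b) -(alC b) -mulrA be.
  by rewrite -(mulrA al' d) (mulrA d) -(alC d) -!mulrA de !(mulrA al') al'al mul1r.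
have edb : e * (d * b') = d * b' by rewrite mulrA ed.
rewrite plane_mxM ?r0 ?edb ?eb' // -(mulrA _ b) bb' -!(mulrA _ e) edb.
by rewrite ee mulrBl mul1r addrC.
Qed.

(** A triangular matrix in [N] with distinct diagonal entries, commuted with a lower
    transvection, gives the transvection of proportional parameter. The factor is
    invertible because [al] is not a fourth root of unity. *)
Lemma shear_lower bt : (al' * al' * (al' * al') - 1) * bt = 1 ->
    (forall s, bt * s = s * bt) ->
  N (plane_mx 0 b e d) -> forall t, in_corner t -> N (lower t).
Proof.
move=> btE btC Ng t [et te]; move: (shear_commutator Ng).
have al'al : al' * al = 1 by rewrite -alC.
have [A' [A'E A'C]] : exists A', A' = al' * al' /\ forall s, A' * s = s * A'.
  by exists (al' * al'); split=> // s; rewrite -mulrA al'C -mulrA al'C !mulrA.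
have [A [AE AC]] : exists A, A = al * al /\ forall s, A * s = s * A.
  by exists (al * al); split=> // s; rewrite -mulrA alC -mulrA alC !mulrA.
have AA' : A * A' = 1 by rewrite AE A'E mulrA -(mulrA al) alal' mulr1.
rewrite -A'E -AE in btE *.
have corner z z' : (forall s, z * s = s * z) -> e * z' = z' -> e * (z * z') = z * z'.
  by move=> zC ez'; rewrite mulrA -zC -mulrA ez'.
have eAe := corner _ _ AC ee; have eA'e := corner _ _ A'C ee.
have [c [-> ec ce]] : exists c, [/\ (1 - A') * (d * b') = c, e * c = c & c * e = c].
  exists ((1 - A') * (d * b')); split=> //; last by rewrite -!mulrA b'e.
  by rewrite mulrA mulrBr mulr1 -A'C -{1}[e]mul1r -mulrBl -mulrA (mulrA e) ed.
move=> Nk; have AeA'e : A * e * (A' * e) = e.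
  by rewrite -mulrA (mulrA e) -A'C -mulrA ee mulrA AA' mul1r.
have A'eAe : A' * e * (A * e) = e.
  by rewrite -mulrA (mulrA e) -AC -mulrA ee mulrA -AC AA' mul1r.
have cA'e : c * (A' * e) = A' * c by rewrite mulrA -A'C -mulrA ce.
have A'ec : A' * e * c = A' * c by rewrite -mulrA ec.
have Nk' : N (plane_mx (A' * e) 0 (- c) (A * e)).
  apply: (Ninv Nk); rewrite plane_mxM ?r0 ?ec //.
  by rewrite AeA'e cA'e A'ec subrr A'eAe plane_mx1.
have ett : e * (bt * t) = bt * t by apply: corner.
have tte : bt * t * e = bt * t by rewrite -mulrA te.
have := NM Nk (conj_lower tte Nk'); congr N; rewrite /lower mulrA mulrA.
rewrite (plane_mxM (A * e)) ?ett ?r0 //.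
rewrite (plane_mxM (A * e * e)) ?r0 ?ec //.
rewrite plane_mxM ?r0 ?ett // -!(mulrA _ e e) ee AeA'e ee A'eAe ee A'ec ce.
congr plane_mx; rewrite -(mulrA A' e) ett (mulrDl c) cA'e (addrC (A' * c)) addrK.
rewrite -(mulrA (A' * _)) -(mulrA A' e) ee -(mulrA A') (mulrA (bt * t)) -A'C.
rewrite -(mulrA A' _ e) tte mulrA -[X in _ - X]mul1r -mulrBl mulrA.
by rewrite btE mul1r.
Qed.

End Shear.

(** In characteristic five the parameters of the lower transvections in [N] are
    closed under the maps [t |-> v * t * v]; polarizing them at the inverse of one
    nonzero parameter gives twice every element. *)
Lemma lower_char5 t0 : 1 + 1 + 1 + 1 + 1 = 0 :> R -> in_corner t0 -> t0 != 0 ->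
  N (lower t0) -> forall t, in_corner t -> N (lower t).
Proof.
move=> five [et0 t0e] t00 Nt0 t [et te].
have ND a b : e * b = b -> a * e = a -> N (lower a) -> N (lower b) -> N (lower (a + b)).
  move=> eb ae Na Nb; have := NM Na Nb; rewrite /lower plane_mxM ?r0 //.
  by rewrite ae eb.
have NN a : e * a = a -> a * e = a -> N (lower a) -> N (lower (- a)).
  move=> ea ae Na; apply: (Ninv Na); rewrite /lower plane_mxM ?r0 ?ea //.
  by rewrite ae subrr plane_mx1.
have NJ v : e * v = v -> v * e = v -> N (lower (v * t0 * v)).
  move=> ev ve; have [->|v0] := eqVneq v 0; first by rewrite mulr0 /lower plane_mx1.
  have [v' [v'v vv' ev' v'e]] := divD v0 ev ve.
  have := conj_diag (conj ev' v'e) (conj ev ve) v'v vv' Nt0; congr N.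
  rewrite /lower plane_mxM ?r0 ?et0 // plane_mxM ?r0 //.
  by rewrite v'e v'v ve vv'.
have [s [st0 t0s es se]] := divD t00 et0 t0e.
have ests : e * (t + s) = t + s by rewrite mulrDr et es.
have estse : (t + s) * e = t + s by rewrite mulrDl te se.
have e3 a c : e * a = a -> e * (a * c) = a * c by move=> ea; rewrite mulrA ea.
have N2 : N (lower (t + t)).
  have -> : t + t = (t + s) * t0 * (t + s) + (- (t * t0 * t) + - (s * t0 * s)).
    transitivity (t * (t0 * s) + s * t0 * t); last by ncring.
    by rewrite t0s te st0 et.
  apply: (ND) => //; first 1 last.
  - by rewrite -(mulrA ((t + s) * t0)) estse.
  - exact: NJ.
  - apply: (ND).
    + by rewrite mulrN -!mulrA e3.
    + by rewrite mulNr -(mulrA (t * t0)) te.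
    + by apply: NN; [rewrite -!mulrA e3 | rewrite -(mulrA (t * t0)) te | exact: NJ].
    + by apply: NN; [rewrite -!mulrA e3 | rewrite -(mulrA (s * t0)) se | exact: NJ].
  - by rewrite mulrDr !mulrN -!mulrA !e3.
have e2 : e * (t + t) = t + t by rewrite mulrDr et.
have t2 : (t + t) * e = t + t by rewrite mulrDl te.
have := ND _ _ e2 _ (ND _ _ e2 t2 N2 N2) N2; rewrite mulrDl t2 => /(_ erefl).
congr (N (lower _)); transitivity ((1 + 1 + 1 + 1 + 1) * t + t); first by ncring.
by rewrite five mul0r add0r.
Qed.

(** In dimension two the vectors killed by [y1] form a line, so all transvections
    along [y1] are lower triangular. *)
Lemma transvections_of_lower : (forall t, in_corner t -> N (lower t)) ->
  forall x y, x * e = x -> e * y = y -> y * x = 0 -> N (1 + x * y).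
Proof.
move=> Nl; have y10 : y1 != 0.
  by apply: contra_neq e0 => y10; rewrite -y11 y10 mul0r.
apply: (all_transvections y10 ey1) => x xe y1x.
have -> : x = x2 * (y2 * x) by rewrite mulrA -[LHS]mul1r -xy1 mulrDl -mulrA y1x mulr0 add0r.
by rewrite -lowerE; apply: Nl; split; rewrite ?mulrA ?ey2 // -mulrA xe.
Qed.

(** Dimension two, with [x2 = g * x1]: in this basis [g] is a companion matrix. *)
Lemma transvections_dim2 (g : R) : N g -> g * x1 = x2 ->
    (exists al al' bt : R, [/\ forall s, al * s = s * al, forall s, al' * s = s * al',
      forall s, bt * s = s * bt, al * al' = 1 &
      (al' * al' * (al' * al') - 1) * bt = 1])
    \/ (1 + 1 + 1 + 1 + 1 = 0 :> R /\ y2 * (g * x2) <> 0) ->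
  forall x y, x * e = x -> e * y = y -> y * x = 0 -> N (1 + x * y).
Proof.
move=> Ng gx1 scal; apply: transvections_of_lower.
pose b := y1 * (g * x2); pose d := y2 * (g * x2).
have eb : e * b = b by rewrite mulrA ey1.
have be : b * e = b by rewrite -!mulrA x2e.
have ed : e * d = d by rewrite mulrA ey2.
have de : d * e = d by rewrite -!mulrA x2e.
have gx2 : g * x2 = x1 * b + x2 * d.
  by rewrite /b /d !mulrA -!mulrDl xy1 mul1r.
have gE : g = plane_mx 0 b e d.
  rewrite -[LHS]mulr1 -xy1 mulrDr !mulrA gx1 gx2 /plane_mx mulr0 mul0r add0r x2e.
  by rewrite mulrDl addrA (addrC (x2 * y1)) -addrA.
have [g' [Ng' gg' g'g]] : exists g', [/\ N g', g * g' = 1 & g' * g = 1].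
  by case: groupN => _ _ inv; exact: inv.
have b0 : b != 0.
  apply/eqP => b0; move/eqP: e0; apply.
  have g'x2 : g' * x2 = x1 by rewrite -gx1 mulrA g'g mul1r.
  have : y2 * (g' * (g * x2)) = 0.
    by rewrite gx2 b0 mulr0 add0r (mulrA g') g'x2 mulrA y21 mul0r.
  by rewrite (mulrA g') g'g mul1r y22.
have [b' [b'b bb' eb' b'e]] := divD b0 eb be.
move: Ng; rewrite gE => Ng.
case: scal => [[al [al' [bt [alC al'C btC alal' btE]]]]|[five d0]].
  exact: (shear_lower eb be eb' b'e bb' ed de alC al'C alal' btE btC Ng).
have two z : (1 + 1) * z = z * (1 + 1) :> R by ncring.
(* In characteristic five, [al] is two and its inverse is three. The triangular
   matrix obtained has both diagonal entries minus one, so its square is a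
   transvection. *)
have three z : (1 + 1 + 1) * z = z * (1 + 1 + 1) :> R by ncring.
have six : (1 + 1) * (1 + 1 + 1) = 1 :> R.
  by rewrite -[RHS]addr0 -five; ncring.
have Nk := shear_commutator eb be eb' bb' ed de two three six Ng.
have edb : e * (d * b') = d * b' by rewrite mulrA ed.
have dbe : d * b' * e = d * b' by rewrite -mulrA b'e.
apply: (@lower_char5 (d * b')) => //.
  apply/eqP => db0; apply: d0; rewrite -/d -[d]de -b'b mulrA db0 mul0r.
  by [].
have c15 (z : R) : (1 + 1 + 1 + 1 + 1) * z = 0 by rewrite five mul0r.
have := NM Nk Nk; rewrite plane_mxM ?r0 //; last first.
- by transitivity ((1 + 1 + 1) * (1 + 1 + 1) * (e * e)); [ncring | rewrite ee].
- transitivity ((1 - (1 + 1 + 1) * (1 + 1 + 1)) * (e * (d * b'))); first by ncring.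
  by rewrite edb.
- by transitivity ((1 + 1) * (1 + 1) * (e * e)); [ncring | rewrite ee].
congr N; rewrite /lower; congr plane_mx.
- transitivity (e * e + (1 + 1 + 1 + 1 + 1) * ((1 + 1 + 1) * (e * e))); first by ncring.
  by rewrite c15 ee addr0.
- transitivity ((1 - (1 + 1 + 1) * (1 + 1 + 1)) * ((1 + 1) * (1 + 1)) * (d * b' * e) +
    (1 + 1 + 1) * (1 + 1 + 1) * (1 - (1 + 1 + 1) * (1 + 1 + 1)) * (e * (d * b'))).
    by ncring.
  rewrite dbe edb; transitivity (d * b' + (1 + 1 + 1 + 1 + 1) *
    - ((1 + 1 + 1) * (1 + (1 + 1) * (1 + 1 + 1)) * (d * b'))); first by ncring.
  by rewrite c15 addr0.
- transitivity (e * e + (1 + 1 + 1 + 1 + 1) * ((1 + 1 + 1 + 1) * (1 + 1 + 1 + 1) * (e * e))).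
    by ncring.
  by rewrite c15 ee addr0.
Qed.

(** When the companion matrix [g] has trace zero, its commutator with an upper
    transvection of parameter one or two has not. *)
Lemma nonzero_trace_basis (g : R) : N g -> g * x1 = x2 ->
    1 + 1 + 1 + 1 + 1 = 0 :> R -> y2 * (g * x2) = 0 ->
  exists h z1 z2 w1 w2, [/\ N h, h * z1 = z2, z1 * e = z1 /\ z2 * e = z2,
    e * w1 = w1 /\ e * w2 = w2 &
    [/\ w1 * z1 = e /\ w1 * z2 = 0, w2 * z1 = 0 /\ w2 * z2 = e,
        z1 * w1 + z2 * w2 = 1 & w2 * (h * z2) <> 0]].
Proof.
move=> Ng gx1 five d0.
have [g' [Ng' gg' g'g]] : exists g', [/\ N g', g * g' = 1 & g' * g = 1].
  by case: groupN => _ _ inv; exact: inv.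
have g'x2 : g' * x2 = x1 by rewrite -gx1 mulrA g'g mul1r.
have [b [bE eb be]] : exists b, [/\ b = y1 * (g * x2), e * b = b & b * e = b].
  by exists (y1 * (g * x2)); split=> //; rewrite ?mulrA ?ey1 // -!mulrA x2e.
have gx2 : g * x2 = x1 * b.
  by rewrite -[LHS]mul1r -xy1 mulrDl -!mulrA d0 mulr0 addr0 -bE.
have b0 : b != 0.
  apply/eqP => b0; move/eqP: e0; apply.
  by rewrite -y22 -[x2 in LHS]mul1r -g'g -mulrA gx2 b0 !mulr0.
have [b' [b'b bb' eb' b'e]] := divD b0 eb be.
have g'x1 : g' * x1 = x2 * b'.
  rewrite -[RHS]mul1r -g'g -(mulrA g') (mulrA g) gx2 -mulrA bb'.
  by rewrite x1e.
have basis c c' : (forall z, c * z = z * c) -> (forall z, c' * z = z * c') ->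
    c * c' = 1 -> e + e - c * c * b' <> 0 ->
  exists h z1 z2 w1 w2, [/\ N h, h * z1 = z2, z1 * e = z1 /\ z2 * e = z2,
    e * w1 = w1 /\ e * w2 = w2 &
    [/\ w1 * z1 = e /\ w1 * z2 = 0, w2 * z1 = 0 /\ w2 * z2 = e,
        z1 * w1 + z2 * w2 = 1 & w2 * (h * z2) <> 0]].
  move=> cC c'C cc' trN0.
  have c'c : c' * c = 1 by rewrite -cC.
  have cx1e : c * x1 * e = c * x1 by rewrite -mulrA x1e.
  have y2cx1 : y2 * (c * x1) = 0 by rewrite mulrA -cC -mulrA y21 mulr0.
  have Nh := NM (normN cx1e ey2 y2cx1 Ng) Ng'.
  have hx2 : (1 + c * x1 * y2) * g * (1 - c * x1 * y2) * g' * x2 = c * x1 + x2.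
    rewrite -(mulrA _ g') g'x2 -(mulrA _ (1 - _)) (mulrBl x1) mul1r -(mulrA _ y2) y21.
    rewrite mulr0 subr0 -(mulrA _ g) gx1 mulrDl mul1r -(mulrA _ y2) y22.
    by rewrite cx1e addrC.
  have hx1 : (1 + c * x1 * y2) * g * (1 - c * x1 * y2) * g' * x1 =
      x1 - c * c * (x1 * b') - c * (x2 * b').
    have s1 : (1 - c * x1 * y2) * (x2 * b') = x2 * b' - c * (x1 * b').
      transitivity (x2 * b' - c * (x1 * (y2 * x2 * b'))); first by ncring.
      by rewrite y22 eb'.
    have s2 : g * (x2 * b' - c * (x1 * b')) = x1 - c * (x2 * b').
      rewrite mulrBr (mulrA g c) -(cC g) -(mulrA c) !(mulrA g) gx2 gx1.
      by rewrite -(mulrA x1) bb' x1e.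
    have s3 : (1 + c * x1 * y2) * (x1 - c * (x2 * b')) =
        x1 - c * (x2 * b') - c * x1 * (c * b').
      transitivity (x1 - c * (x2 * b') + c * x1 * (y2 * x1 - y2 * c * (x2 * b'))).
        by ncring.
      by rewrite y21 -(cC y2) -(mulrA c y2) (mulrA y2) y22 eb' sub0r mulrN.
    rewrite -(mulrA _ g') g'x1 -(mulrA _ (1 - _)) s1 -(mulrA _ g) s2 s3 addrAC -!mulrA.
    by rewrite (mulrA x1 c) -(cC x1) -mulrA.
  exists ((1 + c * x1 * y2) * g * (1 - c * x1 * y2) * g'), x2, (c * x1 + x2),
    (y2 - c' * y1), (c' * y1); split=> //.
  - by rewrite mulrDl x2e cx1e.
  - by rewrite mulrBr mulrA -c'C -mulrA ey1 ey2.
  have c'y : c' * y1 * (c * x1) = e.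
    by rewrite -mulrA (mulrA y1) -cC -mulrA y11 mulrA c'c mul1r.
  have c'y2 : c' * y1 * x2 = 0 by rewrite -mulrA y12 mulr0.
  split.
  - by rewrite mulrBl y22 c'y2 subr0 mulrBl !mulrDr y2cx1 y22 c'y c'y2 addr0 add0r subrr.
  - by rewrite mulrDr c'y c'y2 addr0.
  - transitivity (x2 * y2 + c * (x1 * c') * y1); first by ncring.
    by rewrite -(c'C x1) (mulrA c c') cc' mul1r addrC.
  have y1c z : c' * y1 * (c * z) = y1 * z.
    by rewrite -mulrA (mulrA y1) -(cC y1) -(mulrA c) (mulrA c') c'c mul1r.
  rewrite (mulrDr (_ * g')) (mulrA _ c x1) -(cC (_ * g')) -(mulrA c) hx1 hx2.
  rewrite 2!(mulrDr (c' * y1)) c'y c'y2 addr0 y1c => E; apply: trN0; rewrite -{}E.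
  transitivity (e + (y1 * x1 - y1 * c * c * x1 * b' - y1 * c * x2 * b')); last first.
    by ncring.
  rewrite -(cC y1) -(mulrA c y1 c) -(cC y1) -!mulrA !(mulrA y1) y11 y12 mul0r.
  by rewrite !mulr0 subr0 eb' !mulrA addrA.
have [tr1|tr1] := eqVneq (e + e - 1 * 1 * b') 0; last first.
  apply: (basis 1 1) => [z|z||]; rewrite ?mul1r ?mulr1 //.
  by move: tr1; rewrite ?mul1r ?mulr1 => /eqP.
have two (z : R) : (1 + 1) * z = z * (1 + 1) by ncring.
have three (z : R) : (1 + 1 + 1) * z = z * (1 + 1 + 1) by ncring.
apply: (basis (1 + 1) (1 + 1 + 1)) => //; first by rewrite -[RHS]addr0 -five; ncring.
have b'2 : b' = e + e by apply/esym/subr0_eq; move: tr1; rewrite !mul1r.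
rewrite b'2 => E; move/eqP: e0; apply; transitivity
  (- (e + e - (1 + 1) * (1 + 1) * (e + e)) - (1 + 1 + 1 + 1 + 1) * e); first by ncring.
by rewrite E five mul0r oppr0 addr0.
Qed.

End PlaneMatrices.

(** The multipliers of [e] and of any [x] off the line of [e] agree, since [e + x]
    has a multiplier too; the vectors on that line are reached through a second
    line. *)
Lemma homothety_central (g : R) : e <> 1 ->
    (forall x, x * e = x -> exists d, g * x = x * d) -> forall s, g * s = s * g.
Proof.
move=> en1 gx; have e10 : 1 - e != 0.
  by apply/eqP => /subr0_eq E; apply: en1.
have [s x20] := simple_ring_prime simpleR e10 e0.
have [x2 [x2E ex2 x2e]] : exists x2, [/\ x2 != 0, e * x2 = 0 & x2 * e = x2].
  exists ((1 - e) * s * e); split=> //; last by rewrite -(mulrA (_ * s)) ee.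
  by rewrite !mulrA mulrBr mulr1 ee subrr !mul0r.
have x2off d : x2 <> e * d.
  by move=> E; move/eqP: x2E; apply; rewrite -ex2 E mulrA ee.
have [d0 gd0] := gx e ee; pose c := e * d0 * e.
have gc : g * e = c by rewrite /c -gd0 -mulrA ee.
have ec : e * c = c by rewrite /c !mulrA ee.
have off x : x * e = x -> (forall d, x <> e * d) -> g * x = x * c.
  move=> xe xoff; have [d gxd] := gx x xe.
  have exe : (e + x) * e = e + x by rewrite mulrDl ee xe.
  have [d' gd'] := gx _ exe.
  have E0 : c + x * d * e = e * d' * e + x * d' * e.
    have ce : c * e = c by rewrite /c -!mulrA ee.
    by rewrite -{1}ce -gc -gxd -mulrDl -mulrDr gd' !mulrDl.
  have E : x * (e * d' * e - e * d * e) = e * (c - d' * e).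
    rewrite !mulrBr ec !mulrA xe.
    transitivity (e * d' * e + x * d' * e - x * d * e - e * d' * e); first by ncring.
    by rewrite -E0; ncring.
  have [d0'|/eqP dn0] := pselect (e * d' * e - e * d * e = 0); last first.
    have [||v [_ uv _ _]] := divD dn0.
    - by rewrite mulrBr !mulrA ee.
    - by rewrite mulrBl -!mulrA ee.
    case: (xoff ((c - d' * e) * v)).
    by rewrite mulrA -E -mulrA uv xe.
  have gxe : g * x = x * (e * d * e).
    by rewrite !mulrA xe -gxd -mulrA xe.
  rewrite gxe -(subr0_eq d0'); congr (_ * _); apply/esym/subr0_eq.
  by move: E; rewrite d0' mulr0 mulrBr ec mulrA.
have gV x : x * e = x -> g * x = x * c.
  move=> xe; have [[d xd]|xoff] := pselect (exists d, x = e * d); last first.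
    by apply: off => // d xd; apply: xoff; exists d.
  have := off (x + x2) _ _; rewrite mulrDl xe x2e => /(_ erefl).
  rewrite mulrDr (off x2) // mulrDl => E; apply: (addIr (x2 * c)); apply: E => d' E.
  by apply: (x2off (d' - d)); rewrite mulrBr -E -xd addrC addKr.
move=> t; apply: contrapT => /eqP; rewrite -subr_eq0 => gt0.
have [u /eqP[]] := simple_ring_prime simpleR gt0 e0.
rewrite !mulrBl -!mulrA (mulrA t u) (gV (t * u * e)) -?mulrA ?ee //.
by rewrite (gV (u * e)) -?mulrA ?ee // !mulrA subrr.
Qed.

(** If [g] is not central, it moves some vector [x1] off its line, by
    [homothety_central]. Then [x1] and [g * x1] are independent; the two cases are
    whether they span everything. *)
Lemma transvections_in (g s : R) : N g -> g * s <> s * g -> e <> 1 ->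
    (exists al al' bt : R, [/\ forall s, al * s = s * al, forall s, al' * s = s * al',
      forall s, bt * s = s * bt, al * al' = 1 &
      (al' * al' * (al' * al') - 1) * bt = 1])
    \/ 1 + 1 + 1 + 1 + 1 = 0 :> R ->
  forall x y, x * e = x -> e * y = y -> y * x = 0 -> N (1 + x * y).
Proof.
move=> Ng gs en1 scal.
have [x1 [x1e gx1]] : exists x1, x1 * e = x1 /\ forall d, g * x1 <> x1 * d.
  apply: contrapT => noX; apply: gs; apply: homothety_central => // x xe.
  apply: contrapT => nod; apply: noX; exists x; split=> // d gxd.
  by apply: nod; exists d.
have x10 : x1 != 0 by apply/eqP => E; apply: (gx1 0); rewrite E !mulr0.
have x2e : g * x1 * e = g * x1 by rewrite -mulrA x1e.
have [y1 [y2 [ey1 ey2 [y11 y12 y21 y22]]]] := dual_basis x10 x1e x2e gx1.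
have [xy1|xy1] := pselect (x1 * y1 + (g * x1) * y2 = 1); last first.
  exact: (transvections_dim_ge3 Ng erefl x1e x2e ey1 ey2 (And4 y11 y12 y21 y22) xy1).
have dim2 := transvections_dim2 x1e x2e ey1 ey2 y11 y12 y21 y22 xy1 Ng erefl.
case: scal => [scal|five]; first by apply: dim2; left.
(* In characteristic five the fourth powers of scalars may all be one; then the
   companion matrix must have a nonzero trace, which a change of basis achieves. *)
have [d0|d0] := pselect (y2 * (g * (g * x1)) = 0); last by apply: dim2; right.
have [h [z1 [z2 [w1 [w2 [Nh hz [z1e z2e] [ew1 ew2]]]]]]] :=
  nonzero_trace_basis x1e x2e ey1 ey2 y11 y12 y21 y22 xy1 Ng erefl five d0.
case=> [[w11 w12] [w21 w22] zw1 tr].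
by apply: (transvections_dim2 z1e z2e ew1 ew2 w11 w12 w21 w22 zw1 Nh hz); right.
Qed.

End Transvections.

(** * Involutions and scalars *)

Section Involution.
Variables (F : fieldType) (A : unitAlgType F) (star : A -> A).
Hypothesis centerA : center A = range (in_alg A).
Hypotheses (starI : involution star) (star1 : first_kind star).

Local Notation scalar x := (range (in_alg A) x).

Lemma scalar_central x : scalar x -> forall y, x * y = y * x.
Proof. by rewrite -centerA. Qed.

Lemma central_scalar x : (forall y, x * y = y * x) -> scalar x.
Proof. by rewrite -centerA. Qed.

Lemma starD x y : star (x + y) = star x + star y. Proof. by case: starI. Qed.
Lemma starM x y : star (x * y) = star y * star x. Proof. by case: starI. Qed.
Lemma starK x : star (star x) = x. Proof. by case: starI. Qed.

Lemma star_scalar x : scalar x -> star x = x.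
Proof. by rewrite -centerA; exact: star1. Qed.

Lemma scalar1 : scalar (1 : A). Proof. by exists 1 => //; rewrite /= scale1r. Qed.
Lemma scalarA a : scalar (a%:A : A). Proof. by exists a. Qed.

Lemma scalarD x y : scalar x -> scalar y -> scalar (x + y).
Proof. by move=> [a _ <-] [b _ <-]; exists (a + b); rewrite //= scalerDl. Qed.

Lemma scalarN x : scalar x -> scalar (- x).
Proof. by move=> [a _ <-]; exists (- a); rewrite //= scaleNr. Qed.

Lemma scalarB x y : scalar x -> scalar y -> scalar (x - y).
Proof. by move=> ? ?; apply/scalarD/scalarN. Qed.

Lemma scalarM x y : scalar x -> scalar y -> scalar (x * y).
Proof.
move=> [a _ <-] [b _ <-]; exists (a * b) => //=.
by rewrite -scalerAl mul1r scalerA.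
Qed.

Lemma scalar_divl x y : scalar x -> x != 0 -> scalar (x * y) -> scalar y.
Proof.
move=> [a _ <-] /= a0 [b _ /= bE]; exists (a^-1 * b) => //=.
have a0' : a != 0 by apply: contra_neq a0 => ->; rewrite scale0r.
by rewrite -scalerA bE -scalerAl mul1r scalerA mulVf // scale1r.
Qed.

Lemma star_one : star 1 = 1. Proof. exact: star_scalar scalar1. Qed.

Lemma star0 : star 0 = 0.
Proof. by apply: (addrI (star 0)); rewrite -starD !addr0. Qed.

Lemma starN x : star (- x) = - star x.
Proof. by apply: (addrI (star x)); rewrite -starD !subrr star0. Qed.

Lemma starB x y : star (x - y) = star x - star y.
Proof. by rewrite starD starN. Qed.

Lemma starZ a x : star (a *: x) = a *: star x.
Proof.
by rewrite -mulr_algl starM (star_scalar (scalarA a)) mulr_algr.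
Qed.

Lemma starV x : x \is a GRing.unit -> star x^-1 = (star x)^-1 /\ star x \is a GRing.unit.
Proof.
move=> ux; have xs : star x * star x^-1 = 1 by rewrite -starM mulVr // star_one.
have sx : star x^-1 * star x = 1 by rewrite -starM mulrV // star_one.
have us : star x \is a GRing.unit by apply/unitrP; exists (star x^-1).
by split=> //; rewrite -[LHS]mul1r -(mulVr us) -mulrA xs mulr1.
Qed.

(** Since [x * star x = t * x - x * x], where [t] is the trace of [x], the norm of
    [x] commutes with [y] as soon as the traces of [x], [y] and [x * y] commute
    with [x] and [y]. *)
Lemma norm_comm_of_traces x y : GRing.comm (x + star x) x -> GRing.comm (x + star x) y ->
    GRing.comm (y + star y) x -> GRing.comm (x * y + star (x * y)) x ->
  x * star x * y = y * (x * star x).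
Proof.
set t := x + star x; set u := y + star y => txC tyC uxC txy.
move: txy; rewrite /GRing.comm starM.
have -> : star x = t - x by rewrite addrC addKr.
have -> : star y = u - y by rewrite addrC addKr.
move=> /eqP; rewrite -subr_eq0 => /eqP E; apply/subr0_eq; rewrite -{}E.
rewrite -[RHS]addr0 -(subrr (x * u)) -{2}uxC.
move: t u {uxC} txC tyC (uxC) => t u txC tyC uxC; apply/subr0_eq.
transitivity (x * (t * y - y * t) + y * (t * x - x * t) + (x * u - u * x) * t +
  u * (x * t - t * x) - (x * u - u * x) * x - (x * u - u * x)); first by ncring.
by rewrite txC tyC uxC !subrr !mulr0 !mul0r !addr0 !subr0.
Qed.

Lemma norm_comm x y : scalar (x + star x) -> scalar (y + star y) ->
  scalar (x * y + star (x * y)) -> x * star x * y = y * (x * star x).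
Proof. by move=> tx ty txy; apply: norm_comm_of_traces; exact: scalar_central. Qed.

(** The norm [n] of [x] commutes with [G], so [n * (z + star z)] is the trace of
    [n * z], a scalar. If all traces vanished, [star] would be minus the identity on
    [G], hence the identity as it fixes [1], and [G] would be commutative. *)
Lemma traces_norms_setT : traces star setT `<=` range (in_alg A) ->
  norms star setT `<=` range (in_alg A).
Proof.
move=> TA _ [x _ <-]; apply: central_scalar => y.
by apply: norm_comm; apply: TA; eexists.
Qed.

(** The norm [n] of [x] commutes with [G], so [n * (z + star z)] is the trace of
    [n * z], a scalar; and the traces cannot all vanish, since [star] would then be
    an anti-automorphism and the identity on [G]. *)
Lemma traces_norms (G : set A) : G 1 -> (forall x y, G x -> G y -> G (x * y)) ->
    nonabelian G -> traces star G `<=` range (in_alg A) ->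
  norms star G `<=` range (in_alg A).
Proof.
move=> G1 GM [g [h [Gg Gh gh]]] TG _ [x Gx <-].
have T z : G z -> scalar (z + star z) by move=> Gz; apply: TG; exists z.
have nC z : G z -> x * star x * z = z * (x * star x).
  by move=> Gz; apply: norm_comm; apply: T => //; exact: GM.
have [[z [Gz Tz0]]|noT] := pselect (exists z, G z /\ z + star z != 0).
  apply: (scalar_divl (T z Gz) Tz0).
  have zs := scalar_central (T z Gz); rewrite zs mulrDr.
  have xE : star x = (x + star x) - x by rewrite addrC addKr.
  have zE : star z = (z + star z) - z by rewrite addrC addKr.
  have nz : x * star x * star z = star z * (x * star x).
    by rewrite zE mulrBr mulrBl (nC z Gz) zs.
  have -> : x * star x * z + x * star x * star z =
      x * star x * z + star (x * star x * z).
    by rewrite nz starM (starM x) starK.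
  have nE : x * star x * z = (x + star x) * (x * z) - x * (x * z).
    by rewrite {1}xE mulrBr mulrBl -(scalar_central (T x Gx) x) !mulrA.
  have st w : star ((x + star x) * w) = (x + star x) * star w.
    by rewrite starM (star_scalar (T x Gx)) (scalar_central (T x Gx)).
  have -> : x * star x * z + star (x * star x * z) =
      (x + star x) * (x * z + star (x * z)) - (x * (x * z) + star (x * (x * z))).
    by rewrite nE starB st mulrDr opprD addrACA.
  have Gxz := GM _ _ Gx Gz.
  by apply: scalarB; [apply: scalarM; exact: T | apply: T; exact: GM].
have sE z : G z -> star z = - z.
  move=> Gz; apply/eqP; rewrite -addr_eq0 addrC; apply/eqP.
  by apply: contrapT => /eqP ?; apply: noT; exists z.
have /eqP : star 1 = 1 := star_one; rewrite sE // => /eqP N1.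
have NE (z : A) : - z = z by rewrite -mulN1r N1 mul1r.
by move/eqP: gh; case; rewrite -[LHS]NE -sE ?starM ?sE ?NE //; exact: GM.
Qed.

End Involution.

(** * Subnormal chains of unit groups *)

Section UnitSubgroups.
Variables (A : unitRingType) (H : set A).
Hypothesis subH : unit_subgroup H.

Lemma usubg_unit x : H x -> x \is a GRing.unit.
Proof. by case: subH => + _ => /(_ x). Qed.

Lemma usubg1 : H 1.
Proof. by case: subH => _ [H1 _]; move: H1; rewrite inE. Qed.

Lemma usubg_div x y : H x -> H y -> H (x / y).
Proof.
move=> Hx Hy; case: subH => _ [_ Hdiv].
by have := Hdiv x y; rewrite !inE; apply.
Qed.

Lemma usubgV x : H x -> H x^-1.
Proof. by move=> Hx; rewrite -[x^-1]mul1r; exact: usubg_div usubg1 Hx. Qed.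

Lemma usubgM x y : H x -> H y -> H (x * y).
Proof. by move=> Hx Hy; rewrite -[y]invrK; apply: usubg_div => //; exact: usubgV. Qed.

End UnitSubgroups.

Definition subnormal_chain (A : unitRingType) (r : nat) (H : nat -> set A) :=
  [/\ H r = units A, forall i, (i <= r)%N -> unit_subgroup (H i) &
      forall i, (i < r)%N -> normal_in (H i) (H i.+1)].

Lemma chain_mono (A : unitRingType) (r : nat) (H : nat -> set A) i :
  subnormal_chain r H -> (i <= r)%N -> H 0%N `<=` H i.
Proof.
move=> [_ _ normH]; elim: i => [_ x|i IH ir x Hx] //; have [sub _] := normH i ir.
by apply: sub; apply: IH => //; exact: ltnW.
Qed.

(** * The case of a ring that is not a division ring *)

(** By simplicity [e] and [1 - e] generate the unit ideal, so each diagonal Peirce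
    component is spanned by products of off-diagonal elements. *)
Lemma peirce_span (R : nzRingType) (e : R) (P : set R) : simple_ring R ->
    e * e = e -> e != 0 -> 1 - e != 0 ->
    P 0 -> (forall x y, P x -> P y -> P (x + y)) ->
    (forall s, P (e * s * (1 - e))) -> (forall s, P ((1 - e) * s * e)) ->
    (forall s t, P (e * s * (1 - e) * ((1 - e) * t * e))) ->
    (forall s t, P ((1 - e) * s * e * (e * t * (1 - e)))) ->
  forall s, P s.
Proof.
move=> simpleR ee e0 f0 P0 PD Pef Pfe Pee Pff s.
have ff : (1 - e) * (1 - e) = 1 - e by rewrite mulrBl mul1r mulrBr mulr1 ee subrr subr0.
have Psum (l : seq (R * R)) (g : R * R -> R) :
    (forall p, P (g p)) -> P (\sum_(p <- l) g p).
  by move=> Pg; apply: big_ind => // p _; exact: Pg.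
have [le leE] := simple_ring_span simpleR e0.
have [lf lfE] := simple_ring_span simpleR f0.
have -> : s = e * s * e + e * s * (1 - e) + ((1 - e) * s * e + (1 - e) * s * (1 - e)).
  by ncring.
apply: (PD) (PD _ _ _ (Pef s)) (PD _ _ (Pfe s) _).
- have -> : s = \sum_(p <- lf) s * (p.1 * (1 - e) * p.2).
    by rewrite -mulr_sumr lfE mulr1.
  rewrite mulr_sumr mulr_suml; apply: Psum => p; rewrite -ff.
  by have := Pee (s * p.1) p.2; rewrite !mulrA.
- have -> : s = \sum_(p <- le) s * (p.1 * e * p.2).
    by rewrite -mulr_sumr leE mulr1.
  rewrite mulr_sumr mulr_suml; apply: Psum => p; rewrite -{2}ee.
  by have := Pff (s * p.1) p.2; rewrite !mulrA.
Qed.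

Section NonDivision.
Variables (F : fieldType) (A : unitAlgType F).
Hypothesis centerA : center A = range (in_alg A).
Hypothesis alsaA : almost_locally_simple_artinian A.

Lemma local_simple_subring (s : seq A) :
  exists (S : nzRingType) (f : {rmorphism S -> A}),
    [/\ simple_ring S, descending_chain_condition (@left_ideal S), injective f,
        forall x, x \in s -> range f x & forall a : F, range f a%:A].
Proof.
have [K [S [f [simpleS [dccS _] finj fS]]]] := alsaA s.
exists S, f; split=> // [x xs|a]; apply: fS => B [/= [B1 Blin _] sB].
  exact: sB.
have B1' := set_mem B1; rewrite -[a%:A]addr0 -(subrr (1 : A)).
have B0 : (1 : A) - 1 \in mem B.
  by rewrite addrC -scaleN1r; apply: Blin.
by apply: set_mem; apply: Blin.
Qed.

Lemma four_elements_avoid (t : seq F) : (exists s : seq F, uniq s /\ size s = 4%N) ->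
  (size t < 4)%N -> exists a, a \notin t.
Proof.
move=> [s [us ss]] st; apply: contrapT => noa.
have : (size s <= size t)%N.
  apply: uniq_leq_size => // a As; apply: contrapT => /negP At; apply: noa.
  by exists a.
by rewrite ss leqNgt st.
Qed.

(** If the fourth powers of all nonzero elements are one, the field has at most five
    elements, and it does not have four since the cube is then already one. *)
Lemma four_elements_pow4 : (exists s : seq F, uniq s /\ size s = 4%N) ->
  (exists a : F, a != 0 /\ a ^+ 4 != 1) \/ 1 + 1 + 1 + 1 + 1 = 0 :> F.
Proof.
move=> cardF; have [[a [a0 a4]]|no] := pselect (exists a : F, a != 0 /\ a ^+ 4 != 1).
  by left; exists a.
right; have P4 (a : F) : a != 0 -> a ^+ 4 = 1.
  by move=> a0; apply: contrapT => /eqP a4; apply: no; exists a.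
have one0 : (1 : F) = 0 -> False by move/eqP; rewrite oner_eq0.
have [two|two] := eqVneq (1 + 1 : F) 0.
  have [a] := @four_elements_avoid [:: 0; 1; 1] cardF isT; rewrite !inE !negb_or => /and3P[a0 a1 _].
  have a10 : a + 1 != 0.
    by apply: contra_neq a1 => E; rewrite -[RHS]add0r -E -addrA two addr0.
  case: one0; have := P4 _ a10; have := P4 _ a0 => a4 a14.
  transitivity ((1 + 1) * (1 + a * (1 + 1 + (1 + 1 + 1) * a + (1 + 1) * a ^+ 2)) : F);
    last by rewrite two mul0r.
  transitivity ((a + 1) ^+ 4 - a ^+ 4 + 1 : F); first by rewrite a4 a14; ring.
  by ring.
have [//|five] := eqVneq (1 + 1 + 1 + 1 + 1 : F) 0.
have three : 1 + 1 + 1 = 0 :> F.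
  apply: (mulIf five); rewrite mul0r.
  transitivity ((1 + 1) ^+ 4 - 1 : F); first by ring.
  by rewrite P4 // subrr.
have [a] := @four_elements_avoid [:: 0; 1; - 1] cardF isT; rewrite !inE !negb_or => /and3P[a0 a1 aN1].
have ap : a + 1 != 0 by rewrite addr_eq0.
have am : a - 1 != 0 by rewrite subr_eq0.
have := P4 _ a0; have := P4 _ ap; have := P4 _ am => am4 ap4 a4.
move/eqP: two; case; transitivity
  ((a + 1) ^+ 4 + (a - 1) ^+ 4 - (1 + 1) * a ^+ 4 - (1 + 1 + 1) * ((1 + 1) * (1 + 1)) * a ^+ 2 : F).
  by ring.
by rewrite am4 ap4 a4 three !mul0r subr0 mulr1 subrr.
Qed.

Variables (star : A -> A).
Hypotheses (starI : involution star) (star1 : first_kind star).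

Local Notation scalar x := (range (in_alg A) x).

(** Two values of the scalar factor determine the trace and the norm of [w], which
    are therefore scalars; neither is invertible when [w] squares to zero, so both
    vanish. *)
Lemma nilpotent_skew (w : A) (a : F) : w * w = 0 -> a != 0 -> a != 1 ->
    scalar ((1 + w) * star (1 + w)) -> scalar ((1 + a *: w) * star (1 + a *: w)) ->
  star w = - w.
Proof.
move=> ww a0 a1 n1 na.
have [w0|w0] := eqVneq w 0; first by rewrite w0 (star0 starI) oppr0.
pose t := w + star w; pose n := w * star w.
have nE b : (1 + b *: w) * star (1 + b *: w) = 1 + (b *: t + (b * b) *: n).
  rewrite (starD starI) (star_one centerA star1) (starZ centerA starI star1).
  rewrite mulrDr mulr1 mulrDl mul1r -scalerAr -scalerAl scalerA /t /n scalerDr.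
  by rewrite !addrA.
have n1' : scalar (t + n).
  have := nE 1; rewrite !scale1r mulr1 scale1r => E.
  by rewrite -[t + n](addKr 1) addrC; apply: (scalarB _ (scalar1 A)); rewrite -E.
have na' : scalar (a *: t + (a * a) *: n).
  by rewrite -[X in scalar X](addKr 1) addrC; apply: (scalarB _ (scalar1 A)); rewrite -nE.
have scZ b x : scalar x -> scalar (b *: x).
  by move=> [c _ <-]; exists (b * c); rewrite //= scalerA.
have ns : scalar n.
  have -> : n = (a * a - a)^-1 *: (a *: t + (a * a) *: n - a *: (t + n)).
    have -> : a *: t + (a * a) *: n - a *: (t + n) = (a * a - a) *: n.
      by move: (t) (n) => x y; rewrite scalerDr opprD addrACA subrr add0r -scalerBl.
    rewrite scalerA mulVf ?scale1r //.
    by rewrite -[X in _ - X]mulr1 -mulrBr mulf_neq0 // subr_eq0.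
  by apply: (scZ); apply: scalarB => //; exact: scZ.
have ts : scalar t by rewrite -[t](addrK n); exact: scalarB.
have n0 : n = 0.
  move: ns => [c _ /= cE]; have : c *: w = 0.
    by rewrite -mulr_algr cE /n mulrA ww mul0r.
  by move/eqP; rewrite scaler_eq0 (negPf w0) orbF => /eqP c0; rewrite -cE c0 scale0r.
move: ts => [c _ /= cE]; have : c *: w = 0.
  by rewrite -mulr_algr cE /t mulrDr ww add0r.
move/eqP; rewrite scaler_eq0 (negPf w0) orbF => /eqP c0.
by apply/eqP; rewrite -addr_eq0 addrC -/t -cE c0 scale0r.
Qed.

End NonDivision.

Section NonDivisionTraces.
Variables (F : fieldType) (A : unitAlgType F) (star : A -> A).
Hypothesis centerA : center A = range (in_alg A).
Hypothesis alsaA : almost_locally_simple_artinian A.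
Hypothesis cardF : exists s : seq F, uniq s /\ size s = 4%N.
Hypotheses (starI : involution star) (star1 : first_kind star).
Variables (r : nat) (H : nat -> set A).
Hypothesis chainH : subnormal_chain r H.
Hypothesis nabH : nonabelian (H 0%N).
Hypothesis normsH : norms star (H 0%N) `<=` range (in_alg A).

Local Notation scalar x := (range (in_alg A) x).

Let Hr : H r = units A. Proof. by case: chainH. Qed.
Let subH i : (i <= r)%N -> unit_subgroup (H i). Proof. by case: chainH => _ + _; apply. Qed.
Let normH i : (i < r)%N -> normal_in (H i) (H i.+1). Proof. by case: chainH => _ _; apply. Qed.

Section LocalSubring.
Variables (S : nzRingType) (f : {rmorphism S -> A}).
Hypotheses (simpleS : simple_ring S) (finj : injective f).
Hypothesis scalS : forall a : F, range f a%:A.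
Variables (g h : S) (e : S).
Hypotheses (Gg : H 0%N (f g)) (gh : g * h <> h * g).
Hypotheses (e0 : e != 0) (ee : e * e = e) (en1 : e <> 1).
Hypothesis divD : forall u, u != 0 -> e * u = u -> u * e = u ->
    exists v, [/\ v * u = e, u * v = e, e * v = v & v * e = v].
Hypothesis gV : range f (f g)^-1.

Let N i := [set t | H i (f t) /\ exists2 t', H i (f t') & t * t' = 1 /\ t' * t = 1].

Let Ngroup i : (i <= r)%N -> unit_group (N i).
Proof.
move=> ir; have sH := subH ir; split=> [|x y [Hx [x' Hx' [xx' x'x]]] [Hy [y' Hy' [yy' y'y]]]|].
- rewrite /N /= rmorph1; split; first exact: usubg1.
  by exists 1; rewrite ?mulr1 ?rmorph1 //; exact: usubg1.
- split; first by rewrite rmorphM; exact: usubgM.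
  exists (y' * x'); first by rewrite rmorphM; exact: usubgM.
  by split; rewrite -mulrA ?(mulrA y) ?(mulrA x') ?yy' ?x'x mul1r.
- by move=> x [Hx [x' Hx' [xx' x'x]]]; exists x'; split=> //; split=> //; exists x.
Qed.

Let Ng i : (i <= r)%N -> N i g.
Proof.
move=> ir; split; first exact: (chain_mono chainH ir).
have ug : f g \is a GRing.unit := usubg_unit (subH (leq0n r)) Gg.
case: gV => g' _ g'E; exists g'.
  by rewrite g'E; apply: (usubgV (subH ir)); exact: (chain_mono chainH ir).
by split; apply: finj; rewrite rmorphM rmorph1 g'E ?mulrV ?mulVr.
Qed.

(** The preimage of each term of the chain is normalized by that of the next term,
    hence by the transvections once these are in the next term; [transvections_in]
    carries them down to the preimage of [H 0]. *)
Lemma in_local_transvections (x y : S) : x * e = x -> e * y = y -> y * x = 0 ->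
  H 0%N (f (1 + x * y)).
Proof.
have scal : (exists al al' bt : S, [/\ forall s, al * s = s * al,
    forall s, al' * s = s * al', forall s, bt * s = s * bt, al * al' = 1 &
    (al' * al' * (al' * al') - 1) * bt = 1]) \/ 1 + 1 + 1 + 1 + 1 = 0 :> S.
  have fA a b : f a = b%:A -> forall s, a * s = s * a.
    by move=> aE s; apply: finj; rewrite !rmorphM aE mulr_algl mulr_algr.
  have [[a [a0 a4]]|five] := four_elements_pow4 cardF.
    have [al _ alE] := scalS a^-1; have [al' _ al'E] := scalS a.
    have [bt _ btE] := scalS (a ^+ 4 - 1)^-1.
    left; exists al, al', bt; split; [exact: fA alE| exact: fA al'E|exact: fA btE| |].
      by apply: finj; rewrite rmorphM rmorph1 alE al'E -!in_algE -rmorphM mulVf ?rmorph1.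
    apply: finj; rewrite rmorphM rmorphB !rmorphM rmorph1 al'E btE -!in_algE.
    have -> : in_alg A a * in_alg A a * (in_alg A a * in_alg A a) = in_alg A (a ^+ 4).
      by rewrite -!rmorphM -!expr2 -exprM.
    by rewrite -[1](rmorph1 (in_alg A)) -rmorphB -rmorphM mulfV ?subr_eq0.
  right; apply: finj; rewrite !rmorphD rmorph1 rmorph0.
  by rewrite -[1](rmorph1 (in_alg A)) -!rmorphD five rmorph0.
suff trans k i x' y' : (i + k = r)%N -> x' * e = x' -> e * y' = y' -> y' * x' = 0 ->
    N i (1 + x' * y') by move=> xe ey yx; case: (trans r 0%N x y (add0n r) xe ey yx).
elim: k i x' y' => [|k IH] i x' y' ik x'e ey' yx'.
  have TK := transvectionK yx'; have KT := transvectionKV yx'.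
  have u t t' : t * t' = 1 -> t' * t = 1 -> H i (f t).
    move=> tt' t't; rewrite -(addn0 i) ik Hr; apply/unitrP; exists (f t').
    by rewrite -!rmorphM tt' t't rmorph1.
  split; first exact: u TK KT.
  by exists (1 - x' * y') => //; exact: u KT TK.
have ir : (i < r)%N by rewrite -ik addnS ltnS leq_addr.
have [sHK nHK] := normH ir.
apply: (@transvections_in S e simpleS e0 ee divD (N i) (Ngroup (ltnW ir)) _ g h (Ng (ltnW ir))) => //.
move=> a b c ae eb ba [Hc [c' Hc' [cc' c'c]]].
have [Ht _] : N i.+1 (1 + a * b) by apply: IH => //; rewrite addSnnS.
have TK := transvectionK ba; have KT := transvectionKV ba.
have tV : f (1 - a * b) = (f (1 + a * b))^-1.
  have ut := usubg_unit (subH ir) Ht.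
  by apply: (mulrI ut); rewrite mulrV // -rmorphM TK rmorph1.
have conj t : H i (f t) -> H i (f ((1 + a * b) * t * (1 - a * b))).
  by move=> Hi; rewrite !rmorphM tV; exact: nHK.
split; first exact: conj.
exists ((1 + a * b) * c' * (1 - a * b)); first exact: conj.
by split; rewrite -!mulrA (mulrA (1 - a * b)) KT mul1r; [rewrite (mulrA c) cc' | rewrite (mulrA c') c'c]; rewrite mul1r.
Qed.

Lemma in_local_skew (x y : S) : x * e = x -> e * y = y -> y * x = 0 ->
  star (f (x * y)) = - f (x * y).
Proof.
move=> xe ey yx.
have [a a0 a1] : exists2 a : F, a != 0 & a != 1.
  have [[a [a0 a4]]|five] := four_elements_pow4 cardF.
    by exists a => //; apply: contra_neq a4 => ->; rewrite expr1n.
  have two : 1 + 1 != 0 :> F.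
    apply/eqP => two; move: five; rewrite two add0r two add0r => /eqP.
    by rewrite oner_eq0.
  exists (1 + 1) => //; apply/eqP => E.
  have /eqP : 1 = 0 :> F by apply: (addrI 1); rewrite E addr0.
  by rewrite oner_eq0.
have G1 := in_local_transvections xe ey yx.
have [b _ bE] := scalS a.
have Ga : H 0%N (f (1 + b * x * y)).
  apply: in_local_transvections => //; first by rewrite -mulrA xe.
  apply: finj; rewrite !rmorphM bE mulr_algl -scalerAr -rmorphM yx.
  by rewrite rmorph0 scaler0.
apply: (nilpotent_skew centerA starI star1 _ a0 a1).
- by rewrite -rmorphM -mulrA (mulrA y) yx mul0r mulr0 rmorph0.
- by apply: normsH; exists (f (1 + x * y)); rewrite // rmorphD rmorph1.
- apply: normsH; exists (f (1 + b * x * y)) => //.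
  by rewrite rmorphD rmorph1 -mulrA (rmorphM f b) bE mulr_algl.
Qed.

Let fe s : star (f (e * s * (1 - e))) = - f (e * s * (1 - e)).
Proof.
have -> : e * s * (1 - e) = e * (e * s * (1 - e)) by rewrite !mulrA ee.
apply: in_local_skew; rewrite ?mulrA ?ee //.
by rewrite -mulrA mulrBl mul1r ee subrr mulr0.
Qed.

Let ef s : star (f ((1 - e) * s * e)) = - f ((1 - e) * s * e).
Proof.
have E : ((1 - e) * s * e) * e = (1 - e) * s * e by rewrite -(mulrA _ e e) ee.
rewrite -E; apply: in_local_skew => //.
by rewrite !mulrA mulrBr mulr1 ee subrr !mul0r.
Qed.

(** Reversing a product of three skew elements changes its sign, and so does
    [star] on such a product when it lies off the diagonal. *)
Let peirce_product_central s t q :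
  let z := e * s * (1 - e) in let z' := (1 - e) * t * e in
  (z * z' + z' * z) * q = q * (z * z' + z' * z).
Proof.
move=> z z'; move: q.
have rev a b c : star (f a) = - f a -> star (f b) = - f b -> star (f c) = - f c ->
    star (f (a * b * c)) = - f (a * b * c) -> a * b * c = c * b * a.
  move=> sa sb sc; rewrite rmorphM rmorphM (starM starI) (starM starI) sa sb sc.
  rewrite mulrNN mulNr mulrA => /oppr_inj E; apply: finj.
  by rewrite !rmorphM E.
have fe0 : (1 - e) * e = 0 by rewrite mulrBl mul1r ee subrr.
have ef0 : e * (1 - e) = 0 by rewrite mulrBr mulr1 ee subrr.
have zz s1 : z * (e * s1 * (1 - e)) = 0.
  by rewrite /z -!mulrA (mulrA _ e) fe0 mul0r !mulr0.
have zz2 s1 : (e * s1 * (1 - e)) * z = 0.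
  by rewrite /z -!mulrA (mulrA _ e) fe0 mul0r !mulr0.
have z'z' s1 : z' * ((1 - e) * s1 * e) = 0.
  by rewrite /z' -!mulrA (mulrA e) ef0 mul0r !mulr0.
have z'z'2 s1 : ((1 - e) * s1 * e) * z' = 0.
  by rewrite /z' -!mulrA (mulrA e) ef0 mul0r !mulr0.
have comm a b c : a * c = 0 -> c * a = 0 -> a * b * c = c * b * a ->
    (a * b + b * a) * c = c * (a * b + b * a) :> S.
  by move=> ac ca abc; rewrite mulrDl mulrDr -(mulrA b a c) ac !mulrA ca abc mulr0 mul0r addr0 add0r.
have Ce s1 : (z * z' + z' * z) * (e * s1 * (1 - e)) = (e * s1 * (1 - e)) * (z * z' + z' * z).
  apply: comm => //; apply: rev; [exact: fe|exact: ef|exact: fe|].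
  have -> : z * z' * (e * s1 * (1 - e)) = e * (s * (1 - e) * z' * e * s1) * (1 - e).
    by rewrite /z !mulrA.
  exact: fe.
have Cf s1 : (z * z' + z' * z) * ((1 - e) * s1 * e) = ((1 - e) * s1 * e) * (z * z' + z' * z).
  rewrite ![z * z' + _]addrC.
  apply: comm => //; apply: rev; [exact: ef|exact: fe|exact: ef|].
  have -> : z' * z * ((1 - e) * s1 * e) = (1 - e) * (t * e * z * (1 - e) * s1) * e.
    by rewrite /z' !mulrA.
  exact: ef.
have CM a b c : c * a = a * c -> c * b = b * c -> c * (a * b) = a * b * c :> S.
  by move=> ca cb; rewrite mulrA ca -mulrA cb mulrA.
apply: (peirce_span simpleS ee e0) => [||x y Px Py|s1|s1|s1 t1|s1 t1].
- by rewrite subr_eq0 eq_sym; apply/eqP.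
- by rewrite mulr0 mul0r.
- by rewrite (mulrDr _ x y) (mulrDl x y) Px Py.
- exact: Ce.
- exact: Cf.
- exact: CM (Ce _) (Cf _).
- exact: CM (Cf _) (Ce _).
Qed.

(** Off-diagonal elements have trace zero, and the trace of a product [z * z'] of
    two of them is [z * z' + z' * z], so [peirce_span] concludes. *)
Lemma in_local_traces u q : (f u + star (f u)) * f q = f q * (f u + star (f u)).
Proof.
move: u; apply: (peirce_span simpleS ee e0) => [||x y Px Py|s|s|s t|s t].
- by rewrite subr_eq0 eq_sym; apply/eqP.
- by rewrite rmorph0 (star0 starI) addr0 mulr0 mul0r.
- by rewrite rmorphD (starD starI) addrACA mulrDl mulrDr Px Py.
- by rewrite fe subrr mulr0 mul0r.
- by rewrite ef subrr mulr0 mul0r.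
- rewrite (rmorphM f (e * s * _)) (starM starI) ef fe mulrNN -!rmorphM -rmorphD.
  by rewrite -!rmorphM peirce_product_central.
- rewrite (rmorphM f ((1 - e) * s * _)) (starM starI) ef fe mulrNN -!rmorphM -rmorphD.
  by rewrite -!rmorphM addrC peirce_product_central.
Qed.

End LocalSubring.

Lemma nondivision_traces (a : A) : a != 0 -> a \isn't a GRing.unit ->
  traces star setT `<=` range (in_alg A).
Proof.
move=> a0 /negP ua _ [u _ <-]; apply: central_scalar => // q.
have [x [y [Gx Gy xy]]] := nabH.
have [S [f [simpleS dccS finj fS scalS]]] :=
  local_simple_subring alsaA [:: u; q; a; x; y; x^-1].
have inS z : z \in [:: u; q; a; x; y; x^-1] -> exists z', f z' = z.
  by move=> /fS[z' _ <-]; exists z'.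
have [u' uE] : exists z', f z' = u by apply: inS; rewrite !inE eqxx.
have [q' qE] : exists z', f z' = q by apply: inS; rewrite !inE eqxx ?orbT.
have [a' aE] : exists z', f z' = a by apply: inS; rewrite !inE eqxx ?orbT.
have [x' xE] : exists z', f z' = x by apply: inS; rewrite !inE eqxx ?orbT.
have [y' yE] : exists z', f z' = y by apply: inS; rewrite !inE eqxx ?orbT.
have xV : range f x^-1 by apply: fS; rewrite !inE eqxx ?orbT.
have [e [e0 ee divD]] := primitive_idempotent simpleS dccS.
have en1 : e <> 1.
  move=> e1; apply: ua; have a'0 : a' != 0.
    by apply: contra_neq a0 => E; rewrite -aE E rmorph0.
  have [||v [va av _ _]] := divD a' a'0; rewrite ?e1 ?mul1r ?mulr1 //.
  by apply/unitrP; exists (f v); rewrite -aE -!rmorphM va av e1 rmorph1.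
rewrite -uE -qE; apply: (in_local_traces simpleS finj scalS (g := x') (h := y') _ _ e0 ee en1 divD).
- by rewrite xE.
- by move=> E; move/eqP: xy; case; rewrite -xE -yE -!rmorphM E.
- by rewrite xE.
Qed.

End NonDivisionTraces.

(** * Commuting and finite subsets of a division ring *)

(** An orbit contained in a set with [n] elements has at most [n] elements, so its
    length divides [n`!]. *)
Lemma finite_orbit (T : eqType) (g : T -> T) (t : seq T) (x : T) :
    injective g -> (forall i, iter i g x \in t) ->
  iter (size t)`! g x = x.
Proof.
move=> ginj gt.
have /(uniqPn x)[i [j [ij]]] : ~~ uniq (traject g x (size t).+1).
  apply/negP => /uniq_leq_size le; suff : (size (traject g x (size t).+1) <= size t)%N.
    by rewrite size_traject ltnn.
  by apply: le => y /trajectP[i _ ->].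
rewrite size_traject => jt; rewrite !nth_traject ?(ltn_trans ij) // => E.
have {}E : iter (j - i) g x = x.
  have iginj : injective (iter i g).
    by elim: i {ij E} => // i IH u v /= /ginj /IH.
  by apply: iginj; rewrite -iterD subnKC ?(ltnW ij).
have /dvdnP[k ->] : (j - i %| (size t)`!)%N.
  by apply: dvdn_fact; rewrite subn_gt0 ij /= leq_subLR (leq_trans _ (leq_addl _ _)).
by elim: k => // k IH; rewrite mulSn iterD IH.
Qed.

Section Division.
Variable A : unitRingType.
Hypothesis divA : division_ring A.

Lemma div_mul_eq0 (a b : A) : a * b = 0 -> a = 0 \/ b = 0.
Proof.
move=> ab; have [->|a0] := eqVneq a 0; first by left.
by right; rewrite -[b](mulKr (divA a0)) ab mulr0.
Qed.

Lemma div_mul_neq0 (a b : A) : a != 0 -> b != 0 -> a * b != 0.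
Proof. by move=> a0 b0; apply/eqP => /div_mul_eq0[]; exact/eqP. Qed.

Lemma prod_eq0 (s : seq A) (g : A -> A) :
  \prod_(x <- s) g x = 0 <-> exists2 x, x \in s & g x = 0.
Proof.
elim: s => [|y s IH].
  by rewrite big_nil; split=> [/eqP|[]//]; rewrite oner_eq0.
rewrite big_cons; split=> [/div_mul_eq0[y0|/IH[x xs x0]]|[x]].
- by exists y; rewrite ?inE ?eqxx.
- by exists x; rewrite // inE xs orbT.
- rewrite inE => /predU1P[->->|xs x0]; first by rewrite mul0r.
  by rewrite (IH.2 _) ?mulr0 //; exists x.
Qed.

(** An identity between two products of linear factors that holds at infinitely
    many points is an identity of polynomials, so the factors of one side produce
    roots of the other. *)
Lemma linear_factors (xs ys : seq A) (S : set A) : infinite_set S ->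
    (forall a b, S a -> S b -> GRing.comm a b) ->
    (forall a x, S a -> x \in xs ++ ys -> GRing.comm a x) ->
    (forall x y, x \in xs -> y \in xs ++ ys -> GRing.comm x y) ->
    (forall a, S a -> \prod_(x <- xs) (a + x) = \prod_(y <- ys) (a + y)) ->
  {subset xs <= ys}.
Proof.
move=> Sinf SC SxC xC agree x xxs.
pose P (s : seq A) := \prod_(x <- s) ('X + x%:P) : {poly A}.
have hornerP a s : (forall y, y \in s -> GRing.comm a y) -> comm_poly (P s) a /\
    (P s).[a] = \prod_(y <- s) (a + y).
  rewrite /P; elim: s => [|y s IH] aC.
    by rewrite !big_nil hornerC; split=> //; exact: comm_poly1.
  have [z zs|Pa PE] := IH; first by apply: aC; rewrite inE zs orbT.
  have ya : comm_poly ('X + y%:P) a.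
    by rewrite /comm_poly !hornerE mulrDl mulrDr (aC y) // inE eqxx.
  rewrite !big_cons; split; first exact: comm_polyM.
  by rewrite hornerM_comm // PE !hornerE.
have Puniq n : exists s : seq A, [/\ size s = n, uniq_roots s & forall a, a \in s -> S a].
  elim: n => [|n [s [ss us sS]]]; first by exists [::].
  have [a Sa aNs] : exists2 a, S a & a \notin s.
    apply: contrapT => no; apply: Sinf; apply: (sub_finite_set _ (finite_seq s)).
    by move=> a Sa /=; apply: contrapT => /negP ?; apply: no; exists a.
  exists (a :: s); split; rewrite /= ?ss //.
    rewrite us andbT; apply/allP => b bs; rewrite /diff_roots.
    rewrite (SC a b Sa (sS b bs)) eqxx /=; apply: divA.
    by rewrite subr_eq0; apply: contraNneq aNs => <-.
  by move=> b; rewrite inE => /predU1P[->|/sS].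
have E : P xs = P ys.
  apply/eqP; rewrite -subr_eq0; apply/negPn/negP => p0.
  have [s [ss us sS]] := Puniq (size (P xs - P ys)).
  have := max_ring_poly_roots p0 _ us; rewrite ss ltnn => absurd.
  suff /absurd : all (root (P xs - P ys)) s by [].
  apply/allP => a /sS Sa; rewrite /root hornerD hornerN.
  have [|_ ->] := hornerP a xs.
    by move=> y ys'; apply: SxC => //; rewrite mem_cat ys'.
  have [|_ ->] := hornerP a ys.
    by move=> y ys'; apply: SxC => //; rewrite mem_cat ys' orbT.
  by rewrite agree // subrr.
have [y yxs|_ Ex] := hornerP (- x) xs.
  by apply: commr_sym; apply: commrN; apply: commr_sym; apply: xC; rewrite // mem_cat yxs.
have [y yys|_ Ey] := hornerP (- x) ys.
  by apply: commr_sym; apply: commrN; apply: commr_sym; apply: xC; rewrite // mem_cat yys orbT.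
have [|y yys /eqP] := (prod_eq0 ys (fun y => - x + y)).1.
  by rewrite -Ey -E Ex; apply/prod_eq0; exists x; rewrite // addNr.
by rewrite addrC subr_eq0 => /eqP <-.
Qed.

End Division.

(** * Conjugation and its coboundaries on commutative subfields *)

Section CommutativeSubfields.
Variable A : unitRingType.
Hypothesis divA : division_ring A.

Definition centralizer (X : set A) := [set u | forall x, X x -> GRing.comm u x].

Definition division_subring (E : set A) := [/\ E 1, forall x y, E x -> E y -> E (x - y),
  forall x y, E x -> E y -> E (x * y) & forall x, E x -> E x^-1].

Definition commutative_subfield (E : set A) :=
  division_subring E /\ forall x y, E x -> E y -> GRing.comm x y.

Lemma centralizer_division_subring X : division_subring (centralizer X).
Proof.
split=> [x _|x y Cx Cy u Xu|x y Cx Cy u Xu|x Cx u Xu].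
- exact: commr_sym (commr1 x).
- by apply/commr_sym/commrB; apply/commr_sym; [exact: Cx|exact: Cy].
- by apply/commr_sym/commrM; apply/commr_sym; [exact: Cx|exact: Cy].
- by apply/commr_sym/commrV; apply/commr_sym; exact: Cx.
Qed.

Lemma division_subring0 E : division_subring E -> E 0.
Proof. by move=> [E1 EB _ _]; rewrite -(subrr 1); exact: EB. Qed.

Lemma division_subringN E x : division_subring E -> E x -> E (- x).
Proof. by move=> sE Ex; case: (sE) => _ EB _ _; rewrite -sub0r; apply: EB => //; exact: division_subring0. Qed.

Lemma division_subringD E x y : division_subring E -> E x -> E y -> E (x + y).
Proof.
move=> sE Ex Ey; case: (sE) => _ EB _ _; rewrite -[y]opprK; apply: EB => //.
exact: division_subringN.
Qed.

Lemma division_subringM E x y : division_subring E -> E x -> E y -> E (x * y).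
Proof. by case=> _ _ + _; apply. Qed.

Lemma division_subringV E x : division_subring E -> E x -> E x^-1.
Proof. by case=> _ _ _; apply. Qed.

Lemma division_subringX E x n : division_subring E -> E x -> E (x ^+ n).
Proof.
move=> sE Ex; elim: n => [|n IH]; first by case: sE; rewrite expr0.
by rewrite exprS; exact: division_subringM.
Qed.

Definition bicommutant (X : set A) := centralizer (centralizer X).

Lemma bicommutant_sub X : X `<=` bicommutant X.
Proof. by move=> x Xx u Cu; apply: commr_sym; exact: Cu. Qed.

Lemma bicommutant_subfield X : (forall x y, X x -> X y -> GRing.comm x y) ->
  commutative_subfield (bicommutant X).
Proof.
move=> XC; split; first exact: centralizer_division_subring.
move=> x y Ex Ey; apply: Ex => z Xz; apply: Ey => t Xt; exact: XC.
Qed.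

Definition Ad (y x : A) := y * x * y^-1.

Lemma Ad1 y : y != 0 -> Ad y 1 = 1.
Proof. by move=> y0; rewrite /Ad mulr1 mulrV // divA. Qed.

Lemma AdD y u v : Ad y (u + v) = Ad y u + Ad y v.
Proof. by rewrite /Ad mulrDr mulrDl. Qed.

Lemma AdN y u : Ad y (- u) = - Ad y u.
Proof. by rewrite /Ad mulrN mulNr. Qed.

Lemma AdB y u v : Ad y (u - v) = Ad y u - Ad y v.
Proof. by rewrite AdD AdN. Qed.

Lemma Ad0 y : Ad y 0 = 0.
Proof. by rewrite /Ad mulr0 mul0r. Qed.

Lemma AdM y u v : y != 0 -> Ad y (u * v) = Ad y u * Ad y v.
Proof. by move=> y0; rewrite /Ad !mulrA mulrVK // divA. Qed.

Lemma AdX y u n : y != 0 -> Ad y (u ^+ n) = Ad y u ^+ n.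
Proof. by move=> y0; elim: n => [|n IH]; rewrite ?Ad1 // !exprS AdM // IH. Qed.

Lemma Ad_inj y : y != 0 -> injective (Ad y).
Proof.
by move=> y0 u v /(congr1 (fun w => y^-1 * w * y)); rewrite /Ad !mulrA mulVr ?divA // !mul1r !mulrVK // divA.
Qed.

Lemma Ad_neq0 y u : y != 0 -> u != 0 -> Ad y u != 0.
Proof. by move=> y0; apply: contra_neq => E; apply: (Ad_inj y0); rewrite Ad0. Qed.

Lemma AdV y u : y != 0 -> Ad y u^-1 = (Ad y u)^-1.
Proof.
move=> y0; have [->|u0] := eqVneq u 0; first by rewrite invr0 Ad0 invr0.
have uy := divA y0; have uu := divA u0.
by rewrite /Ad invrM ?unitrV ?unitrMl // invrM // invrK mulrA.
Qed.

Lemma Ad_mul y u : y != 0 -> y * u = Ad y u * y.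
Proof. by move=> y0; rewrite /Ad mulrVK // divA. Qed.

Lemma Ad_fixP y u : y != 0 -> Ad y u = u <-> GRing.comm y u.
Proof.
move=> y0; split=> [E|E]; first by rewrite /GRing.comm Ad_mul // E.
by rewrite /Ad E mulrK // divA.
Qed.

Lemma Ad_comp y z u : y != 0 -> z != 0 -> Ad (y * z) u = Ad y (Ad z u).
Proof. by move=> y0 z0; rewrite /Ad invrM ?divA // !mulrA. Qed.

Lemma div_expf_neq0 (u : A) n : u != 0 -> u ^+ n != 0.
Proof.
move=> u0; elim: n => [|n IH]; first by rewrite oner_eq0.
by rewrite exprS; exact: div_mul_neq0.
Qed.

Lemma iter_Ad y i u : y != 0 -> iter i (Ad y) u = Ad (y ^+ i) u.
Proof.
move=> y0; elim: i => [|i IH]; first by rewrite /Ad expr0 mul1r invr1 mulr1.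
by rewrite iterS IH exprS Ad_comp // div_expf_neq0.
Qed.

(** The multiplicative coboundary of conjugation by [y], also the commutator
    of [c] and [y]. *)
Definition twist (y c : A) := c * (Ad y c)^-1.

Section Twist.
Variables (E : set A) (y : A).
Hypotheses (fieldE : commutative_subfield E) (y0 : y != 0).
Hypothesis yE : forall c, E c -> E (Ad y c).

Local Notation s := (Ad y).
Local Notation f := (twist y).
Let sE : division_subring E := fieldE.1.
Let EC := fieldE.2.

Lemma twist_neq0 c : c != 0 -> f c != 0.
Proof.
move=> c0; apply: div_mul_neq0 => //; apply: contra_neq (Ad_neq0 y0 c0) => E0.
by rewrite -[LHS]invrK E0 invr0.
Qed.

Lemma twist_mul c : c != 0 -> f c * s c = c.
Proof. by move=> c0; rewrite /twist mulrVK // divA // Ad_neq0. Qed.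

Lemma twist_eq1 c : c != 0 -> f c = 1 -> s c = c.
Proof. by move=> c0 fc; rewrite -{2}(twist_mul c0) fc mul1r. Qed.

Lemma iter_twist_neq0 k c : c != 0 -> iter k f c != 0.
Proof. by move=> c0; elim: k => //= k; exact: twist_neq0. Qed.

Lemma twist_in c : E c -> E (f c).
Proof.
by move=> Ec; apply: division_subringM => //; apply: division_subringV => //; exact: yE.
Qed.

Lemma iter_twist_in k c : E c -> E (iter k f c).
Proof. by move=> Ec; elim: k => //= k; exact: twist_in. Qed.

Lemma twistM c d : c != 0 -> d != 0 -> E c -> E d -> f (c * d) = f c * f d.
Proof.
move=> c0 d0 Ec Ed; rewrite /twist AdM // invrM ?divA ?Ad_neq0 //.
rewrite -!mulrA; congr (_ * _); rewrite !mulrA.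
have Esc := division_subringV sE (yE Ec); have Esd := division_subringV sE (yE Ed).
rewrite -[RHS]mulrA; apply: EC => //; exact: division_subringM.
Qed.

Lemma twist1 : f 1 = 1. Proof. by rewrite /twist Ad1 // invr1 mulr1. Qed.

Lemma twistX c n : c != 0 -> E c -> f (c ^+ n) = f c ^+ n.
Proof.
move=> c0 Ec; elim: n => [|n IH]; first exact: twist1.
rewrite !exprS twistM ?IH //; last exact: division_subringX.
exact: div_expf_neq0.
Qed.

Lemma iter_twistX k c n : c != 0 -> E c -> iter k f (c ^+ n) = iter k f c ^+ n.
Proof.
move=> c0 Ec; elim: k => //= k ->; rewrite twistX //; first exact: iter_twist_neq0.
exact: iter_twist_in.
Qed.

Lemma iter_Ad_in i c : E c -> E (iter i s c).
Proof. by move=> Ec; elim: i => //= i; exact: yE. Qed.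

Let C0 := [set a | E a /\ s a = a].

(** If [k.+2] coboundaries give one, then [k.+1] give an invariant element, which is
    trivial after raising to the power [n]; and powers commute with coboundaries. *)
Lemma power_descent n : (0 < n)%N ->
    (forall b, E b -> b != 0 -> s (f b) = f b -> f b ^+ n = 1) ->
    forall k N, (0 < N)%N -> (forall c, E c -> c != 0 -> iter k.+1 f (c ^+ N) = 1) ->
  exists2 N, (0 < N)%N & forall c, E c -> c != 0 -> s (c ^+ N) = c ^+ N.
Proof.
move=> n0 fn; elim=> [|k IH] N N0 fN.
  exists N => // c Ec c0; apply: twist_eq1; first exact: div_expf_neq0.
  exact: fN.
apply: (IH (N * n)%N); first by rewrite muln_gt0 N0.
move=> c Ec c0; rewrite exprM iter_twistX ?div_expf_neq0 //; last exact: division_subringX.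
apply: fn.
- by apply: iter_twist_in; exact: division_subringX.
- by apply: iter_twist_neq0; exact: div_expf_neq0.
- apply: twist_eq1 (fN c Ec c0); apply: (iter_twist_neq0 k.+1); exact: div_expf_neq0.
Qed.

Lemma finite_exponent (X : set A) : finite_set X -> X 1 ->
    (forall u v, X u -> X v -> X (u * v)) ->
  exists2 n, (0 < n)%N & forall d, X d -> d != 0 -> d ^+ n = 1.
Proof.
move=> /finite_seqP[t XE] X1 XM; exists (size t)`!; first exact: fact_gt0.
move=> d Xd d0; have itE i : iter i ( *%R d) 1 = d ^+ i by rewrite iter_mulr_1.
rewrite -itE; apply: finite_orbit; first exact: mulrI (divA d0).
move=> i; have : X (iter i ( *%R d) 1) by elim: i => //= i; exact: XM.
by rewrite XE.
Qed.

Lemma linear_powers (S : set A) n c d : infinite_set S -> S `<=` E -> E c -> E d ->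
    (0 < n)%N -> (forall a, S a -> (a + c) ^+ n = (a + d) ^+ n) -> c = d.
Proof.
move=> Sinf SE Ec Ed n0 Scd.
have prodE a (u : A) : \prod_(x <- nseq n u) (a + x) = (a + u) ^+ n.
  by rewrite big_nseq iter_mulr_1.
have inE2 x : x \in nseq n c ++ nseq n d -> E x.
  by rewrite mem_cat !mem_nseq => /orP[]/andP[_ /eqP->].
have : {subset nseq n c <= nseq n d}.
  apply: (@linear_factors A divA _ _ S) => //.
  - by move=> a b /SE Ea /SE Eb; exact: EC.
  - by move=> a x /SE Ea /inE2 Ex; exact: EC.
  - by move=> u v; rewrite mem_nseq => /andP[_ /eqP->] /inE2; exact: EC.
  - by move=> a Sa; rewrite !prodE Scd.
by move/(_ c); rewrite !mem_nseq n0 eqxx => /(_ isT) /eqP.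
Qed.

(** Otherwise [a] and [a + 1] have the same [n]-th power for infinitely many [a]. *)
Lemma bounded_exponent_finite n : (0 < n)%N ->
  (forall c, E c -> c != 0 -> c ^+ n = 1) -> finite_set E.
Proof.
move=> n0 En; apply: contrapT => Einf; have [E1 _ _ _] := sE.
suff /esym/eqP : 0 = 1 :> A by rewrite oner_eq0.
apply: (@linear_powers (E `\` [set` [:: 0; - 1]]) n) => //; try exact: division_subring0.
- by apply: infinite_setD => //; exact: finite_seq.
- move=> a [Ea /= /negP]; rewrite !inE negb_or => /andP[a0 a1].
  by rewrite addr0 !En // ?addr_eq0 //; exact: division_subringD.
Qed.

(** If the invariants were finite, invariant coboundaries would have bounded order,
    and [power_descent] would bound the order of all elements of [E]. *)
Lemma infinite_fixed_subfield k : infinite_set E ->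
  (forall c, E c -> c != 0 -> iter k.+1 f c = 1) -> infinite_set C0.
Proof.
move=> Einf fk C0fin; have [E1 _ EM _] := sE.
have [m m0 Xm] : exists2 n, (0 < n)%N & forall d, C0 d -> d != 0 -> d ^+ n = 1.
  apply: finite_exponent => //; first by split=> //; exact: Ad1.
  move=> u v [Eu su] [Ev sv]; split; first exact: EM.
  by rewrite AdM // su sv.
have [||N N0 sN] := @power_descent m m0 _ k 1 isT.
- move=> b Eb b0 sb; apply: Xm; last exact: twist_neq0.
  by split=> //; exact: twist_in.
- by move=> c Ec c0; rewrite expr1; exact: fk.
apply: Einf; apply: (@bounded_exponent_finite (N * m)); first by rewrite muln_gt0 N0.
move=> c Ec c0; rewrite exprM; apply: Xm; last exact: div_expf_neq0.
by split; [exact: division_subringX | exact: sN].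
Qed.

(** On translates of [c] by invariant elements, an iterated coboundary is a quotient
    of two products of linear factors at the conjugates of [c]. *)
Lemma iter_twist_factors c k : E c -> exists xs ys : seq A,
  [/\ c \in xs, forall x, x \in xs -> E x,
    forall x, x \in ys -> exists2 i, (0 < i <= k)%N & x = iter i s c &
    forall a, C0 a -> a + c != 0 ->
      iter k f (a + c) * \prod_(y <- ys) (a + y) = \prod_(x <- xs) (a + x)].
Proof.
move=> Ec; suff [xs [ys [cxs xsE ysE prodE]]] : exists xs ys : seq A,
  [/\ c \in xs, forall x, x \in xs -> exists2 i, (i <= k)%N & x = iter i s c,
    forall x, x \in ys -> exists2 i, (0 < i <= k)%N & x = iter i s c &
    forall a, C0 a -> a + c != 0 ->
      iter k f (a + c) * \prod_(y <- ys) (a + y) = \prod_(x <- xs) (a + x)].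
  exists xs, ys; split=> // x /xsE[i _ ->]; exact: iter_Ad_in.
elim: k => [|k [xs [ys [cxs xsE ysE prodE]]]].
  exists [:: c], [::]; split=> // [|x|a _ _]; first by rewrite inE.
    by rewrite inE => /eqP->; exists 0%N.
  by rewrite big_nil big_seq1 mulr1.
exists (xs ++ map s ys), (ys ++ map s xs); split.
- by rewrite mem_cat cxs.
- move=> x; rewrite mem_cat => /orP[/xsE[i ik ->]|/mapP[z /ysE[i /andP[_ ik] ->] ->]].
    by exists i => //; exact: leqW.
  by exists i.+1.
- move=> x; rewrite mem_cat => /orP[/ysE[i /andP[i0 ik] ->]|/mapP[z /xsE[i ik ->] ->]].
    by exists i => //; rewrite i0 leqW.
  by exists i.+1.
- move=> a C0a ac0; have [Ea sa] := C0a.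
  have sprod zs : \prod_(z <- map s zs) (a + z) = s (\prod_(z <- zs) (a + z)).
    elim: zs => [|z zs IH]; first by rewrite !big_nil Ad1.
    by rewrite !big_cons IH AdM // AdD sa.
  have inP zs : (forall z, z \in zs -> exists i, z = iter i s c) ->
      E (\prod_(z <- zs) (a + z)).
    elim: zs => [|z zs IH] zsE; first by rewrite big_nil; case: sE.
    rewrite big_cons; apply: division_subringM => //.
      have [|i ->] := zsE z; first by rewrite inE eqxx.
      by apply: division_subringD => //; exact: iter_Ad_in.
    by apply: IH => u uzs; apply: zsE; rewrite inE uzs orbT.
  rewrite !big_cat !sprod /= -!prodE // AdM //.
  set F := iter k f (a + c).
  have F0 : F != 0 by exact: iter_twist_neq0.
  have EF : E F by apply: iter_twist_in; exact: division_subringD.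
  set q := \prod_(y <- ys) _.
  have Eq : E q by apply: inP => z /ysE[i _ ->]; exists i.
  have EsF := yE EF; have Esq := yE Eq.
  have -> : q * (s F * s q) = s F * (q * s q).
    by rewrite (mulrA q) (EC Eq EsF) -(mulrA (s F)).
  by rewrite (mulrA (f F)) twist_mul // mulrA.
Qed.

(** Iterated coboundaries of a nontrivial automorphism of an infinite field are not
    all trivial. Otherwise the invariants are infinite, translating by them shows
    that each element has finitely many conjugates; then the last nontrivial coboundary
    is an invariant root of unity, so that some power of every element is invariant,
    and translating again, the elements themselves are. *)
Lemma iter_twist_trivial k : infinite_set E ->
  (forall c, E c -> c != 0 -> iter k f c = 1) -> forall c, E c -> s c = c.
Proof.
case: k => [|k] Einf fk; have [E1 _ _ _] := sE.
  move=> c Ec; have [->|c0] := eqVneq c 0; first by rewrite Ad0.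
  by have /= -> := fk c Ec c0; exact: Ad1.
have C0inf := infinite_fixed_subfield Einf fk.
have setD c : infinite_set (C0 `\` [set - c]).
  by apply: infinite_setD => //; exact: finite_set1.
have period c : E c -> iter (k.+1)`! s c = c.
  move=> Ec; have [xs [ys [cxs xsE ysE prodE]]] := iter_twist_factors k.+1 Ec.
  have ysE' u : u \in ys -> E u by move=> /ysE[i _ ->]; exact: iter_Ad_in.
  have xysE x : x \in xs ++ ys -> E x by rewrite mem_cat => /orP[/xsE|/ysE'].
  have : {subset xs <= ys}.
    apply: (@linear_factors A divA _ _ (C0 `\` [set - c])) => //.
    - by move=> a b [[Ea _] _] [[Eb _] _]; exact: EC.
    - by move=> a x [[Ea _] _] /xysE; exact: EC.
    - by move=> x z /xsE Ex /xysE; exact: EC.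
    - move=> a [C0a /eqP]; rewrite -addr_eq0 => ac0.
      rewrite -prodE // fk ?mul1r //; first by case: C0a => Ea _; exact: division_subringD.
  move/(_ c cxs)/ysE => [i /andP[i0 ik] iE].
  have /dvdnP[m ->] : (i %| (k.+1)`!)%N by rewrite dvdn_fact // i0.
  by elim: m => // m IH; rewrite mulSn iterD IH -iE.
have [||N N0 sN] := @power_descent (k.+1)`! (fact_gt0 _) _ k 1 isT.
- move=> b Eb b0 sfb; have f0 := twist_neq0 b0.
  suff itE i : iter i s b = (f b ^- i) * b.
    move: (itE (k.+1)`!); rewrite period // => E'.
    by apply: invr_inj; rewrite invr1; apply: (mulIr (divA b0)); rewrite -E' mul1r.
  elim: i => [|i IH]; first by rewrite expr0 invr1 mul1r.
  rewrite iterS IH AdM // AdV // AdX // sfb exprS invrM ?divA ?div_expf_neq0 //.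
  rewrite -(mulrA _ _ b); congr (_ * _); apply: (mulrI (divA f0)).
  by rewrite mulVKr ?divA // twist_mul.
- by move=> c Ec c0; rewrite expr1; exact: fk.
move=> c Ec; apply/esym/(@linear_powers (C0 `\` [set - c]) N) => //.
- by move=> a [[]].
- exact: yE.
- move=> a [[Ea sa] /eqP]; rewrite -addr_eq0 => ac0.
  by rewrite -sN ?AdX // ?AdD ?sa //; exact: division_subringD.
Qed.

End Twist.
End CommutativeSubfields.

(** * Finite subrings *)

Section FiniteSubring.
Variables (A : unitRingType) (t : seq A).

Definition fin_subring of GRing.divring_closed (mem t) := seq_sub t.
Variable ringt : GRing.divring_closed (mem t).
Local Notation T := (fin_subring ringt).

HB.instance Definition _ := Finite.copy T (seq_sub t).
HB.instance Definition _ := SubChoice.copy T (seq_sub t).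
HB.instance Definition _ := GRing.SubChoice_isSubUnitRing.Build A (mem t) T ringt.
End FiniteSubring.

Section Wedderburn.
Variable A : unitRingType.
Hypothesis divA : division_ring A.

(** Wedderburn's little theorem, the subring being repackaged as a finite type. *)
Lemma finite_subring_commutative (B : set A) : finite_set B -> B 1 ->
    (forall x y, B x -> B y -> B (x - y)) -> (forall x y, B x -> B y -> B (x * y)) ->
  forall x y, B x -> B y -> x * y = y * x.
Proof.
move=> Bfin B1 BB BM.
have [n n0 Bn] := finite_exponent divA Bfin B1 BM.
have [t BE] := (finite_seqP B).1 Bfin.
have tP x : (x \in t) = `[< B x >] by apply/idP/asboolP; rewrite BE.
have ringt : GRing.divring_closed (mem t).
  split=> [|x y|x y]; rewrite ?inE /= !tP; first exact/asboolP.
    by move=> /asboolP Bx /asboolP By; apply/asboolP; exact: BB.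
  move=> /asboolP Bx /asboolP By; apply/asboolP/BM => //.
  have [->|y0] := eqVneq y 0; first by rewrite invr0 -(subrr 1); exact: BB.
  have -> : y^-1 = y ^+ n.-1.
    by apply: (mulrI (divA y0)); rewrite mulrV ?divA // -exprS prednK // Bn.
  by elim: n.-1 => [|k IH]; rewrite ?expr0 // exprS; exact: BM.
have domT : GRing.integral_domain_axiom (fin_subring ringt).
  move=> u v /(congr1 val); rewrite rmorphM rmorph0 => /(div_mul_eq0 divA)[] u0.
    by apply/orP; left; apply/eqP/val_inj; rewrite rmorph0.
  by apply/orP; right; apply/eqP/val_inj; rewrite rmorph0.
move=> x y Bx By; have xt : x \in t by rewrite tP; exact/asboolP.
have yt : y \in t by rewrite tP; exact/asboolP.
have := congr1 val (finDomain_mulrC domT (SeqSub xt) (SeqSub yt)).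
by rewrite !rmorphM.
Qed.

Fixpoint power_span (E : set A) (y : A) (i : nat) : set A :=
  if i is j.+1 then [set b + e * y ^+ j | b in power_span E y j & e in E] else [set 0].

(** Otherwise [E] and [y] would generate a finite noncommutative division ring. *)
Lemma finite_normalized_fixed (E : set A) (y : A) N : finite_set E -> division_subring E ->
    y != 0 -> (forall e, E e -> E (Ad y e)) -> (0 < N)%N -> y ^+ N = 1 ->
  forall e, E e -> y * e = e * y.
Proof.
move=> Efin sE y0 yE N0 yN; have [E1 EB EM _] := sE; have E0 := division_subring0 sE.
pose B := power_span E y.
have BE i e : E e -> B i.+1 e.
  elim: i e => [|i IH] e Ee; first by exists 0 => //; exists e; rewrite // add0r expr0 mulr1.
  by exists e; [exact: IH|exists 0; rewrite // mul0r addr0].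
have BB i b c : B i b -> B i c -> B i (b - c).
  elim: i b c => [b c -> ->|i IH _ _ [b Bb [e Ee <-]] [c Bc [d Ed <-]]] /=; first by rewrite subr0.
  exists (b - c); [exact: IH | exists (e - d); first exact: EB].
  by rewrite mulrBl opprD addrACA.
have B0 i : B i 0 by case: i => // i; exact: BE.
have BD i b c : B i b -> B i c -> B i (b + c).
  by move=> Bb Bc; rewrite -[c]opprK; apply: (BB) => //; rewrite -sub0r; exact: BB.
have Be i b e : B i b -> E e -> B i (b * e).
  elim: i b e => [b e -> _|i IH _ e [b Bb [c Ec <-]] Ee] /=; first by rewrite mul0r.
  exists (b * e); [exact: IH | exists (c * iter i (Ad y) e)].
    by apply: EM => //; exact: iter_Ad_in.
  rewrite mulrDl -(mulrA c _ e) (Ad_mul divA e (div_expf_neq0 divA i y0)).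
  by rewrite iter_Ad // (mulrA c).
have By i b : B i b -> B i.+1 (b * y).
  elim: i b => [b ->|i IH _ [b Bb [e Ee <-]]]; first by rewrite mul0r; exact: BE.
  by exists (b * y); [exact: IH | exists e; rewrite // mulrDl -mulrA -exprSr].
have ByN b : B N b -> B N (b * y).
  move=> /By[c Bc [e Ee <-]]; rewrite yN mulr1; apply: BD => //.
  by case: (N) N0 => // i _; exact: BE.
have BM i b u : B i u -> B N b -> B N (b * u).
  elim: i b u => [b u -> _|i IH b _ [u Bu [e Ee <-]] Bb] /=; first by rewrite mulr0.
  rewrite mulrDr; apply: BD; first exact: IH.
  rewrite mulrA; have := Be _ _ _ Bb Ee; move: (b * e).
  elim: (i) => [|j IHj] c Bc; first by rewrite expr0 mulr1.
  by rewrite exprS mulrA; apply: IHj; exact: ByN.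
have BN1 : B N 1 by case: (N) N0 => // i _; exact: BE.
have Bfin i : finite_set (B i).
  elim: i => [|i IH]; first exact: finite_set1.
  exact: (finite_image2 (fun b e => b + e * y ^+ i)).
move=> e Ee; apply: (finite_subring_commutative (Bfin N)) => //.
- exact: BB.
- by move=> u v Bu Bv; exact: BM Bv Bu.
- by rewrite -[y]mul1r; exact: ByN.
- by case: (N) N0 => // i _; exact: BE.
Qed.

End Wedderburn.

(** * Subnormal subgroups of a division ring *)

Section SubnormalChains.
Variable A : unitRingType.
Hypothesis divA : division_ring A.

Definition conjugates_subgroup (x : A) (C : set A) : set A :=
  smallest (@unit_subgroup A) [set Ad s x | s in C].

Definition conjugates_series (x : A) (C : set A) (k : nat) : set A :=
  iter k (conjugates_subgroup x) C.

Lemma usubg_neq0 (C : set A) x : unit_subgroup C -> C x -> x != 0.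
Proof. by move=> sC Cx; apply: contraTneq (usubg_unit sC Cx) => ->; rewrite unitr0. Qed.

Lemma unit_subgroupI (C P : set A) : unit_subgroup C -> P 1 ->
  (forall x y, C x -> C y -> P x -> P y -> P (x / y)) -> unit_subgroup (C `&` P).
Proof.
move=> sC P1 PV; split=> [x [Cx _]|]; first exact: (usubg_unit sC).
split=> [|x y]; rewrite !inE; first by split=> //; exact: usubg1.
by move=> [Cx Px] [Cy Py]; split; [exact: usubg_div | exact: PV].
Qed.

Section ConjugatesSubgroup.
Variables (x : A) (C : set A).
Hypotheses (sC : unit_subgroup C) (Cx : C x).
Local Notation D := (conjugates_subgroup x C).

Lemma conjugates_in s : C s -> D (Ad s x).
Proof. by move=> Cs B [_ sB]; apply: sB; exists s. Qed.

Lemma conjugates_subgroup_mem : D x.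
Proof.
have := conjugates_in (usubg1 sC); rewrite /Ad.
by rewrite invr1 mulr1 mul1r.
Qed.

Lemma Ad_in u v : C u -> C v -> C (Ad u v).
Proof. by move=> Cu Cv; apply: usubg_div => //; exact: usubgM. Qed.

Lemma conjugates_subgroup_sub : D `<=` C.
Proof. by move=> z; apply; split=> // _ [s Cs <-]; exact: Ad_in. Qed.

Lemma conjugates_subgroup_subgroup : unit_subgroup D.
Proof.
split=> [z /conjugates_subgroup_sub|]; first exact: usubg_unit.
split=> [|u v]; rewrite !inE; first by move=> B [sB _]; exact: usubg1.
by move=> Du Dv B sB; apply: usubg_div; [case: sB|exact: Du|exact: Dv].
Qed.

Lemma conjugates_subgroup_ind (P : set A) : P 1 ->
    (forall u v, D u -> D v -> P u -> P v -> P (u / v)) ->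
    (forall s, C s -> P (Ad s x)) ->
  D `<=` P.
Proof.
move=> P1 PV PAd z Dz; suff : (D `&` P) z by case.
apply: (Dz); split; first exact: (unit_subgroupI conjugates_subgroup_subgroup).
by move=> _ [s Cs <-]; split; [exact: conjugates_in | exact: PAd].
Qed.

Lemma conjugates_subgroup_normal : normal_in D C.
Proof.
split; first exact: conjugates_subgroup_sub.
move=> z k Dz Ck; have k0 := usubg_neq0 sC Ck; have sD := conjugates_subgroup_subgroup.
move: z Dz; apply: (@conjugates_subgroup_ind [set z | D (k * z / k)]) => [|u v Du Dv Pu Pv|s Cs] /=.
- by rewrite mulr1 mulrV ?(usubg_unit sC) //; exact: usubg1.
- have v0 := usubg_neq0 sD Dv; have -> : k * (u / v) / k = Ad k (u / v) by [].
  by rewrite AdM // AdV //; exact: (usubg_div sD Pu Pv).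
- rewrite -[_ / k]/(Ad k _) -Ad_comp ?(usubg_neq0 sC Cs) //.
  by apply: conjugates_in; exact: usubgM.
Qed.

End ConjugatesSubgroup.

Lemma conjugates_series_subgroup x C k : unit_subgroup C -> C x ->
  unit_subgroup (conjugates_series x C k) /\ conjugates_series x C k x.
Proof.
move=> sC Cx; elim: k => [//|k [sD Dx]].
by split; [exact: conjugates_subgroup_subgroup | exact: conjugates_subgroup_mem].
Qed.

Lemma conjugates_series_sub x C k l : unit_subgroup C -> C x -> (k <= l)%N ->
  conjugates_series x C l `<=` conjugates_series x C k.
Proof.
move=> sC Cx /subnK <-; elim: (l - k)%N => // n IH z.
have [sD Dx] := conjugates_series_subgroup (n + k) sC Cx.
by move/(conjugates_subgroup_sub sD Dx); exact: IH.
Qed.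

Section Chain.
Variables (r : nat) (H : nat -> set A).
Hypothesis chainH : subnormal_chain r H.

Let Hr : H r = units A. Proof. by case: chainH. Qed.
Let subH i : (i <= r)%N -> unit_subgroup (H i). Proof. by case: chainH => _ + _; apply. Qed.
Let normH i : (i < r)%N -> normal_in (H i) (H i.+1). Proof. by case: chainH => _ _; apply. Qed.

(** As [x] is in [H i.-1], which [H i] normalizes, so is its conjugate by [s]; this
    includes [i = 0], where [i.-1] is [0]. *)
Lemma chain_Ad i x s : (i <= r)%N -> H 0%N x -> H i s -> H i.-1 (Ad s x).
Proof.
case: i => [_ Hx Hs|i ir Hx Hs] /=; first exact: (Ad_in (subH (leq0n r))).
by have [_] := normH ir; apply=> //; exact: (chain_mono chainH (ltnW ir)).
Qed.

(** Since [v] commutes with [x], it maps the conjugate of [x] by [s] to its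
    conjugate by [Ad v s]; so each term of the series of conjugates leads one step
    down the chain. *)
Lemma conjugates_series_Ad x v k z : H 0%N x -> v != 0 -> GRing.comm v x ->
  conjugates_series x (H 0%N) k z -> H (r.-1 - k)%N (Ad v z).
Proof.
move=> Hx v0 vx; elim: k z => [z Hz|k IH].
  by rewrite subn0; apply: chain_Ad => //; rewrite Hr; exact: divA.
have kr j : (r.-1 - j <= r)%N := leq_trans (leq_subr _ _) (leq_pred r).
have [sC Cx] := conjugates_series_subgroup k (subH (leq0n r)) Hx.
apply: (conjugates_subgroup_ind sC Cx (P := [set z | H _ (Ad v z)])) => [|u w Du Dw Hu Hw|s /[dup] Cs /IH Hs] /=.
- by rewrite Ad1 //; exact: (usubg1 (subH (kr _))).
- by rewrite AdM // AdV //; exact: (usubg_div (subH (kr _))).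
- have s0 := usubg_neq0 sC Cs.
  have -> : Ad v (Ad s x) = Ad (Ad v s) x.
    have vV0 : v^-1 != 0 by apply: contra_neq v0 => E; rewrite -[v]invrK E invr0.
    rewrite [in RHS]/Ad -/(Ad (v * s * v^-1) x) !Ad_comp ?div_mul_neq0 //.
    congr (Ad v (Ad s _)); apply/esym/Ad_fixP => //.
    by apply: commr_sym; apply: commrV; exact: commr_sym.
  by rewrite subnS; apply: chain_Ad.
Qed.

(** A coboundary is a commutator with [y], and [y] belongs to all the terms of the
    chain. *)
Lemma twist_chain y c k : H 0%N y -> c != 0 -> H (r - k)%N (iter k (twist y) c).
Proof.
move=> Hy c0; have y0 := usubg_neq0 (subH (leq0n r)) Hy.
elim: k => [|k IH]; first by rewrite subn0 Hr; exact: divA.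
have u0 : iter k (twist y) c != 0 by exact: iter_twist_neq0.
rewrite iterS subnS; move: (iter k _ c) u0 IH => u u0 Hu.
have uE : twist y u = Ad u y / y.
  by rewrite /twist -AdV // /Ad !mulrA.
have jr : ((r - k).-1 <= r)%N := leq_trans (leq_pred _) (leq_subr _ _).
rewrite uE; apply: (usubg_div (subH jr)); last exact: (chain_mono chainH).
by apply: chain_Ad => //; exact: leq_subr.
Qed.

(** With [u] the [k]-th coboundary of [e], conjugating [y] by [u * y] gives the next
    coboundary times [y]. *)
Lemma conjugates_series_twist y e k : H 0%N y -> H 0%N e ->
  conjugates_series y (H 0%N) k.+1 (iter k.+1 (twist y) e * y).
Proof.
move=> Hy He; have y0 := usubg_neq0 (subH (leq0n r)) Hy.
have e0 := usubg_neq0 (subH (leq0n r)) He.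
have step u : u != 0 -> twist y u * y = Ad u y.
  by move=> u0; rewrite /twist -AdV // /Ad !mulrA mulrVK // divA.
elim: k => [|k IH]; first by rewrite /= step //; apply: conjugates_in.
have u0 : iter k.+1 (twist y) e != 0 by exact: iter_twist_neq0.
rewrite iterS step // {1}/conjugates_series iterS.
have -> : Ad (iter k.+1 (twist y) e) y = Ad (iter k.+1 (twist y) e * y) y.
  rewrite Ad_comp //; congr Ad; apply/esym/Ad_fixP => //.
exact: conjugates_in.
Qed.

Hypothesis nabH : nonabelian (H 0%N).

Lemma centralizer_Ad (X : set A) y : y != 0 ->
  (forall u, X u -> X (Ad y u)) -> (forall u, X u -> X (Ad y^-1 u)) ->
  forall u, centralizer X u -> centralizer X (Ad y u).
Proof.
move=> y0 Xy XyV u Cu x Xx.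
have yV0 : y^-1 != 0 by apply: contra_neq y0 => E; rewrite -[y]invrK E invr0.
have -> : x = Ad y (Ad y^-1 x).
  by rewrite -Ad_comp // mulrV ?divA // /Ad mul1r invr1 mulr1.
by rewrite /GRing.comm -!AdM //; congr Ad; apply: Cu; exact: XyV.
Qed.

(** Suppose that every [x] in [H 0] commutes with the last term of its series of
    conjugates, and let [k] be maximal such that some [y] in the [k]-th term moves
    [x]. The next term is then abelian and [y] normalizes it, hence also a field
    [E] containing [x] and, by construction, the powers of [y] that act trivially.
    Since [E] has to be infinite, the coboundaries of [y] on [E] are not eventually
    trivial, and they show that [y] does not commute with the last term of its own
    series. *)
Lemma noncommuting_series : exists x z, [/\ H 0%N x,
  conjugates_series x (H 0%N) r.+1 z & ~ GRing.comm z x].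
Proof.
apply: contrapT => noxz; have sG := subH (leq0n r).
have all_comm x z : H 0%N x -> conjugates_series x (H 0%N) r.+1 z -> GRing.comm z x.
  by move=> Hx cz; apply: contrapT => zx; apply: noxz; exists x, z.
have [x [y0 [Gx Gy0 /eqP xy0]]] := nabH.
pose C k := conjugates_series x (H 0%N) k.
have [k [y [Cy yx CSx]]] : exists k y, [/\ C k y, ~ GRing.comm y x &
    forall z, C k.+1 z -> GRing.comm z x].
  apply: contrapT => nok.
  suff [z [Cz]] : exists z, C r.+1 z /\ ~ GRing.comm z x by apply; exact: all_comm.
  elim: r.+1 => [|k [y [Cy yx]]]; first by exists y0; split=> // /esym.
  apply: contrapT => noz; apply: nok; exists k, y; split=> // z Cz.
  by apply: contrapT => zx; apply: noz; exists z.
have [sC Cx] := conjugates_series_subgroup k sG Gx.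
have [sD Dx] := conjugates_series_subgroup k.+1 sG Gx.
have [_ nD] := conjugates_subgroup_normal sC Cx.
have Gy : H 0%N y by apply: (conjugates_series_sub sG Gx (leq0n k)).
have yn0 := usubg_neq0 sC Cy; have x0 := usubg_neq0 sC Cx.
have Dy u : C k.+1 u -> C k.+1 (Ad y u) by move=> Du; exact: nD.
have CyV := usubgV sC Cy.
have DyV u : C k.+1 u -> C k.+1 (Ad y^-1 u) by move=> Du; exact: nD.
have Dab u v : C k.+1 u -> C k.+1 v -> GRing.comm u v.
  move=> Du; move: v; apply: (conjugates_subgroup_ind sC Cx (P := [set v | GRing.comm u v])) => [|v w _ _ uv uw|s Cs].
  - exact: commr1.
  - by apply: commrM => //; exact: commrV.
  - have s0 := usubg_neq0 sC Cs; have sV := usubgV sC Cs.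
    have sV0 := usubg_neq0 sC sV.
    have -> : u = Ad s (Ad s^-1 u).
      by rewrite -Ad_comp // mulrV ?divA // /Ad mul1r invr1 mulr1.
    by rewrite /= /GRing.comm -!AdM //; congr Ad; apply: CSx; exact: nD.
(* The powers of [y] that commute with the next term are added to it in order that,
   if [E] is finite, [y] has finite order. *)
pose X := C k.+1 `|` [set y ^+ i | i in [set i | centralizer (C k.+1) (y ^+ i)]].
have XC u v : X u -> X v -> GRing.comm u v.
  move=> [Du|[i /= ci <-]] [Dv|[j /= cj <-]]; [exact: Dab| | |].
  - by apply: commr_sym; exact: cj.
  - exact: ci.
  - by apply: commrX; apply: commr_sym; exact: commrX.
have Xy u : X u -> X (Ad y u).
  move=> [Du|[i ci <-]]; [left; exact: Dy | right; exists i => //].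
  by apply/esym/Ad_fixP => //; exact: commrX.
have yV0 := usubg_neq0 sC CyV.
have XyV u : X u -> X (Ad y^-1 u).
  move=> [Du|[i ci <-]]; [left; exact: DyV | right; exists i => //].
  by apply/esym/Ad_fixP => //; apply: commr_sym; apply: commrV; apply/commr_sym/commrX.
pose E := bicommutant X; have fieldE : commutative_subfield E := bicommutant_subfield XC.
have CXy := centralizer_Ad yn0 Xy XyV.
have CXyV : forall u, centralizer X u -> centralizer X (Ad y^-1 u).
  by apply: centralizer_Ad => //; rewrite invrK.
have Ey e : E e -> E (Ad y e) by apply: centralizer_Ad.
have DE u : C k.+1 u -> E u by move=> Du; apply: bicommutant_sub; left.
have [Einf|Efin] := pselect (infinite_set E).
  apply: (yx); rewrite -(Ad_fixP divA x yn0).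
  apply: (iter_twist_trivial divA fieldE yn0 Ey (k := (r.+2 + r))) => //; last exact: DE.
  move=> c Ec c0; rewrite iterD; set e := iter r (twist y) c.
  have Ge : H 0%N e by have := @twist_chain y c r Gy c0; rewrite subnn.
  have e0 := usubg_neq0 sG Ge.
  have cz := all_comm _ _ Gy (@conjugates_series_twist y e r Gy Ge).
  rewrite iterS; set w := iter r.+1 (twist y) e in cz *.
  have w0 : w != 0 by exact: iter_twist_neq0.
  have wy : Ad y w = w.
    apply/Ad_fixP => //; have -> : w = w * y * y^-1 by rewrite mulrK // divA.
    by apply: commrM; [exact: commr_sym | apply/commr_sym/commr_sym/commrV].
  by rewrite /twist wy mulrV // divA.
have {}Efin := contrapT Efin; have [t Et] := (finite_seqP E).1 Efin.
have [E1 _ EM _] := fieldE.1.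
have [m m0 mE] := finite_exponent divA Efin E1 EM.
pose n := (size t)`!; have En e : E e -> Ad (y ^+ n) e = e.
  move=> Ee; rewrite -iter_Ad //; apply: finite_orbit; first exact: Ad_inj.
  by move=> i; have : E (iter i (Ad y) e); [exact: (iter_Ad_in Ey) | rewrite Et].
have ynE : E (y ^+ n).
  apply: bicommutant_sub; right; exists n => // u /DE /En.
  by rewrite Ad_fixP // div_expf_neq0.
have yN : y ^+ (n * m) = 1 by rewrite exprM mE // div_expf_neq0.
apply: (yx); apply: (finite_normalized_fixed divA Efin fieldE.1 yn0 Ey _ yN (DE _ Dx)).
by rewrite muln_gt0 fact_gt0.
Qed.

End Chain.
End SubnormalChains.

(** * Eigenvectors on a quadratic curve *)

(** Coordinates are compared with respect to [N], [T] and [e]. When [N] is a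
    combination of [T] and [e] the eigenvalues may vary with [a], and three nonzero
    values of [a] are needed to find one for which they do not. *)
Lemma quadratic_eigenvectors (F : fieldType) (V : lmodType F) (d : V -> V) (N T e : V) :
    (exists s : seq F, uniq s /\ size s = 4%N) ->
    (forall x y, d (x + y) = d x + d y) -> (forall a x, d (a *: x) = a *: d x) ->
    e != 0 -> d e = e ->
    (forall a, exists c, d (N + a *: T + (a * a) *: e) = c *: (N + a *: T + (a * a) *: e)) ->
  d T = T.
Proof.
move=> cardF dD dZ e0 de eig.
have [[p Tp]|Tn] := pselect (exists p, T = p *: e); first by rewrite Tp dZ de.
have indep a b a' b' : a *: T + b *: e = a' *: T + b' *: e -> a = a' /\ b = b'.
  move=> E; have {}E : (a - a') *: T = (b' - b) *: e.
    by apply/eqP; rewrite !scalerBl subr_eq addrAC eq_sym subr_eq E addrC.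
  have aa : a = a'.
    apply: contrapT => /eqP; rewrite -subr_eq0 => aa; apply: Tn.
    by exists ((a - a')^-1 * (b' - b)); rewrite -scalerA -E scalerA mulVf // scale1r.
  split=> //; move/eqP: E; rewrite aa subrr scale0r eq_sym scaler_eq0 (negPf e0) orbF.
  by rewrite subr_eq0 => /eqP.
pose l a := sval (cid (eig a)).
have lE a : d N + a *: d T + (a * a) *: e = l a *: N + (l a * a) *: T + (l a * (a * a)) *: e.
  have := svalP (cid (eig a)); rewrite -/(l a) !dD !dZ de => ->.
  by rewrite !scalerDr !scalerA.
have l0E : d N = l 0 *: N.
  by have := lE 0; rewrite !(mulr0, scale0r, addr0).
have [a ] := @four_elements_avoid F [:: 0] cardF isT; rewrite inE => a0.
have [b ] := @four_elements_avoid F [:: 0; a] cardF isT; rewrite !inE negb_or => /andP[b0 ba].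
have [c ] := @four_elements_avoid F [:: 0; a; b] cardF isT.
rewrite !inE !negb_or => /and3P[c0 ca cb].
have lE' x : x *: d T = (l x - l 0) *: N + (l x * x) *: T + ((l x - 1) * (x * x)) *: e.
  have := lE x; rewrite l0E => E; apply: (addrI (l 0 *: N)); apply: (addIr ((x * x) *: e)).
  rewrite E; have -> : l x *: N = l 0 *: N + (l x - l 0) *: N by rewrite -scalerDl addrC subrK.
  have -> : (l x * (x * x)) *: e = ((l x - 1) * (x * x)) *: e + (x * x) *: e.
    by rewrite -scalerDl; congr (_ *: _); ring.
  by rewrite !addrA.
have fixT x : x != 0 -> x *: d T = x *: T -> d T = T.
  by move=> x0 /(congr1 ( *:%R x^-1)); rewrite !scalerA mulVf // !scale1r.
have [[p [q NE]]|Nn] := pselect (exists p q, N = p *: T + q *: e); last first.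
  have indep3 u v w u' v' w' :
      u *: N + v *: T + w *: e = u' *: N + v' *: T + w' *: e -> [/\ u = u', v = v' & w = w'].
    move=> E; have uu : u = u'.
      apply: contrapT => /eqP; rewrite -subr_eq0 => uu; apply: Nn.
      exists ((u - u')^-1 * (v' - v)), ((u - u')^-1 * (w' - w)).
      rewrite -!scalerA -scalerDr; apply: (canRL (scalerK uu)).
      have uE : u *: N = u' *: N + v' *: T + w' *: e - (v *: T + w *: e).
        by rewrite -E -(addrA (u *: N)) addrK.
      rewrite !scalerBl uE addrAC -[u' *: N + _ + _]addrA.
      by rewrite [u' *: N + _]addrC addrK opprD addrACA.
    by move: E; rewrite uu -!addrA => /addrI/indep[].
  have := congr1 ( *:%R b) (lE' a); have := congr1 ( *:%R a) (lE' b).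
  rewrite [a *: (b *: _)]scalerA (mulrC a b) -(scalerA b a) => -> E.
  move: E; rewrite !scalerDr !scalerA => /indep3[EN ET Ee].
  have lab : l a = l b.
    apply: (mulIf (mulf_neq0 a0 b0)).
    by transitivity (a * (l b * b)); [rewrite ET; ring | ring].
  have l0a : l a = l 0.
    apply/eqP; rewrite -subr_eq0; suff : (l a - l 0) * (b - a) == 0.
      by rewrite mulf_eq0 [b - a == 0]subr_eq0 (negPf ba) orbF.
    by rewrite mulrBr subr_eq0 mulrC -EN lab mulrC.
  have l1 : l a = 1.
    apply/eqP; rewrite -subr_eq0; suff : (l a - 1) * (a * b * (a - b)) == 0.
      by rewrite !mulf_eq0 (negPf a0) (negPf b0) /= [a - b == 0]subr_eq0 (eq_sym a) (negPf ba) orbF.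
    rewrite -[X in _ == X](subrr (a * ((l b - 1) * (b * b)))) {1}Ee lab; apply/eqP; ring.
  by apply: (fixT a) => //; rewrite lE' -l0a l1 !subrr mul0r !scale0r addr0 add0r mul1r.
have {}lE' x : x *: d T = ((l x - l 0) * p + l x * x) *: T +
    ((l x - l 0) * q + (l x - 1) * (x * x)) *: e.
  rewrite lE' NE scalerDr !scalerA !scalerDl.
  by rewrite -[LHS]addrA addrACA.
have [p0|p0] := eqVneq p 0.
  have q0 : l 0 * q = q.
    move: l0E; rewrite NE p0 scale0r add0r dZ de scalerA => /eqP.
    rewrite -subr_eq0 -scalerBl scaler_eq0 (negPf e0) orbF subr_eq0 => /eqP E.
    by rewrite -E.
  have key x y : x != 0 -> y != 0 -> y != x -> l x = 1 \/ q = x * y.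
    move=> x0 y0 xy; have := congr1 ( *:%R y) (lE' x); have := congr1 ( *:%R x) (lE' y).
    rewrite [x *: (y *: _)]scalerA (mulrC x y) -(scalerA y x) => -> E.
    move: E; rewrite !scalerDr !scalerA => /indep[].
    rewrite p0 !mulr0 !add0r => ET Ee.
    have lxy : l x = l y.
      apply: (mulIf (mulf_neq0 x0 y0)).
      by transitivity (x * (l y * y)); [rewrite ET; ring | ring].
    have : (l x - 1) * ((y - x) * (q - x * y)) == 0.
      rewrite -[X in _ == X](subrr (x * ((l y - l 0) * q + (l y - 1) * (y * y)))) {1}Ee lxy.
      apply/eqP; transitivity ((l y - 1) * ((y - x) * (q - x * y)) - (y - x) * (l 0 * q - q)).
        by rewrite q0 subrr mulr0 subr0.
      ring.
    rewrite !mulf_eq0 [y - x == 0]subr_eq0 (negPf xy) /=.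
    case/orP; rewrite subr_eq0 => /eqP E; [left|right]; rewrite E // mulrC //.
  have l1 : l a = 1.
    have [//|qab] := key a b a0 b0 ba; have [//|qac] := key a c a0 c0 ca.
    by move: qab; rewrite qac => /(mulfI a0)/eqP; rewrite (negPf cb).
  have := lE' a; rewrite p0 !mulr0 !add0r l1 subrr mul0r addr0 mulrBl !mul1r q0.
  by rewrite subrr scale0r addr0; exact: fixT.
have [x [x0 xp xq]] : exists x, [/\ x != 0, x + p != 0 & q != p * x].
  apply: contrapT => nox.
  have [x] := @four_elements_avoid F [:: 0; - p; q / p] cardF isT.
  rewrite !inE !negb_or => /and3P[x0 xp xq]; apply: nox; exists x.
  split=> //; first by rewrite addr_eq0.
  by apply: contra_neq xq => ->; rewrite (mulrC p) mulfK.
have Ep : p *: d T = (l 0 * p) *: T + (l 0 * q - q) *: e.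
  apply: (addIr (q *: e)); rewrite -addrA -scalerDl subrK -scalerA -[in RHS]scalerA -scalerDr.
  by rewrite -NE -l0E NE dD !dZ de.
have := congr1 ( *:%R p) (lE' x); rewrite scalerA mulrC -(scalerA x) Ep.
rewrite !scalerDr !scalerA => /indep[ET Ee].
have lx : l x = l 0.
  apply/eqP; rewrite -subr_eq0; suff : p * ((l x - l 0) * (x + p)) == 0.
    by rewrite !mulf_eq0 (negPf p0) (negPf xp) orbF.
  rewrite -[X in _ == X](subrr (x * (l 0 * p))) {1}ET; apply/eqP; ring.
have l1 : l 0 = 1.
  apply/eqP; rewrite -subr_eq0; suff : (l 0 - 1) * (x * (q - p * x)) == 0.
    by rewrite !mulf_eq0 subr_eq0 (negPf x0) /= [q - _ == 0]subr_eq0 (negPf xq) orbF.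
  rewrite -[X in _ == X](subrr (x * (l 0 * q - q))) {2}Ee lx; apply/eqP; ring.
by apply: (fixT p) => //; rewrite Ep l1 !mul1r subrr scale0r addr0.
Qed.

(** * Conjugates of a quadratic element *)

Section QuadraticWords.
Variable A : unitRingType.
Hypothesis divA : division_ring A.
Variables (t n w : A).
Hypotheses (tw : GRing.comm t w) (nw : GRing.comm n w) (t0 : t != 0).
Hypothesis wE : w * w = t * w - n.

(** The product of [u - w] and [u - (t - w)] is zero. *)
Lemma quadratic_roots u : GRing.comm t u -> u * u = t * u - n -> GRing.comm u w ->
  u = w \/ u = t - w.
Proof.
move=> tu uE uw; have /(div_mul_eq0 divA)[/subr0_eq|E] : (u - w) * (u + w - t) = 0.
- transitivity (u * u - t * u - (w * w - t * w) + (u * w - w * u) + (t * u - u * t) - (t * w - w * t)).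
    by ncring.
  have -> : u * u - t * u = - n by rewrite uE addrAC subrr sub0r.
  have -> : w * w - t * w = - n by rewrite wE addrAC subrr sub0r.
  by rewrite uw tu tw !subrr !addr0 subr0.
- by left.
- by right; apply/eqP; rewrite -subr_eq0 opprB addrA E.
Qed.

(** By [quadratic_roots], if the conjugate of [w] commutes with [w], it is [w] or
    [t - w]. In the second case [u * w + w * u = t * u], so [u * u] commutes with
    [w]; as [u * u = t * u - n], so does [u]. *)
Lemma quadratic_conjugate u : GRing.comm t u -> GRing.comm n u -> u * u = t * u - n ->
    ~ GRing.comm u w ->
  let u' := Ad u w in
  [/\ GRing.comm t u', GRing.comm n u', u' * u' = t * u' - n & ~ GRing.comm u' w].
Proof.
move=> tu nu uE uw u'.
have u0 : u != 0 by apply: contra_notN uw => /eqP ->; exact: commr_sym (commr0 _).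
have tC : GRing.comm t u' by apply: commrM; [exact: commrM | exact: commrV].
have nC : GRing.comm n u' by apply: commrM; [exact: commrM | exact: commrV].
have u'E : u' * u' = t * u' - n.
  have Ad_t : Ad u t = t by apply/Ad_fixP => //; exact: commr_sym.
  have Ad_n : Ad u n = n by apply/Ad_fixP => //; exact: commr_sym.
  by rewrite -AdM // wE AdB AdM // Ad_t Ad_n.
split=> // /(quadratic_roots tC u'E) [E|E]; apply: uw; first exact/(Ad_fixP divA).
have {}E : u * w + w * u = t * u.
  by rewrite (Ad_mul divA) // -/u' E mulrBl subrK.
have uuw : u * u * w = w * (u * u).
  apply/subr0_eq; transitivity (u * (u * w + w * u) - (u * w + w * u) * u); first by ncring.
  by rewrite E mulrA -tu subrr.
apply: (mulrI (divA t0)); move: uuw; rewrite uE mulrBl mulrBr nw !mulrA -tw => /addIr ->.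
by rewrite -!mulrA.
Qed.

(** The quadratic equation shared with [w] is inherited by the conjugates of [w], so
    [quadratic_conjugate] can be repeated. *)
Lemma quadratic_series (C : set A) s k : unit_subgroup C -> C s ->
    GRing.comm t s -> GRing.comm n s -> s * s = t * s - n -> ~ GRing.comm s w ->
  exists z, conjugates_series w C k z /\ ~ GRing.comm z w.
Proof.
move=> sC Cs ts ns sE sw; suff [z [Cz [_ _ _ zw]]] : exists z, conjugates_series w C k z /\
    [/\ GRing.comm t z, GRing.comm n z, z * z = t * z - n & ~ GRing.comm z w] by exists z.
elim: k => [|k [z [Cz [tz nz zE zw]]]]; first by exists s.
by exists (Ad z w); split; [exact: conjugates_in | exact: quadratic_conjugate].
Qed.

End QuadraticWords.

(** * Elements moved by the involution *)

Section DivisionNorms.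
Variables (F : fieldType) (A : unitAlgType F) (star : A -> A).
Hypothesis divA : division_ring A.
Hypothesis centerA : center A = range (in_alg A).
Hypothesis cardF : exists s : seq F, uniq s /\ size s = 4%N.
Hypotheses (starI : involution star) (star1 : first_kind star).
Variables (r : nat) (H : nat -> set A).
Hypothesis chainH : subnormal_chain r H.
Hypothesis nabH : nonabelian (H 0%N).
Hypothesis normsH : norms star (H 0%N) `<=` range (in_alg A).

Local Notation scalar x := (range (in_alg A) x).
Local Notation G := (H 0%N).
Let sG : unit_subgroup G. Proof. by case: chainH => _ /(_ 0%N (leq0n r)). Qed.

Lemma scalar_comm x y : scalar x -> GRing.comm x y.
Proof. by move=> /(scalar_central centerA); apply. Qed.

Lemma scalar_invr x : scalar x -> scalar x^-1.
Proof.
move=> [a _ <-] /=; exists a^-1 => //=.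
have [->|a0] := eqVneq a 0; first by rewrite invr0 scale0r invr0.
by rewrite -!in_algE fmorphV.
Qed.

Lemma star_norm g : G g -> exists n, [/\ scalar n, n != 0 & star g = n * g^-1 /\ star g * g = n].
Proof.
move=> Gg; exists (g * star g); have g0 := usubg_neq0 sG Gg.
have ns : scalar (g * star g) by apply: normsH; exists g.
have sg0 : star g != 0.
  by apply: contra_neq g0 => E; rewrite -(starK starI g) E (star0 starI).
have sgg : star g * g = g * star g.
  apply: (mulrI (divA g0)); rewrite mulrA; exact: scalar_comm.
split=> //; first exact: div_mul_neq0.
by split=> //; rewrite -sgg mulrK // divA.
Qed.

(** The norm of the conjugate of [z] by [v + a] is a scalar for each scalar [a], so
    conjugation by [z] multiplies [star (v + a) * (v + a)] by a scalar; this is the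
    situation of [quadratic_eigenvectors]. *)
Lemma centralizer_trace_comm x v z : G x -> GRing.comm v x ->
  conjugates_series x G r z -> GRing.comm z (v + star v).
Proof.
move=> Gx vx Cz; have Gz : G z by exact: (conjugates_series_sub sG Gx (leq0n r)).
have z0 := usubg_neq0 sG Gz.
have [vs|vn] := pselect (scalar v).
  by apply: commr_sym; apply: scalar_comm; apply: scalarD => //; rewrite (star_scalar centerA star1).
apply/(Ad_fixP divA) => //.
apply: (@quadratic_eigenvectors F A (Ad z) (star v * v) _ 1) => //.
- exact: AdD.
- by move=> a u; rewrite /Ad -scalerAr -scalerAl.
- exact: oner_neq0.
- exact: Ad1.
move=> a; pose u := v + a%:A.
have u0 : u != 0.
  apply: contra_notN vn; rewrite addr_eq0 => /eqP ->; apply: scalarN; exact: scalarA.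
have su : star u = star v + a%:A by rewrite (starD starI) (star_scalar centerA star1 (scalarA A a)).
have -> : star v * v + a *: (v + star v) + (a * a) *: 1 = star u * u.
  rewrite su mulrDl !mulrDr -!scalerAr -!scalerAl !mul1r !mulr1 scalerA scalerDr.
  by rewrite !addrA (addrAC _ (a *: v)) .
have Gg : G (Ad u z).
  have /(conjugates_series_Ad divA chainH Gx u0) : conjugates_series x G r z by [].
  have -> : (r.-1 - r = 0)%N by apply/eqP; rewrite subn_eq0 leq_pred.
  by apply; apply: commr_sym; apply: commrD; [exact: commr_sym | apply: commr_sym; apply: scalar_comm; exact: scalarA].
have [n [ns n0 [zs zz]]] := star_norm Gz.
have ug := Ad_mul divA z u0; move: (Ad u z) Gg ug => g Gg ug.
have [m [ms m0 [_ gg]]] := star_norm Gg.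
have E : star z * (star u * u * z) = m * (star u * u).
  have := congr1 star ug; rewrite !(starM starI) => ug'.
  rewrite -(mulrA (star u)) ug mulrA ug' -(mulrA (star u)) (mulrA (star g)) gg.
  by rewrite mulrA -(scalar_comm _ ms) mulrA.
have {}E : n * (star u * u * z) = m * (z * (star u * u)).
  rewrite (mulrA m z) (scalar_comm z ms) -(mulrA z m) -E (mulrA z) zs.
  by rewrite (mulrA z) -(scalar_comm z ns) mulrK ?divA.
have [k _ kE] : scalar (n / m) by apply: scalarM => //; exact: scalar_invr.
have {}E : z * (star u * u) = k *: (star u * u * z).
  apply: (mulrI (divA m0)); rewrite -E -mulr_algl -in_algE kE (mulrA m) (scalar_comm (n / m) ms).
  by rewrite mulrVK ?divA.
by exists k; rewrite /Ad E -scalerAl mulrK ?divA.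
Qed.

Lemma star_centralizer x v : G x -> GRing.comm v x -> GRing.comm (star v) x.
Proof.
move=> Gx vx; have [n [ns n0 [xE _]]] := star_norm Gx; have x0 := usubg_neq0 sG Gx.
have -> : x = n * (n * x^-1)^-1.
  have nu := divA n0; have xu := divA x0.
  by rewrite invrM ?unitrV // invrK mulrA (scalar_comm _ ns) mulrK.
apply: commrM; first exact/commr_sym/scalar_comm.
by apply: commrV; rewrite -xE /GRing.comm -!(starM starI) vx.
Qed.

Lemma star_Ad g u : G g -> star (Ad g u) = Ad g (star u).
Proof.
move=> Gg; have [n [ns n0 [gE _]]] := star_norm Gg; have g0 := usubg_neq0 sG Gg.
have := congr1 star (Ad_mul divA u g0); rewrite [in RHS](starM starI) (starM starI) gE.
move: (Ad g u) => w; rewrite mulrA -(scalar_comm _ ns) -!mulrA => /(mulrI (divA n0)) E.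
by rewrite /Ad -mulrA E mulVKr ?divA.
Qed.

Lemma noncommuting_conjugate x : G x ->
    (exists2 z, conjugates_series x G r.+1 z & ~ GRing.comm z x) ->
  exists2 s, conjugates_series x G r s & ~ GRing.comm (Ad s x) x.
Proof.
move=> Gx [z Cz zx]; apply: contrapT => nos; apply: zx.
have [sC Cx] := conjugates_series_subgroup r sG Gx.
have := conjugates_subgroup_ind sC Cx (P := [set z | GRing.comm z x]).
apply=> // [|u v _ _ ux vx|s Cs] /=; first exact/commr_sym/commr1.
- by apply/commr_sym/commrM; [exact: commr_sym | exact/commrV/commr_sym].
- by apply: contrapT => sx; apply: nos; exists s.
Qed.

(** If [star] fixes [x] and its conjugate [z], then the characteristic is two, and
    [star] inverts the commutator [w] of [x] and [z]. The conjugate of [w] by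
    [1 + x] is in [G], as [1 + x] commutes with [x]; it satisfies the same quadratic
    equation as [w] and does not commute with [w], so [quadratic_series] applies. *)
Lemma moved_element : exists x s, [/\ G x, conjugates_series x G r s,
  ~ GRing.comm (Ad s x) x & star x <> x].
Proof.
have [x [z0 [Gx Cz0 z0x]]] := noncommuting_series divA chainH nabH.
have [s Cs zx] : exists2 s, conjugates_series x G r s & ~ GRing.comm (Ad s x) x.
  by apply: noncommuting_conjugate => //; exists z0.
have [sx|sx] := pselect (star x = x); last by exists x, s.
have [sC Cx] := conjugates_series_subgroup r sG Gx.
have Gs : G s by exact: (conjugates_series_sub sG Gx (leq0n r)).
have x0 := usubg_neq0 sG Gx; have s0 := usubg_neq0 sG Gs.
set z := Ad s x in zx; have Gz : G z := Ad_in sG Gs Gx.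
have Cz : conjugates_series x G r z := Ad_in sC Cs Cx.
have z_0 := usubg_neq0 sG Gz; have ux := divA x0; have uz := divA z_0.
have sz : star z = z by rewrite /z star_Ad // sx.
have [d [ds d0 [_ xx]]] := star_norm Gx; rewrite sx in xx.
have zz : z * z = d.
  by rewrite /z -AdM // xx; apply/Ad_fixP => //; apply: commr_sym; exact: scalar_comm.
clearbody z; have two : 1 + 1 = 0 :> A.
  apply: contrapT => /eqP two0; apply: zx.
  have := centralizer_trace_comm Gx (erefl (x * x)) Cz; rewrite sx.
  have -> : x + x = (1 + 1) * x by rewrite mulrDl mul1r.
  have s2 : scalar ((1 : A) + 1) by apply: scalarD; exact: scalar1.
  rewrite /GRing.comm mulrA -(scalar_comm z s2) -!mulrA => /(mulrI (divA two0)) //.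
have addxx (u : A) : u + u = 0 by rewrite -[u]mul1r -mulrDl two mul0r.
pose w := x * z / x / z; pose w' := z * x / z / x.
have dx u : x * x * u = u * (x * x) by rewrite xx; exact: scalar_comm.
have dz u : z * z * u = u * (z * z) by rewrite zz; exact: scalar_comm.
have ww' : w * w' = 1.
  by rewrite /w /w' !mulrA mulrVK // mulrVK // mulrK // mulrV.
have w'w : w' * w = 1.
  by rewrite /w /w' !mulrA mulrVK // mulrVK // mulrK // mulrV.
have xw : x * w = w' * x by rewrite /w /w' mulrVK // !mulrA dx !mulrA mulrK.
have xw' : x * w' = w * x.
  have h : x / z / x = x^-1 / z * x.
    by apply: (mulrI ux); rewrite !mulrA dx !mulrA mulrK // mulrV // mul1r.
  transitivity (x * z * (x / z / x)); first by rewrite !mulrA.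
  by rewrite h !mulrA.
have sV u : u \is a GRing.unit -> star u = u -> star u^-1 = u^-1.
  by move=> uu su; have [-> _] := starV centerA starI star1 uu; rewrite su.
have sw : star w = w'.
  rewrite /w !(starM starI) !sV // sx sz; apply: (mulrI uz); rewrite mulVKr //.
  apply: (mulrI ux); rewrite mulVKr // /w' !mulrA -(mulrA x z z) -dz -(mulrA (z * z)) -dx.
  by rewrite !mulrA mulrK // dx mulrA mulrK.
have w_w' : w <> w'.
  move=> E; have ww : w * w = 1 by rewrite {2}E.
  have : (w - 1) * (w - 1) = 0.
    by rewrite mulrBl mul1r mulrBr mulr1 ww opprB addxx.
  case/(div_mul_eq0 divA); move/subr0_eq => w1; apply: zx; apply/esym.
    by rewrite /GRing.comm -[RHS]mul1r -w1 /w !mulrA mulrVK // mulrVK.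
  by rewrite /GRing.comm -[RHS]mul1r -w1 /w !mulrA mulrVK // mulrVK.
have NE (u : A) : - u = u by apply/eqP; rewrite eq_sym -addr_eq0 addxx.
pose t := w + w'.
have t0 : t != 0 by rewrite addr_eq0 NE; apply/eqP.
have tw : GRing.comm t w by rewrite /GRing.comm mulrDl mulrDr ww' w'w.
have tx : GRing.comm t x by rewrite /GRing.comm mulrDl mulrDr xw xw' addrC.
have wE : w * w = t * w - 1 by rewrite mulrDl w'w addrK.
pose v := 1 + x.
have v0 : v != 0.
  rewrite /v addrC addr_eq0; apply/eqP => x1; apply: zx; rewrite x1.
  exact/commrN/commr1.
have vx : GRing.comm v x by rewrite /GRing.comm mulrDl mulrDr mul1r mulr1.
have Cw : conjugates_series x G r w.
  by do !apply: (usubg_div sC) => //; exact: usubgM.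
have Gw : G w by exact: (conjugates_series_sub sG Gx (leq0n r)).
have r0 : (r.-1 - r = 0)%N by apply/eqP; rewrite subn_eq0 leq_pred.
have := conjugates_series_Ad divA chainH Gx v0 vx Cw; rewrite r0 => Gvw.
have tv : GRing.comm t v by apply: commrD => //; exact: commr1.
have n1 u : GRing.comm (1 : A) u := commr_sym (commr1 u).
have tAd : GRing.comm t (Ad v w) by apply: commrM; [exact: commrM | exact: commrV].
have AdE : Ad v w * Ad v w = t * Ad v w - 1.
  have Ad_t : Ad v t = t by apply/Ad_fixP => //; exact: commr_sym.
  by rewrite -AdM // wE AdB AdM // Ad_t Ad1.
have Adw : ~ GRing.comm (Ad v w) w.
  move/(quadratic_roots divA tw wE tAd AdE) => E; apply: w_w'.
  have {}E : Ad v w = w \/ Ad v w = w' by case: E => ->; [left|right; rewrite /t addrC addKr].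
  have vw := Ad_mul divA w v0; move: vw; rewrite {1}/v mulrDl mul1r xw.
  case: E => ->; rewrite /v mulrDr mulr1; first by move/addrI/(mulIr ux).
  by move/addIr.
have [y [Cy yw]] := quadratic_series divA tw (n1 w) t0 wE r.+1 sG Gvw tAd (n1 _) AdE Adw.
have [s' Cs' s'w] : exists2 s, conjugates_series w G r s & ~ GRing.comm (Ad s w) w.
  by apply: noncommuting_conjugate => //; exists y.
by exists w, s'; split=> //; rewrite sw => /esym.
Qed.

End DivisionNorms.

(** * The quaternion subalgebra of a moved element *)

Section QuaternionSubalgebra.
Variables (F : fieldType) (A : unitAlgType F) (star : A -> A).
Hypothesis divA : division_ring A.
Hypothesis centerA : center A = range (in_alg A).
Hypothesis cardF : exists s : seq F, uniq s /\ size s = 4%N.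
Hypotheses (starI : involution star) (star1 : first_kind star).
Variables (r : nat) (H : nat -> set A).
Hypothesis chainH : subnormal_chain r H.
Hypothesis normsH : norms star (H 0%N) `<=` range (in_alg A).
Variables (x s : A).

Local Notation scalar x := (range (in_alg A) x).
Local Notation G := (H 0%N).
Local Notation z := (Ad s x).
Hypotheses (Gx : G x) (Cs : conjugates_series x G r s).
Hypotheses (zx : ~ GRing.comm z x) (sx : star x <> x).

Let sG : unit_subgroup G. Proof. by case: chainH => _ /(_ 0%N (leq0n r)). Qed.
Let Gs : G s. Proof. exact: (conjugates_series_sub sG Gx (leq0n r)). Qed.
Let x0 : x != 0. Proof. exact: (usubg_neq0 sG Gx). Qed.
Let s0 : s != 0. Proof. exact: (usubg_neq0 sG Gs). Qed.
Let Cz : conjugates_series x G r z.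
Proof. by have [sC Cx] := conjugates_series_subgroup r sG Gx; exact: (Ad_in sC Cs Cx). Qed.
Let scomm := scalar_comm centerA.
Let starC := star_centralizer divA centerA starI chainH normsH.

(** This is the center of the quaternion algebra constructed below. *)
Definition fixed_subfield : set A := [set v | GRing.comm v x /\ star v = v].
Local Notation C := fixed_subfield.

(** By [centralizer_trace_comm] applied to [x * v], the element [y] commutes with
    [v * (x + star x)]. When [x] has trace zero the characteristic is not two, and
    [v + v] is used instead. *)
Lemma fixed_comm_series v y : C v -> conjugates_series x G r y -> GRing.comm v y.
Proof.
move=> [vx sv] Cy; apply: commr_sym.
have trC u := @centralizer_trace_comm F A star divA centerA cardF starI star1 r H chainH normsH x u y Gx ^~ Cy.
have [t0|t0] := eqVneq (x + star x) 0.
  have two0 : 1 + 1 != 0 :> A.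
    apply/eqP => two; apply: sx; apply: (addrI x); rewrite t0.
    by rewrite -[x]mul1r -mulrDl two mul0r.
  have := trC v vx; rewrite sv.
  have -> : v + v = (1 + 1) * v by rewrite mulrDl mul1r.
  have s2 : scalar ((1 : A) + 1) by apply: scalarD; exact: scalar1.
  rewrite /GRing.comm mulrA -(scomm y s2) -[in LHS]mulrA -[in RHS]mulrA.
  exact: (mulrI (divA two0)).
have xv : GRing.comm (x * v) x by apply/commr_sym/commrM => //; exact: commr_sym.
have := trC _ xv; have := trC x (commr_refl x); rewrite (starM starI) sv -vx -mulrDr.
move: (x + star x) t0 => t t0 yt; rewrite /GRing.comm mulrA -(mulrA v) -yt mulrA.
exact: (mulIr (divA t0)).
Qed.

Local Notation y := (star x).

Lemma fixed_comm v : C v -> GRing.comm v x /\ GRing.comm v z.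
Proof. by move=> Cv; split; [case: Cv | exact: fixed_comm_series]. Qed.

Let yx : GRing.comm y x. Proof. exact: starC. Qed.

Let d0 : x - y != 0. Proof. by rewrite subr_eq0; apply/eqP => /esym. Qed.

(** The coefficient [b] is [(v - star v) / (x - star x)]. *)
Lemma centralizer_split v : GRing.comm v x -> exists a b, [/\ C a, C b & v = a + b * x].
Proof.
move=> vx; have svx := starC Gx vx.
have vy : GRing.comm v y.
  by have := congr1 star svx; rewrite !(starM starI) (starK starI) => /esym.
have svy : GRing.comm (star v) y.
  by have := congr1 star vx; rewrite !(starM starI) => /esym.
have sub_comm u w u' : GRing.comm u u' -> GRing.comm w u' -> GRing.comm (u - w) u'.
  by move=> uu ww; apply/commr_sym/commrB; exact: commr_sym.
pose d := x - y; have dx : GRing.comm d x by exact: sub_comm.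
have sd : star d = - d by rewrite (starB starI) (starK starI) opprB.
have [sdV _] := starV centerA starI star1 (divA d0).
have vd : GRing.comm (v - star v) d by apply: commrB; apply: sub_comm.
pose b := (v - star v) / d.
have bx : GRing.comm b x.
  by apply/commr_sym/commrM; [exact/commr_sym/sub_comm | exact/commrV/commr_sym].
have Cb : C b.
  split=> //; rewrite (starM starI) sdV sd (starB starI) (starK starI) invrN mulNr -mulrN opprB.
  by apply/esym/commrV.
exists (v - b * x), b; split; [|exact: Cb|by rewrite subrK].
split; first by apply: sub_comm => //; apply/commr_sym/commrM => //; exact: commr_sym.
case: Cb => _ sb; rewrite (starB starI) (starM starI) sb.
have by_ : GRing.comm y b.
  apply: commrM; first by apply: commrB; exact: commr_sym.
  by apply/commrV; apply: commrB => //; exact: commr_refl.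
have bd : b * (x - y) = v - star v by rewrite mulrVK ?divA.
have svE : star v = v - (b * x - b * y) by rewrite -mulrBr bd subKr.
by rewrite by_ {1}svE opprB addrA addrAC addrK.
Qed.

(** By [centralizer_split] such an element is [a + b * x], where [a] and [b] commute
    with [z] but [x] does not. *)
Lemma fixed_of_comm u : GRing.comm u x -> GRing.comm u z -> C u.
Proof.
move=> /centralizer_split[a [b [Ca Cb ->]]] uz.
have [_ az] := fixed_comm Ca; have [_ bz] := fixed_comm Cb.
have [-> |b0] := eqVneq b 0; first by rewrite mul0r addr0.
case: zx; apply/esym/(mulrI (divA b0)).
move: uz; rewrite /GRing.comm mulrDl mulrDr az => /addrI.
by rewrite (mulrA z) -bz -!(mulrA b).
Qed.

Lemma fixed_subfieldP : C = centralizer [set` [:: x; z]].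
Proof.
apply/seteqP; split=> u; first move=> /fixed_comm[ux uz] v.
  by rewrite /= !inE => /orP[]/eqP->.
by move=> Cu; apply: fixed_of_comm; apply: Cu; rewrite /= !inE eqxx ?orbT.
Qed.

Lemma fixed_subfield_field : commutative_subfield C.
Proof.
have sC : division_subring C by rewrite fixed_subfieldP; exact: centralizer_division_subring.
split=> // a b Ca Cb; have [_ sab] := division_subringM sC Ca Cb.
by rewrite /GRing.comm -sab (starM starI); case: Ca => _ ->; case: Cb => _ ->.
Qed.

Let sC : division_subring C := fixed_subfield_field.1.

Definition quaternion_subalgebra : set A := centralizer C.
Local Notation L := quaternion_subalgebra.

Let sL : division_subring L. Proof. exact: centralizer_division_subring. Qed.

Lemma quaternion_x : L x. Proof. by move=> v [vx _]; exact: commr_sym. Qed.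
Lemma quaternion_z : L z. Proof. by move=> v /fixed_comm[_ vz]; exact: commr_sym. Qed.
Lemma quaternion_star u : L u -> L (star u).
Proof.
move=> Lu v Cv; have [_ sv] := Cv; have := congr1 star (Lu v Cv).
by rewrite !(starM starI) sv => /esym.
Qed.

Lemma trace_fixed k : GRing.comm k x -> C (k + star k).
Proof.
move=> kx; split; last by rewrite (starD starI) (starK starI) addrC.
by apply/commr_sym/commrD; apply: commr_sym => //; exact: starC.
Qed.

Let t := x + y.
Let Ct : C t. Proof. exact: trace_fixed. Qed.
Let tC u : L u -> t * u = u * t. Proof. by move=> Lu; rewrite (Lu _ Ct). Qed.

Let star_z : star z = t - z.
Proof.
rewrite (star_Ad divA centerA starI chainH normsH) //.
have yE : y = t - x by rewrite /t addrC addKr.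
rewrite {1}yE AdB; congr (_ - _); apply/Ad_fixP => //; apply: commr_sym.
exact: fixed_comm_series.
Qed.

Local Notation j := (x * z - z * x).

Let j0 : j != 0.
Proof. by rewrite subr_eq0; apply/eqP => /esym. Qed.

Let Lj : L j.
Proof. by case: (sL) => _ LB LM _; apply: LB; apply: LM; (exact: quaternion_x || exact: quaternion_z). Qed.

(** The quadratic polynomial over [C] with the root [x] has the other root [star x],
    and left multiplication by [x] commutes with right multiplications. *)
Lemma conj_commutator u : L u -> x * (x * u - u * x) = (x * u - u * x) * y.
Proof.
move=> Lu; have xyu : x * y * u = u * (x * y).
  by apply: scomm; apply: normsH; exists x.
have tu := tC Lu; rewrite /t in tu.
apply/subr0_eq; transitivity (x * (x * u) - x * (u * (x + y)) + u * (x * y)); first by ncring.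
by rewrite -tu -xyu; ncring.
Qed.

Lemma commutator_conj : j * x = y * j.
Proof.
have := conj_commutator quaternion_z; have := tC Lj; rewrite /t.
by move: j => w; rewrite mulrDl mulrDr => + E; rewrite -E [RHS]addrC => /addrI/esym.
Qed.

(** By [conj_commutator] the difference of [x * u - u * star x], which commutes with
    [x], and [x * u - u * x], which is semilinear like [x * z - z * x], is
    [u * (x - star x)]. *)
Lemma quaternion_split u : L u ->
  exists k l, [/\ GRing.comm k x, GRing.comm l x & u = k + l * j].
Proof.
move=> Lu; pose R := x * u - u * x; pose S := x * u - u * y.
have xR : x * R = R * y := conj_commutator Lu.
have xS : GRing.comm S x.
  apply/esym; move: xR; rewrite /S /R /GRing.comm !mulrBr !mulrBl.
  have := tC Lu; rewrite /t => tu.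
  have xyu : x * y * u = u * (x * y).
    by apply: scomm; apply: normsH; exists x.
  move=> _; apply/subr0_eq; transitivity (x * (x * u) - x * (u * (x + y)) + u * (y * x)); first by ncring.
  by rewrite yx -tu -xyu; ncring.
have dx : GRing.comm (x - y) x by apply/commr_sym/commrB => //; exact: commr_sym.
have SR : S - R = u * (x - y) by rewrite /S /R; ncring.
have jE := conj_commutator quaternion_z.
clearbody R S; move: (j) j0 commutator_conj jE => w w0 wx wE.
have dw : w * (x - y) = - (x - y) * w by rewrite mulrBr wx -wE opprB mulrBl.
have wV : w / (x - y) = - ((x - y)^-1 * w).
  apply: (mulIr (divA d0)); rewrite mulrVK ?divA // mulNr -mulrA dw.
  by rewrite mulrA mulrN mulVr ?divA // mulN1r opprK.
have dVx : GRing.comm (x - y)^-1 x by apply/commr_sym/commrV/commr_sym.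
exists (S / (x - y)), (R / w / (x - y)); split.
- by apply/commr_sym/commrM; apply: commr_sym.
- apply/commr_sym/commrM; last exact: commr_sym.
  rewrite /GRing.comm mulrA xR; apply: (mulIr (divA w0)).
  rewrite mulrVK ?divA // -(mulrA _ x) wE mulrA mulrVK ?divA //.
- apply: (mulIr (divA d0)).
  rewrite mulrDl mulrVK ?divA // -SR; congr (_ + _).
  rewrite -(mulrA _ w) dw mulrA mulrN mulrVK ?divA // mulNr mulrVK ?divA //.
Qed.

(** In the decomposition of [quaternion_split] the second summand has trace zero. *)
Lemma trace_quaternion u : L u -> C (u + star u).
Proof.
move=> /quaternion_split[k [l [kx lx ->]]].
rewrite (starD starI) addrACA; apply: division_subringD => //; first exact: trace_fixed.
have [a [b [Ca Cb lE]]] := centralizer_split lx.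
have sj : star j = - j.
  have E v w : star (v * w - w * v) = star w * star v - star v * star w.
    by rewrite (starB starI) !(starM starI).
  rewrite E star_z (_ : y = t - x); last by rewrite /t addrC addKr.
  have := tC quaternion_x; have := tC quaternion_z; move: t z => p q tv tx.
  rewrite !mulrBr !mulrBl tv tx; ncring.
have := commutator_conj; have := conj_commutator quaternion_z; have := Lj; move: j sj => w sw Lw wE wx.
rewrite (starM starI) sw lE (starD starI) (starM starI).
have [[_ ->] [_ ->]] := (Ca, Cb).
rewrite mulNr mulrDr (mulrA w) -wE mulrDl (Lw a Ca) -(mulrA x) (Lw b Cb) mulrA.
have [bx _] := Cb.
by rewrite bx subrr; exact: division_subring0.
Qed.

(** By [norm_comm_of_traces] the norm of [u] commutes with [x] and [z]. *)
Lemma norm_quaternion u : L u -> C (u * star u).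
Proof.
move=> Lu; have LM v : L v -> L (u * v) by move=> Lv; exact: (division_subringM sL).
have Tr v w : L v -> L w -> GRing.comm (v + star v) w.
  by move=> Lv Lw; apply/commr_sym/Lw; exact: trace_quaternion.
have nC v : L v -> u * star u * v = v * (u * star u).
  by move=> Lv; apply: (norm_comm_of_traces starI); apply: (Tr) => //; exact: LM.
by apply: fixed_of_comm; apply: nC; [exact: quaternion_x | exact: quaternion_z].
Qed.

(** When [fixed_subfield] consists of scalars, its centralizer is the whole ring. *)
Lemma traces_of_scalar_fixed : (forall c, C c -> scalar c) ->
  traces star setT `<=` range (in_alg A).
Proof.
move=> Csc _ [u _ <-]; apply/Csc/trace_quaternion => v Cv.
by apply/commr_sym/scomm/Csc.
Qed.

(** Otherwise the quaternion subalgebra would be a finite noncommutative division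
    ring. *)
Lemma fixed_subfield_infinite : infinite_set C.
Proof.
move=> Cfin; have Kfin : finite_set [set a + b * x | a in C & b in C].
  exact: (finite_image2 (fun a b => a + b * x)).
have Lfin : finite_set L.
  apply: (sub_finite_set _ (finite_image2 (fun k l => k + l * j) Kfin Kfin)).
  move=> u /quaternion_split[k [l [kx lx ->]]].
  have [a [b [Ca Cb ->]]] := centralizer_split kx.
  have [c [d [Cc Cd ->]]] := centralizer_split lx.
  exists (a + b * x); first by exists a => //; exists b.
  by exists (c + d * x) => //; exists c => //; exists d.
have [L1 LB LM _] := sL.
apply: zx; apply: (finite_subring_commutative divA Lfin L1 LB LM).
  exact: quaternion_z.
exact: quaternion_x.
Qed.

End QuaternionSubalgebra.

(** * Normalizers of a commutative subfield *)

Section SemilinearNormalizer.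
Variables (F : fieldType) (A : unitAlgType F).
Hypothesis divA : division_ring A.
Hypothesis cardF : exists s : seq F, uniq s /\ size s = 4%N.
Variable C : set A.
Hypothesis fieldC : commutative_subfield C.
Hypothesis scalC : forall a : F, C a%:A.
Local Notation L := (centralizer C).
Variables (m : nat) (H : nat -> set A) (h : A).
Hypothesis chainH : subnormal_chain m H.
Hypothesis Hh : H 0%N h.
Hypothesis normC : forall w c, H 0%N w -> C c -> C (Ad w c).
Hypothesis moveC : exists2 c, C c & Ad h c <> c.

Local Notation s := (Ad h).
Let sC : division_subring C := fieldC.1.
Let CC := fieldC.2.
Let sL : division_subring L. Proof. exact: centralizer_division_subring. Qed.
Let sH : unit_subgroup (H 0%N). Proof. by case: chainH => _ /(_ 0%N (leq0n m)). Qed.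
Let h0 : h != 0. Proof. exact: (usubg_neq0 sH Hh). Qed.
Let uh : h \is a GRing.unit := divA h0.

Lemma normalizer_Ad w u : H 0%N w -> L u -> L (Ad w u).
Proof.
move=> Hw; have w0 := usubg_neq0 sH Hw; apply: centralizer_Ad => // c Cc; first exact: normC.
by apply: normC => //; exact: (usubgV sH).
Qed.

Let LC u c : L u -> C c -> u * c = c * u. Proof. by move=> Lu; exact: Lu. Qed.
Let CL c : C c -> L c. Proof. by move=> Cc d Cd; exact: CC. Qed.
Let hC c : h * c = s c * h. Proof. exact: Ad_mul. Qed.
Let Cs c : C c -> C (s c). Proof. exact: normC. Qed.

(** The coefficients commute with [C], whereas [h] induces the automorphism [s] on
    [C]; so commutators with elements of [C] separate the terms, except those in [1]
    and [h * h] when [s] is an involution. *)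
Lemma semilinear_relation (a2 a1 a0 : A) : L a2 -> L a1 ->
    a2 * h * h + a1 * h + a0 = 0 -> L a0 ->
  (forall c, C c -> s (s c) = c) /\ a1 = 0 \/ [/\ a2 = 0, a1 = 0 & a0 = 0].
Proof.
move=> L2 L1 E L0.
have E1 c : C c -> a2 * (s (s c) - c) * h + a1 * (s c - c) = 0.
  move=> Cc; apply: (mulIr uh); rewrite mul0r.
  transitivity ((a2 * h * h + a1 * h + a0) * c - c * (a2 * h * h + a1 * h + a0)
     - a2 * h * (h * c - s c * h) - a2 * (h * s c - s (s c) * h) * h - a1 * (h * c - s c * h)
     - (a2 * c - c * a2) * h * h - (a1 * c - c * a1) * h - (a0 * c - c * a0)).
    by ncring.
  by rewrite E !hC (LC L2 Cc) (LC L1 Cc) (LC L0 Cc) !subrr !(mul0r, mulr0, subr0).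
have [c Cc sc] := moveC; have scc : s c - c != 0 by rewrite subr_eq0; apply/eqP.
have [s2|s2] := pselect (forall c, C c -> s (s c) = c).
  left; split=> //; have := E1 c Cc; rewrite s2 // subrr mulr0 mul0r add0r.
  by case/(div_mul_eq0 divA) => // /eqP; rewrite (negPf scc).
right; have [d Cd sd] : exists2 d, C d & s (s d) <> d.
  apply: contrapT => no; apply: s2 => d Cd; apply: contrapT => sd; apply: no.
  by exists d.
have sdd : s (s d) - d != 0 by rewrite subr_eq0; apply/eqP.
have sd1 : s d - d != 0 by rewrite subr_eq0; apply/eqP => E2; apply: sd; rewrite !E2.
have a20 : a2 = 0.
  have : a2 * ((s (s d) - d) * (s d - d)) * h = 0.
    have Csd : C (s (s d) - d) by case: (sC) => _ CB _ _; apply: CB => //; do 2!apply: Cs.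
    have Csd1 : C (s d - d) by case: (sC) => _ CB _ _; apply: CB => //; apply: Cs.
    have e1 := LC (CL Csd) Cd; have e2 := LC (CL Csd1) Cd; have e3 := LC L2 Cd; have e4 := LC L1 Cd.
    have e5 := hC d; have := E1 d Cd.
    move: (s d) (s (s d) - d) e1 e2 e5 => q p e1 e2 e5 X0.
    transitivity ((a2 * p * h + a1 * (q - d)) * d - d * (a2 * p * h + a1 * (q - d))
      - a2 * p * (h * d - q * h) - (a2 * d - d * a2) * p * h - a2 * (p * d - d * p) * h
      - a1 * ((q - d) * d - d * (q - d)) - (a1 * d - d * a1) * (q - d)); first by ncring.
    by rewrite X0 e5 e3 e1 e2 e4 !subrr !(mul0r, mulr0, subr0).
  case/(div_mul_eq0 divA) => [|/eqP]; last by rewrite (negPf h0).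
  case/(div_mul_eq0 divA) => [//|/(div_mul_eq0 divA)[]/eqP]; first by rewrite (negPf sdd).
  by rewrite (negPf sd1).
have a10 : a1 = 0.
  have := E1 d Cd; rewrite a20 !mul0r add0r => /(div_mul_eq0 divA)[//|/eqP].
  by rewrite (negPf sd1).
by split=> //; move: E; rewrite a20 a10 !mul0r !add0r.
Qed.

Let scal_comm (a : F) u : GRing.comm (a%:A : A) u.
Proof. by rewrite /GRing.comm mulr_algl mulr_algr. Qed.

(** For a scalar [a], the commutator [w] of [a + h] and [l' * h] lies in [H 0], and it
    equals [(a + h) / (a + l * h)]. As [w] normalizes [C], it is a combination of
    [1] and [h] over [C], which turns [w * (a + l * h) = a + h] into a semilinear
    relation. *)
Lemma iter_twist_normalizer g : H 0%N g -> L g -> let l := iter m.+2 (twist h) g in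
  C l /\ ((forall c, C c -> s (s c) = c) \/ l = 1).
Proof.
move=> Hg Lg l; have g0 := usubg_neq0 sH Hg.
have sE u : L u -> L (s u) by exact: normalizer_Ad.
have twL u : L u -> L (twist h u).
  by move=> Lu; exact: (division_subringM sL Lu (division_subringV sL (sE u Lu))).
have itL k : L (iter k (twist h) g) by elim: k => //= k; exact: twL.
set l' := iter m.+1 (twist h) g.
have Ll' : L l' := itL _; have Ll : L l := itL _.
have l'0 : l' != 0 by exact: iter_twist_neq0.
have l0 : l != 0 by exact: iter_twist_neq0.
have Hl' : conjugates_series h (H 0%N) m.+1 (l' * h).
  exact: (conjugates_series_twist divA chainH).
have Hl'h : H 0%N (l' * h) by exact: (conjugates_series_sub sH Hh (leq0n _) Hl').
have lE : l' * h * h = l * h * (l' * h).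
  have -> : l * h = Ad l' h by rewrite /l iterS -/l' /twist -AdV // /Ad !mulrA mulrVK.
  by rewrite mulrA -(Ad_mul divA h l'0).
(* Among three nonzero scalars two have distinct squares. *)
have [a [a0 alh]] : exists a : F, a != 0 /\ (a%:A * a%:A : A) <> h * l * h.
  have [b] := @four_elements_avoid F [:: 0] cardF isT; rewrite inE => b0.
  have [c] := @four_elements_avoid F [:: 0; b; - b] cardF isT.
  rewrite !inE !negb_or => /and3P[c0 cb cNb].
  have [E|] := pselect ((b%:A * b%:A : A) = h * l * h); last by exists b.
  exists c; split=> // E'; move: E'; rewrite -E -!in_algE -!rmorphM => /fmorph_inj/eqP.
  by rewrite -!expr2 eqf_sqr (negPf cb) (negPf cNb).
pose v := a%:A + h; have aC u := scal_comm a u; have a0' : a%:A != 0 :> A.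
  by rewrite scaler_eq0 oner_eq0 orbF.
have v0 : v != 0.
  rewrite /v addrC addr_eq0; apply/eqP => hE; have [c Cc] := moveC; apply.
  by apply/Ad_fixP => //; rewrite hE; apply/commr_sym/commrN/commr_sym; exact: scal_comm.
have vh : GRing.comm v h by apply/commr_sym/commrD => //; exact/commr_sym/scal_comm.
have uv := divA v0; have ulh := divA (usubg_neq0 sH Hl'h).
pose w := Ad v (l' * h) / (l' * h).
have Hw : H 0%N w.
  apply: (usubg_div sH) => //; have := conjugates_series_Ad divA chainH Hh v0 vh Hl'.
  by have -> : (m.-1 - m.+1 = 0)%N by apply/eqP; rewrite subn_eq0 ltnW // ltnS leq_pred.
have wE : w * (a%:A + l * h) = a%:A + h.
  have vlh : (a%:A + l * h) * (l' * h) = l' * h * v.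
    by rewrite /v mulrDl mulrDr lE (aC (l' * h)).
  apply: (mulIr ulh); rewrite -(mulrA w) vlh /w (mulrA _ (l' * h) v) (mulrVK ulh).
  by rewrite -(Ad_mul divA).
have w0 := usubg_neq0 sH Hw.
clear Hl' Hl'h lE ulh; clearbody w l; clear l' Ll' l'0.
have CD := division_subringD sC; have CM := division_subringM sC.
have CB u u' : C u -> C u' -> C (u - u') by case: sC => _ + _ _; apply.
have [p [q [Cp Cq pqE]]] : exists p q, [/\ C p, C q & w = p + q * h].
  have [c Cc sc] := moveC; pose e := Ad w (s c) - Ad w c.
  have Ce : C e by apply: (CB); apply: normC => //; exact: Cs.
  have e0 : e != 0.
    by rewrite subr_eq0; apply/eqP => /(Ad_inj divA w0).
  have eE : e * (w * (l * h)) = (c - Ad w c) * a%:A + (s c - Ad w c) * h.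
    have wc := Ad_mul divA c w0; have wsc := Ad_mul divA (s c) w0.
    have lc := LC Ll (Cs Cc); have hc := hC c; have ac := aC c; have aw := aC w.
    have at_ := aC (Ad w c); rewrite /e.
    move: (s c) (Ad w (s c)) (Ad w c) wc wsc lc hc at_ => u3 u1 u2 wc wsc lc hc at_.
    transitivity ((w * (a%:A + l * h)) * c - u2 * (w * (a%:A + l * h))
      - w * (a%:A * c - c * a%:A) - (w * c - u2 * w) * a%:A - w * l * (h * c - u3 * h)
      - w * (l * u3 - u3 * l) * h - (w * u3 - u1 * w) * l * h); first by ncring.
    rewrite wE wc wsc lc hc ac !subrr !(mul0r, mulr0, subr0).
    by rewrite mulrDl hc ac; ncring.
  pose p1 := e^-1 * ((c - Ad w c) * a%:A); pose q1 := e^-1 * (s c - Ad w c).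
  have whE : w * (l * h) = p1 + q1 * h.
    by apply: (mulrI (divA e0)); rewrite eE mulrDr /p1 /q1 -!mulrA !mulVKr ?divA.
  have Ca := scalC a; have CAc := normC Hw Cc; have CeV := division_subringV sC Ce.
  have CaV := division_subringV sC Ca.
  exists ((a%:A - p1) / a%:A), ((1 - q1) / a%:A); split.
  - by apply: (CM) => //; apply: (CB) => //; apply: (CM) => //; apply: (CM) => //; apply: (CB).
  - apply: (CM) => //; apply: (CB); first by case: sC.
    by apply: (CM) => //; apply: (CB) => //; exact: Cs.
  - have : w * a%:A = (a%:A - p1) + (1 - q1) * h.
      have -> : w * a%:A = w * (a%:A + l * h) - w * (l * h) by rewrite mulrDr addrK.
      by rewrite wE whE mulrBl mul1r opprD addrACA.
    move: (1 - q1) (a%:A - p1) => q2 p2 E; apply: (mulIr (divA a0')).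
    rewrite E mulrDl mulrVK ?divA //; congr (_ + _).
    by rewrite -(mulrA _ h) -(aC h) mulrA mulrVK ?divA.
have Lq := CL Cq; have Lp := CL Cp; have Ca := CL (scalC a).
have LM := division_subringM sL; have LD := division_subringD sL.
have LB u u' : L u -> L u' -> L (u - u') by case: sL => _ + _ _; apply.
have L1 : L 1 by case: sL.
have hl : h * l = s l * h by exact: Ad_mul.
have Lsl := sE l Ll.
have rel : (q * s l) * h * h + (p * l + q * a%:A - 1) * h + (p - 1) * a%:A = 0.
  have ha := aC h; move: (s l) hl => l1 hl.
  transitivity ((p + q * h) * (a%:A + l * h) - (a%:A + h) - q * (h * l - l1 * h) * h
    + q * (a%:A * h - h * a%:A)); first by ncring.
  by rewrite -pqE wE hl ha !subrr !(mul0r, mulr0, subr0, addr0).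
have C1 : C 1 by case: sC.
have [||| [s2 a1]|[a2 a1 a0E]] := semilinear_relation _ _ rel _.
- exact: LM.
- by apply: (LB) => //; apply: (LD); exact: LM.
- by apply: LM => //; exact: LB.
- split; last by left.
  have plE : p * l = 1 - q * a%:A.
    by apply/eqP; rewrite -subr_eq0 opprB addrA a1.
  have [p0|p0] := eqVneq p 0; last first.
    rewrite -[l](mulKr (divA p0)) plE; apply: (CM); first exact: division_subringV.
    by apply: CB => //; apply: CM => //; exact: scalC.
  case: alh; have qa : q * a%:A = 1.
    by move/eqP: plE; rewrite p0 mul0r eq_sym subr_eq0 => /eqP.
  have : q * (h * l * h) = a%:A.
    apply/eqP; rewrite -subr_eq0 -rel p0 mul0r add0r qa subrr mul0r addr0 sub0r mulN1r.
    by rewrite hl -!mulrA.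
  by move/(congr1 ( *%R a%:A)); rewrite (mulrA a%:A q) (aC q) qa mul1r => ->.
- have sl0 : s l != 0 by exact: Ad_neq0.
  have q0 : q = 0 by case/(div_mul_eq0 divA): a2 => // /eqP; rewrite (negPf sl0).
  have p1 : p = 1.
    by case/(div_mul_eq0 divA): a0E => [/subr0_eq//|/eqP]; rewrite (negPf a0').
  by move: a1; rewrite q0 p1 mul1r mul0r addr0 => /subr0_eq ->; split=> //; right.
Qed.

(** The first [m] coboundaries of [u] lead from the units down to [H 0], and
    [iter_twist_normalizer] supplies the remaining ones. *)
Lemma iter_twist_in_fixed u : L u -> u != 0 -> let l := iter (m.+2 + m) (twist h) u in
  C l /\ ((forall c, C c -> s (s c) = c) \/ l = 1).
Proof.
move=> Lu u0; rewrite iterD; apply: iter_twist_normalizer.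
  by have := @twist_chain A divA m H chainH h u m Hh u0; rewrite subnn.
have twL v : L v -> L (twist h v).
  move=> Lv; apply: (division_subringM sL Lv (division_subringV sL _)).
  exact: normalizer_Ad.
by elim: m => //= k; exact: twL.
Qed.

(** Otherwise all iterated coboundaries of [h] on the field [C] would be trivial,
    against [iter_twist_trivial]. *)
Lemma normalizer_involutive : infinite_set C -> forall c, C c -> s (s c) = c.
Proof.
move=> Cinf; apply: contrapT => s2; have [c Cc] := moveC; apply.
apply: (iter_twist_trivial divA fieldC h0 Cs (k := m.+2 + m) Cinf) => // d Cd d0.
by have [_ []] := iter_twist_in_fixed (CL Cd) d0.
Qed.

End SemilinearNormalizer.

(** * Normalizers acting as an involution *)

Section InvolutiveNormalizer.
Variables (F : fieldType) (A : unitAlgType F) (star : A -> A).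
Hypothesis divA : division_ring A.
Hypothesis centerA : center A = range (in_alg A).
Hypotheses (starI : involution star) (star1 : first_kind star).
Variable C : set A.
Hypothesis fieldC : commutative_subfield C.
Local Notation L := (centralizer C).
Hypothesis starC : forall c, C c -> star c = c.
Hypothesis starL : forall u, L u -> L (star u).
Hypothesis traceC : forall u, L u -> C (u + star u).
Hypothesis normC : forall u, L u -> C (u * star u).
Variable h : A.
Hypothesis h0 : h != 0.
Local Notation s := (Ad h).
Local Notation f := (twist h).
Hypothesis Cs : forall c, C c -> C (s c).
Hypothesis CsV : forall c, C c -> C (Ad h^-1 c).
Hypothesis ss : forall c, C c -> s (s c) = c.

Let sC : division_subring C := fieldC.1.
Let CC := fieldC.2.
Let sL : division_subring L. Proof. exact: centralizer_division_subring. Qed.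
Let CL c : C c -> L c. Proof. by move=> Cc d Cd; exact: CC. Qed.
Let sE u : L u -> L (s u). Proof. exact: centralizer_Ad. Qed.
Let CB u v : C u -> C v -> C (u - v). Proof. by case: sC => _ + _ _; apply. Qed.
Let starV' u : u != 0 -> star u^-1 = (star u)^-1.
Proof. by move=> /divA uu; have [] := starV centerA starI star1 uu. Qed.

Lemma star_neq0 u : u != 0 -> star u != 0.
Proof. by apply: contra_neq => E; rewrite -(starK starI u) E (star0 starI). Qed.

Lemma star_comm u : L u -> star u * u = u * star u.
Proof.
move=> Lu; have -> : star u = (u + star u) - u by rewrite addrC addKr.
by rewrite mulrBl mulrBr (Lu _ (traceC Lu)).
Qed.

(** On [L] the map [star] is determined by the minimal equations over [C], which
    conjugation by [h] permutes. *)
Lemma star_normalizer u : L u -> star (s u) = s (star u).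
Proof.
move=> Lu; have Lsu := sE Lu; pose c := s (star u) - star (s u).
have Cc : C c.
  have -> : c = s (u + star u) - (s u + star (s u)) by rewrite AdD opprD addrACA subrr add0r.
  by apply: CB; [apply/Cs/traceC | exact: traceC].
have Csc : C (s u * c).
  by rewrite mulrBr -AdM //; apply: CB; [apply/Cs/normC | exact: normC].
have [c0|c0] := eqVneq c 0; first by apply/esym/subr0_eq.
have Csu : C (s u).
  by rewrite -[s u](mulrK (divA c0)); apply: (division_subringM sC) => //; exact: division_subringV.
have Cu : C u.
  have <- : Ad h^-1 (s u) = u; last exact: CsV.
  by rewrite /Ad invrK !mulrA mulVr ?divA // mul1r mulrVK ?divA.
by rewrite starC // starC.
Qed.

Definition unitary u := L u /\ u * star u = 1.

Lemma unitary_neq0 u : unitary u -> u != 0.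
Proof. by case=> _; apply: contra_eq_neq => ->; rewrite mul0r eq_sym oner_neq0. Qed.

Lemma twist_unitary u : unitary u -> unitary (f u).
Proof.
move=> uu; have u0 := unitary_neq0 uu; have [Lu u1] := uu; split.
  exact: (division_subringM sL Lu (division_subringV sL (sE Lu))).
have su0 := Ad_neq0 divA h0 u0; have ssu0 := Ad_neq0 divA h0 (star_neq0 u0).
have E : s (star u) * s u = 1 by rewrite -AdM // star_comm // u1 Ad1.
rewrite /twist (starM starI) starV' // star_normalizer // !mulrA -(mulrA u).
by rewrite -invrM ?divA // E invr1 mulr1.
Qed.

Lemma unitary_fixed c : C c -> unitary c -> c = 1 \/ c = -1.
Proof.
move=> Cc [_]; rewrite (starC Cc) => c1.
have /(div_mul_eq0 divA)[/subr0_eq|/eqP] : (c - 1) * (c + 1) = 0; [|by left|].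
  by transitivity (c * c - 1); [ncring | rewrite c1 subrr].
by rewrite addr_eq0 => /eqP; right.
Qed.

Lemma unitary_quotient v : L v -> v != 0 -> unitary (v / star v).
Proof.
move=> Lv v0; have sv0 := star_neq0 v0; split.
  exact: (division_subringM sL Lv (division_subringV sL (starL Lv))).
rewrite (starM starI) starV' // (starK starI) mulrA -(mulrA v) -invrM ?divA //.
by rewrite -star_comm // invrM ?divA // mulVKr ?divA // mulVr ?divA.
Qed.

(** Either [x] or [1 + x], divided by its image under [star], is as wanted: the two
    quotients cannot both be signs, which the unitary elements of [C] are. *)
Lemma nonfixed_unitary x : L x -> star x <> x -> exists2 u, unitary u & ~ C u.
Proof.
move=> Lx sx; apply: contrapT => no.
have sgn v : L v -> v != 0 -> v = star v \/ v = - star v.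
  move=> Lv v0; have uv := unitary_quotient Lv v0; have sv := divA (star_neq0 v0).
  have Cv : C (v / star v) by apply: contrapT => nC; apply: no; exists (v / star v).
  rewrite -{1 3}[v](mulrVK sv); case: (unitary_fixed Cv uv) => ->; first by left; rewrite mul1r.
  by right; rewrite mulN1r.
have L1 : L 1 by case: sL.
have x0 : x != 0 by apply: contra_notN sx => /eqP->; rewrite (star0 starI).
have s1 : star 1 = 1 := star_one centerA star1.
have x1 : 1 + x != 0.
  apply: contra_notN sx; rewrite addrC addr_eq0 => /eqP->.
  by rewrite (starN starI) s1.
have [/esym//|xE] := sgn x Lx x0.
have [] := sgn _ (division_subringD sL L1 Lx) x1; rewrite (starD starI) s1.
  by move/addrI/esym.
rewrite opprD -xE => /addIr E1; apply: sx; apply: (addrI x); rewrite {1}xE addNr.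
by rewrite -[x]mul1r -mulrDl {1}E1 addNr mul0r.
Qed.

Hypothesis Cinf : infinite_set C.

Let C0 := [set c | C c /\ s c = c].

(** Each [c] in [C] is a root of a quadratic equation whose coefficients [c + s c]
    and [c * s c] are invariant. *)
Lemma infinite_invariants : infinite_set C0.
Proof.
move=> C0fin; apply: Cinf.
pose S (pq : A * A) := [set c | C c /\ c * c = pq.1 * c - pq.2].
apply: (@sub_finite_set _ _ (\bigcup_(pq in C0 `*` C0) S pq)); last first.
  apply: bigcup_finite; first exact: finite_setX.
  move=> [p q] [[/= Cp _] [Cq _]].
  have [[w [Cw wE]]|no] := pselect (exists w, S (p, q) w); last first.
    by apply: (sub_finite_set _ (finite_set0 A)) => w Sw; apply: no; exists w.
  apply: (sub_finite_set _ (finite_seq [:: w; p - w])) => c [Cc cE] /=.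
  have := quadratic_roots divA (CC Cp Cw) wE (CC Cp Cc) cE (CC Cc Cw).
  by rewrite !inE => -[] ->; rewrite eqxx ?orbT.
move=> c Cc; have Csc := Cs Cc; exists (c + s c, c * s c); split=> //=.
- split; first exact: division_subringD.
  by rewrite AdD ss // addrC.
- split; first exact: (division_subringM sC).
  by rewrite AdM // ss //; exact: CC.
- by rewrite mulrDl (CC Cc Csc) addrK.
Qed.

Variable K : nat.
Hypothesis iterC : forall u, L u -> u != 0 -> C (iter K.+1 f u).

(** Let [w] commute with its conjugates. Iterated coboundaries are powers of the first
    one on the unitary elements [(a + w) / (a + star w)], with [a] in [C] invariant;
    as they are signs, comparing linear factors shows that [star] or conjugation by
    [h] fixes [w]. *)
Lemma invariant_of_iter E w : commutative_subfield E -> L w -> E w -> E (star w) ->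
    E (s w) -> E (s (star w)) -> C0 `<=` E -> s (s w) = w ->
  w = star w \/ w = s w.
Proof.
move=> fieldE Lw Ew Esw Eaw Easw C0E ssw; have [sE' EC] := fieldE.
pose M := (2 ^ K.+1)%N.
have key a : C0 a -> a + w != 0 ->
    ((a + w) * (a + s (star w))) ^+ M = ((a + star w) * (a + s w)) ^+ M.
  move=> C0a aw0; have [Ca sa] := C0a; have Ea := C0E _ C0a.
  have La := CL Ca; have Law := division_subringD sL La Lw.
  have saw : star (a + w) = a + star w by rewrite (starD starI) starC.
  pose u := (a + w) / (a + star w).
  have uu : unitary u by rewrite /u -saw; exact: unitary_quotient.
  have u0 := unitary_neq0 uu.
  have ED := division_subringD sE'; have EV := division_subringV sE'.
  have EM := division_subringM sE'.
  have suE : s u = (a + s w) / (a + s (star w)).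
    by rewrite /u AdM // AdV // !AdD sa.
  have Eu : E u by apply: (EM) => //; [|apply: EV]; exact: ED.
  have Esu : E (s u) by rewrite suE; apply: (EM) => //; [|apply: EV]; exact: ED.
  have ssu : s (s u) = u.
    have sswE : s (s (star w)) = star w.
      by rewrite -star_normalizer // -star_normalizer ?ssw //; exact: sE.
    by rewrite suE AdM // AdV // !AdD sa ssw sswE.
  have uE : u = (a + w) / (a + star w) by [].
  clearbody u; have su0 := Ad_neq0 divA h0 u0.
  have fE : f u = u / s u by [].
  have sfu : s (f u) = (f u)^-1.
    by rewrite fE AdM // AdV // ssu invrM ?unitrV ?divA // invrK.
  have f0 := twist_neq0 divA h0 u0.
  have itf k : iter k.+1 f u = f u ^+ (2 ^ k).
    elim: k => [|k IH]; first by rewrite expr1.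
    by rewrite iterS IH {1}/twist AdX // sfu exprVn invrK -exprD addnn -mul2n -expnS.
  have itu k : unitary (iter k f u) by elim: k => //= k; exact: twist_unitary.
  have fM : f u ^+ M = 1.
    rewrite /M expnSr exprM -itf expr2.
    have [Lu _] := uu.
    by case: (unitary_fixed (iterC Lu u0) (itu _)) => ->; rewrite ?mulr1 // mulrNN mulr1.
  have aw1 : a + star w != 0 by rewrite -saw; exact: star_neq0.
  have aw2 : a + s w != 0 by rewrite -{1}sa -AdD; exact: Ad_neq0.
  have aw3 : a + s (star w) != 0 by rewrite -{1}sa -AdD; exact: Ad_neq0.
  have fuE : f u * ((a + star w) * (a + s w)) = (a + w) * (a + s (star w)).
    rewrite fE suE uE invrM ?unitrV ?divA // invrK.
    have := EC _ _ (ED _ _ Ea Esw) (ED _ _ Ea Eaw).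
    have qv := EC _ _ (ED _ _ Ea Esw) (ED _ _ Ea Eaw).
    have qt := EC _ _ (ED _ _ Ea Esw) (ED _ _ Ea Easw).
    move: (a + w) (a + star w) (a + s w) (a + s (star w)) aw0 aw1 aw2 aw3 qv qt.
    move=> p q v t p0 q0 v0 t0 qv qt; rewrite qv -(mulrA p) -(mulrA p) (mulrA (q^-1 * _)).
    by rewrite -(mulrA q^-1) mulrVK ?divA // -(mulrA q^-1) -qt mulKr ?divA.
  have fuC : GRing.comm (f u) ((a + star w) * (a + s w)).
    by apply: EC; [apply: (EM) => //; exact: EV | apply: (EM); exact: ED].
  by rewrite -fuE (exprMn_comm M fuC) fM mul1r.
have prodE a (c : A) : \prod_(x <- nseq M c) (a + x) = (a + c) ^+ M.
  by rewrite big_nseq iter_mulr_1.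
pose xs := nseq M w ++ nseq M (s (star w)); pose ys := nseq M (star w) ++ nseq M (s w).
have M0 : (0 < M)%N by rewrite expn_gt0.
have xsE y : y \in xs ++ ys -> E y.
  by rewrite !mem_cat !mem_nseq M0 /= => /orP[]/orP[]/eqP->.
have : {subset xs <= ys}.
  apply: (@linear_factors A divA _ _ (C0 `\` [set - w])).
  - by apply: infinite_setD; [exact: infinite_invariants | exact: finite_set1].
  - by move=> a b [/C0E Ea _] [/C0E Eb _]; exact: EC.
  - by move=> a y [/C0E Ea _] /xsE; exact: EC.
  - by move=> y y' yxs /xsE; apply: EC; apply: xsE; rewrite mem_cat yxs.
  - move=> a [C0a /eqP]; rewrite -addr_eq0 => aw0.
    have ED := division_subringD sE'; have Ea := C0E _ C0a.
    rewrite !big_cat !prodE /= -!exprMn_comm ?key //; apply: EC; exact: ED.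
move/(_ w); rewrite !mem_cat !mem_nseq M0 eqxx /= => /(_ isT) /orP[/eqP|/eqP]; [by left|by right].
Qed.

(** Let [t] be the last iterated coboundary of a unitary element that is outside
    [C]. The next one is a sign, so that [s t = t] or [s t = - t], and
    [invariant_of_iter] is contradicted by [c * t], where [s] moves [c], in the
    first case and by [t] in the second. *)
Lemma no_involutive_normalizer x : L x -> star x <> x -> ~ (exists2 c, C c & s c <> c).
Proof.
move=> Lx sx [c Cc sc]; have [u0 uu0 Cu0] := nonfixed_unitary Lx sx.
have [t [ut Ct Cft]] : exists t, [/\ unitary t, ~ C t & C (f t)].
  have itu k : unitary (iter k f u0) by elim: k => //= k; exact: twist_unitary.
  apply: contrapT => no; suff : ~ C (iter K.+1 f u0).
    by apply; apply: iterC; [case: uu0 | exact: unitary_neq0].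
  elim: K.+1 => // k IH Ck; apply: no; exists (iter k f u0); split=> //.
have t0 := unitary_neq0 ut; have [Lt t1] := ut.
have stE : star t = t^-1 by apply: (mulrI (divA t0)); rewrite t1 mulrV ?divA.
have st : s t = t \/ s t = - t.
  have := twist_mul divA h0 t0; case: (unitary_fixed Cft (twist_unitary ut)) => ->.
    by rewrite mul1r; left.
  by rewrite mulN1r => E1; right; rewrite -[in RHS]E1 opprK.
pose X := C `|` [set t].
have XC a b : X a -> X b -> GRing.comm a b.
  move=> [Ca|->] [Cb|->]; [exact: CC | | exact: Lt | exact: commr_refl].
  by apply: commr_sym; exact: Lt.
pose E := bicommutant X; have fieldE : commutative_subfield E := bicommutant_subfield XC.
have CE a : C a -> E a by move=> Ca; apply: bicommutant_sub; left.
have Et : E t by apply: bicommutant_sub; right.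
have [sE' _] := fieldE; have EM := division_subringM sE'; have EN a := @division_subringN _ _ a sE'.
have EV := division_subringV sE'.
have C0E : C0 `<=` E by move=> a [Ca _]; exact: CE.
have LM := division_subringM sL.
have tt1 : t * t <> 1.
  move=> tt; apply: Ct.
  have /(div_mul_eq0 divA)[/subr0_eq->|/eqP] : (t - 1) * (t + 1) = 0.
  - by transitivity (t * t - 1); [ncring | rewrite tt subrr].
  - by case: sC.
  - by rewrite addr_eq0 => /eqP ->; apply: division_subringN => //; case: sC.
have [{}st|st'] := pselect (s t = t).
  have c0 : c != 0 by apply: contra_notN sc => /eqP ->; rewrite Ad0.
  have sct : star (c * t) = t^-1 * c by rewrite (starM starI) stE starC.
  have [] := @invariant_of_iter E (c * t) fieldE; rewrite ?sct.
  - by apply: LM => //; exact: CL.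
  - by apply: EM => //; exact: CE.
  - by apply: EM; [exact: EV | exact: CE].
  - by rewrite AdM // st; apply: EM => //; apply/CE/Cs.
  - by rewrite AdM // AdV // st; apply: EM; [exact: EV | apply/CE/Cs].
  - exact: C0E.
  - by rewrite (AdM divA c t h0) (AdM divA (s c) (s t) h0) ss // !st.
  - rewrite -(Lt c Cc) => E1; apply: tt1; have := mulIr (divA c0) E1 => tV.
    by rewrite {1}tV mulVr ?divA.
  - by rewrite AdM // st => /(mulIr (divA t0)) /esym.
have {}st : s t = - t by case: st.
have [] := @invariant_of_iter E t fieldE; rewrite ?stE //.
- exact: EV.
- by rewrite st; exact: EN.
- by rewrite AdV // st; apply/EV/EN.
- by rewrite st AdN st opprK.
- by move=> E1; apply: tt1; rewrite {1}E1 mulVr ?divA.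
- by move/esym.
Qed.

End InvolutiveNormalizer.

(** * Traces in a division ring *)

Section ExtendedChain.
Variable A : unitRingType.
Hypothesis divA : division_ring A.
Variables (r : nat) (H : nat -> set A) (x : A).
Hypotheses (chainH : subnormal_chain r H) (Hx : H 0%N x).

(** Prolonged downwards by the series of conjugates of [x], the chain starts inside
    [quaternion_subalgebra], so that it makes sense to look for the step at which it
    leaves it. *)
Definition extended_chain (i : nat) : set A :=
  if (i <= r.+1)%N then conjugates_series x (H 0%N) (r.+1 - i) else H (i - r.+1)%N.

Lemma extended_chainD j : extended_chain (r.+1 + j) = H j.
Proof.
rewrite /extended_chain; case: j => [|j]; first by rewrite addn0 leqnn subnn.
by rewrite addnS ltnNge leq_addr /= -addnS addKn.
Qed.

Lemma extended_subnormal_chain : subnormal_chain (r.+1 + r) extended_chain.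
Proof.
have [Hr subH normH] := chainH; have sG := subH 0%N (leq0n r).
split=> [|i ir|i ir]; first by rewrite extended_chainD.
- have [ir1|ir1] := leqP i r.+1.
    by rewrite /extended_chain ir1; have [] := conjugates_series_subgroup (r.+1 - i) sG Hx.
  by rewrite -(subnKC (ltnW ir1)) extended_chainD; apply: subH; rewrite leq_subLR.
- have [ir1|ir1] := leqP i.+1 r.+1.
    rewrite /extended_chain ir1 (ltnW ir1) subSS subSn //.
    have [sC Cx] := conjugates_series_subgroup (r - i) sG Hx.
    exact: (conjugates_subgroup_normal divA sC Cx).
  rewrite ltnS in ir1; rewrite -(subnKC ir1) -addnS !extended_chainD.
  by apply: normH; rewrite ltn_subLR.
Qed.

Lemma subnormal_chain_drop (n k : nat) (M : nat -> set A) :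
  subnormal_chain (k + n) M -> subnormal_chain n (fun i => M (k + i)%N).
Proof.
move=> [Mr subM normM]; split=> // i ni; first by apply: subM; rewrite leq_add2l.
by rewrite addnS; apply: normM; rewrite ltn_add2l.
Qed.

End ExtendedChain.

Section DivisionTraces.
Variables (F : fieldType) (A : unitAlgType F) (star : A -> A).
Hypothesis divA : division_ring A.
Hypothesis centerA : center A = range (in_alg A).
Hypothesis cardF : exists s : seq F, uniq s /\ size s = 4%N.
Hypotheses (starI : involution star) (star1 : first_kind star).
Variables (r : nat) (H : nat -> set A).
Hypothesis chainH : subnormal_chain r H.
Hypothesis nabH : nonabelian (H 0%N).
Hypothesis normsH : norms star (H 0%N) `<=` range (in_alg A).

(** If [fixed_subfield] does not consist of scalars, the extended chain leaves its
    centralizer at some step. An element [h] of the first term that is not contained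
    in the centralizer normalizes [fixed_subfield] and moves it, which
    [no_involutive_normalizer] excludes. *)
Lemma division_traces : traces star setT `<=` range (in_alg A).
Proof.
have [x [s [Gx Cs zx sx]]] := moved_element divA centerA cardF starI star1 chainH nabH normsH.
pose C := fixed_subfield star x; pose L := centralizer C.
have fieldC : commutative_subfield C :=
  fixed_subfield_field divA centerA cardF starI star1 chainH normsH Gx Cs zx sx.
have [Csc|Cn] := pselect (forall c, C c -> range (in_alg A) c).
  exact: (traces_of_scalar_fixed divA centerA cardF starI star1 chainH normsH Gx Cs zx sx).
have Cseries := fixed_comm_series divA centerA cardF starI star1 chainH normsH Gx sx.
have sG : unit_subgroup (H 0%N) by case: chainH => _ /(_ 0%N (leq0n r)).
pose M := extended_chain r H x.
have chainM : subnormal_chain (r.+1 + r) M := extended_subnormal_chain divA chainH Gx.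
have [MR subM normM] := chainM.
have M0L : M 0%N `<=` L.
  move=> y; rewrite /M /extended_chain subn0 /= => Cy c Cc; apply: commr_sym.
  by apply: Cseries => //; exact: (conjugates_series_sub sG Gx (leqnSn r)).
have [i [h [ir ML Mh Lh]]] : exists i h, [/\ (i < r.+1 + r)%N, M i `<=` L, M i.+1 h & ~ L h].
  apply: contrapT => no; apply: Cn => c Cc.
  have ML i : (i <= r.+1 + r)%N -> M i `<=` L.
    elim: i => // i IH ir h Mh; apply: contrapT => Lh; apply: no.
    by exists i, h; split=> //; apply: IH; exact: ltnW.
  apply: (central_scalar centerA) => y; have [->|y0] := eqVneq y 0; first by rewrite mulr0 mul0r.
  by apply/esym/(ML _ (leqnn _)) => //; rewrite MR; exact: divA.
pose m := (r.+1 + r - i.+1)%N; pose H' j := M (i.+1 + j)%N.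
have chainH' : subnormal_chain m H' by apply: subnormal_chain_drop; rewrite subnKC.
have H'0 : H' 0%N = M i.+1 by rewrite /H' addn0.
have H'h : H' 0%N h by rewrite H'0.
have sub0 j : (j <= r.+1 + r)%N -> M 0%N `<=` M j.
  exact: (chain_mono chainM).
have CE : C = centralizer (M i).
  apply/seteqP; split=> [c Cc y My|c Cy]; first by apply: commr_sym; exact: ML.
  have [sr Cx1] := conjugates_series_subgroup r.+1 sG Gx.
  have M0 y : conjugates_series x (H 0%N) r.+1 y -> M i y.
    by move=> Cy'; apply: (sub0 i (ltnW ir)); rewrite /M /extended_chain subn0.
  apply: (fixed_of_comm divA centerA cardF starI star1 chainH normsH Gx Cs zx sx); apply: Cy; apply: M0 => //.
  exact: conjugates_in.
have normC w c : H' 0%N w -> C c -> C (Ad w c).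
  rewrite H'0 CE => Mw; have w0 := usubg_neq0 (subM _ ir) Mw.
  have [_ nM] := normM i ir.
  apply: centralizer_Ad => // y My; apply: nM => //; exact: (usubgV (subM _ ir)).
have moveC : exists2 c, C c & Ad h c <> c.
  apply: contrapT => no; apply: Lh => c Cc; apply: contrapT => hc; apply: no.
  by exists c => // /(Ad_fixP divA) hc'; apply/hc/hc'; exact: (usubg_neq0 (subM _ ir) Mh).
have scalC a : C a%:A.
  split; last exact: (star_scalar centerA star1 (scalarA A a)).
  exact: (scalar_comm centerA _ (scalarA A a)).
have Cinf := fixed_subfield_infinite divA centerA cardF starI star1 chainH normsH Gx Cs zx sx.
have h0 := usubg_neq0 (subM _ ir) Mh.
have ss := normalizer_involutive divA cardF fieldC scalC chainH' H'h normC moveC Cinf.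
have iterC u : L u -> u != 0 -> C (iter (m.+1 + m).+1 (twist h) u).
  by move=> Lu u0; have [] := iter_twist_in_fixed divA cardF fieldC scalC chainH' H'h normC moveC Lu u0.
exfalso; apply: (no_involutive_normalizer divA centerA starI star1 fieldC _ _ _ _ h0 _ _ ss Cinf iterC _ sx moveC).
- by move=> c [].
- exact: quaternion_star.
- exact: (trace_quaternion divA centerA cardF starI star1 chainH normsH Gx Cs zx sx).
- exact: (norm_quaternion divA centerA cardF starI star1 chainH normsH Gx Cs zx sx).
- by move=> c Cc; exact: normC.
- by move=> c Cc; apply: normC => //; rewrite H'0; exact: (usubgV (subM _ ir)).
- exact: quaternion_x.
Qed.

End DivisionTraces.

(** * Quaternion division algebras *)

Section Quaternions.
Variables (F : fieldType) (A : unitAlgType F) (star : A -> A).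
Hypothesis divA : division_ring A.
Hypothesis centerA : center A = range (in_alg A).
Hypothesis cardF : exists s : seq F, uniq s /\ size s = 4%N.
Hypotheses (starI : involution star) (star1 : first_kind star).
Hypothesis nabA : nonabelian (units A).
Hypothesis normsA : norms star setT `<=` range (in_alg A).

(** With [G] the group of all units, [fixed_subfield] consists of scalars, and
    [quaternion_split] provides the basis [1], [x], [j], [x * j]. *)
Lemma division_basis : exists b : 'I_4 -> A,
  bijective (fun v : 'rV[F]_4 => \sum_i v 0 i *: b i).
Proof.
pose H (i : nat) := units A.
have chainH : subnormal_chain 0 H.
  split=> // i _; split=> //; split=> [|x y]; rewrite !inE; first exact: unitr1.
  by move=> ux uy; have : x / y \is a GRing.unit by rewrite unitrMl ?unitrV.
have normsH : norms star (H 0%N) `<=` range (in_alg A).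
  by move=> _ [u _ <-]; apply: normsA; exists u.
have [x [s [Gx Cs zx sx]]] := moved_element divA centerA cardF starI star1 chainH nabA normsH.
pose j := x * Ad s x - Ad s x * x.
have Csc c : fixed_subfield star x c -> exists a, c = a%:A.
  move=> Cc; have : range (in_alg A) c.
    apply: (central_scalar centerA) => y; have [->|y0] := eqVneq y 0; first by rewrite mulr0 mul0r.
    exact: (fixed_comm_series divA centerA cardF starI star1 chainH normsH Gx sx Cc (divA y0)).
  by move=> [a _ <-]; exists a.
have L u : quaternion_subalgebra star x u.
  by move=> c /Csc[a ->]; rewrite /GRing.comm mulr_algl mulr_algr.
have split1 v : GRing.comm v x -> exists a b, v = a%:A + b *: x.
  move=> /(centralizer_split divA centerA starI star1 chainH normsH Gx sx)[a [b [/Csc[a' ->] /Csc[b' ->] ->]]].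
  by exists a', b'; rewrite mulr_algl.
have indep1 a b : a%:A + b *: x = 0 -> a = 0 /\ b = 0.
  have [->|b0] := eqVneq b 0.
    by rewrite scale0r addr0 => /eqP; rewrite scaler_eq0 oner_eq0 orbF => /eqP.
  move=> E; case: zx; have -> : x = (- (b^-1 * a))%:A.
    rewrite scaleNr -scalerA -(scalerK b0 x) -scalerN; congr (_ *: _).
    by apply/eqP; rewrite -addr_eq0 addrC E.
  by rewrite /GRing.comm mulr_algl mulr_algr.
have jx : j * x = star x * j by apply: commutator_conj; eassumption.
have xj : x * j = j * star x.
  by apply: conj_commutator; first [exact: L | eassumption].
have j0 : j != 0 by rewrite /j subr_eq0; apply/eqP => /esym.
have jnx : ~ GRing.comm j x.
  by rewrite /GRing.comm jx => /(mulIr (divA j0)).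
pose b (i : 'I_4) := nth 0 [:: 1; x; j; x * j] i.
exists b; pose g (v : 'rV[F]_4) := \sum_i v 0 i *: b i.
have gB v w : g (v - w) = g v - g w.
  by rewrite /g -sumrB; apply: eq_bigr => i _; rewrite !mxE scalerBl.
pose o0 : 'I_4 := @Ordinal 4 0 isT; pose o1 : 'I_4 := @Ordinal 4 1 isT.
pose o2 : 'I_4 := @Ordinal 4 2 isT; pose o3 : 'I_4 := @Ordinal 4 3 isT.
have gE v : g v = ((v 0 o0)%:A + v 0 o1 *: x) + ((v 0 o2)%:A + v 0 o3 *: x) * j.
  rewrite /g !big_ord_recl big_ord0 addr0 /b /= mulrDl mulr_algl -scalerAl !addrA.
  by congr (_ *: _ + _ *: _ + _ *: _ + _ *: _); congr (v _ _); apply/val_inj.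
have g0 v : g v = 0 -> v = 0.
  rewrite gE => E; have [kl0|kl0] := eqVneq ((v 0 o2)%:A + v 0 o3 *: x) 0.
    move: E; rewrite kl0 mul0r addr0 => /indep1[v0 v1]; have [v2 v3] := indep1 _ _ kl0.
    apply/rowP => i; rewrite mxE.
    have [->|->|->|->] : [\/ i = o0, i = o1, i = o2 | i = o3]; rewrite ?v0 ?v1 ?v2 ?v3 //.
    case: i => -[|[|[|[|//]]]] i4; [constructor 1|constructor 2|constructor 3|constructor 4];
      exact/val_inj.
  case: jnx; have cx c d : GRing.comm (c%:A + d *: x) x.
    by rewrite /GRing.comm mulrDl mulrDr mulr_algl mulr_algr -scalerAl -scalerAr.
  have -> : j = ((v 0 o2)%:A + v 0 o3 *: x)^-1 * - ((v 0 o0)%:A + v 0 o1 *: x).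
    apply: (mulrI (divA kl0)); rewrite mulVKr ?divA //.
    by apply/eqP; rewrite -addr_eq0 addrC E.
  apply/commr_sym/commrM; first exact/commrV/commr_sym/cx.
  by apply/commrN/commr_sym/cx.
have ginj : injective g by move=> v w E; apply/subr0_eq/g0; rewrite gB E subrr.
have gsurj u : exists v, g v = u.
  have [k [l [kx lx ->]]] := quaternion_split divA centerA cardF starI star1 chainH normsH Gx Cs zx sx (L u).
  have [a0 [a1 ->]] := split1 k kx; have [a2 [a3 ->]] := split1 l lx.
  by exists (\row_i nth 0 [:: a0; a1; a2; a3] i); rewrite gE !mxE.
exists (fun u => sval (cid (gsurj u))) => [v|u]; last exact: (svalP (cid (gsurj u))).
by apply: ginj; exact: (svalP (cid (gsurj (g v)))).
Qed.

Lemma division_structure : quaternion_division_algebra A /\ centrally_finite A.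
Proof.
have [b [g bK gK]] := division_basis.
have bL : linear (fun v : 'rV[F]_4 => \sum_i v 0 i *: b i).
  move=> a u v; rewrite scaler_sumr -big_split; apply: eq_bigr => i _ /=.
  by rewrite !mxE scalerDl scalerA.
have gL : linear g.
  by move=> a u v; apply: (can_inj bK); rewrite bL !gK.
split; last first.
  split=> //; exists (mkseq (fun k => b (inord k)) 4) => x.
  exists (fun i => (g x 0 (inord i))%:A); split=> [i|].
    by rewrite centerA; exists (g x 0 (inord i)).
  rewrite -{1}[x]gK size_mkseq; apply: eq_bigr => i _.
  by rewrite inord_val mulr_algl nth_mkseq // inord_val.
split=> //.
pose v : {linear A -> 'rV[F]_4} := HB.pack g (GRing.isLinear.Build _ _ _ _ g gL).
by exists v; exists (fun v : 'rV[F]_4 => \sum_i v 0 i *: b i).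
Qed.

End Quaternions.

(** * Matrix units from an involution with scalar traces and norms *)

Section MatrixUnits.
Variables (F : fieldType) (A : unitAlgType F) (star : A -> A).
Hypothesis centerA : center A = range (in_alg A).
Hypothesis alsaA : almost_locally_simple_artinian A.
Hypotheses (starI : involution star) (star1 : first_kind star).
Hypothesis tracesA : traces star setT `<=` range (in_alg A).
Hypothesis normsA : norms star setT `<=` range (in_alg A).

Let trace u : exists a : F, u + star u = a%:A.
Proof.
have [a _ aE] : range (in_alg A) (u + star u) by apply: tracesA; exists u.
by exists a.
Qed.

Let star_trace u a : u + star u = a%:A -> star u = a%:A - u.
Proof. by move=> <-; rewrite addrC addKr. Qed.

Lemma local_prime (a b : A) : a != 0 -> b != 0 -> exists s, a * s * b != 0.
Proof.
move=> a0 b0; have [S [f [simpleS _ finj fS _]]] := local_simple_subring alsaA [:: a; b].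
have [a' _ aE] := fS a (mem_head _ _).
have [b' _ bE] : range f b by apply: fS; rewrite !inE eqxx orbT.
have [||t abt] := simple_ring_prime simpleS (a := a') (b := b').
- by apply: contra_neq a0 => E; rewrite -aE E rmorph0.
- by apply: contra_neq b0 => E; rewrite -bE E rmorph0.
exists (f t); rewrite -aE -bE -!rmorphM; apply: contra_neq abt => E.
by apply: finj; rewrite E rmorph0.
Qed.

Lemma star_normal u : star u * u = u * star u.
Proof.
have [a aE] := trace u; rewrite (star_trace aE) mulrBl mulrBr.
by rewrite mulr_algl mulr_algr.
Qed.

(** A noninvertible [a] has norm zero, and so have its multiples; among these, an
    element of trace one is an idempotent as wanted. If all multiples had trace
    zero, [a] would annihilate all commutators and vanish by [local_prime]. *)
Lemma trace_one_idempotent (a x y : A) : a != 0 -> a \isn't a GRing.unit ->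
  x * y <> y * x -> exists e, e * e = e /\ star e = 1 - e.
Proof.
move=> a0 ua xy; have na : a * star a = 0.
  have [c _ /= cE] : range (in_alg A) (a * star a) by apply: normsA; exists a.
  have [c0|c0] := eqVneq c 0; first by rewrite -cE c0 scale0r.
  case/negP: ua; apply/unitrP; exists (c^-1 *: star a).
  rewrite -scalerAl -scalerAr star_normal -cE scalerA mulVf // scale1r.
  by split.
have [[b [t [bE t0]]]|no] := pselect (exists b t, b * a + star (b * a) = t%:A /\ t != 0).
  exists (t^-1 *: (b * a)).
  have sE := star_trace bE; have nba : b * a * star (b * a) = 0.
    by rewrite (starM starI) mulrA -(mulrA b) na mulr0 mul0r.
  have : b * a * (b * a) = t *: (b * a).
    apply/subr0_eq; rewrite -oppr0 -nba sE mulrBr mulr_algr opprB //.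
  move: (b * a) sE => c sE cc; split.
    rewrite -scalerAl -scalerAr cc; congr (_ *: _).
    by rewrite scalerA mulVf // scale1r.
  by rewrite (starZ centerA starI star1) sE scalerBr scalerA mulVf // scale1r.
have T0 b : b * a = - (star a * star b).
  have [t tE] := trace (b * a); have [t0|t0] := eqVneq t 0; last by case: no; exists b, t.
  by apply/eqP; rewrite -addr_eq0 -(starM starI) tE t0 scale0r.
have sa : star a = - a.
  by have := T0 1; rewrite mul1r (star_one centerA star1) mulr1 => E; rewrite [in RHS]E opprK.
have {}T0 b : b * a = a * star b by rewrite T0 sa mulNr opprK.
have aC b c : a * (b * c - c * b) = 0.
  have E : star b * star c * a = star b * (star c * a) by rewrite mulrA.
  move: E; rewrite T0 (starM starI) !(starK starI) T0 (starK starI) (mulrA (star b)) T0 (starK starI).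
  by rewrite mulrBr mulrA => ->; rewrite !mulrA subrr.
have xy0 : x * y - y * x != 0 by rewrite subr_eq0; apply/eqP.
have [s /eqP[]] := local_prime a0 xy0.
have -> : a * s * (x * y - y * x) = a * (s * x * y - y * (s * x)) - a * (s * y - y * s) * x.
  by ncring.
by rewrite !aC mul0r subr0.
Qed.

Section Idempotent.
Variable e : A.
Hypotheses (ee : e * e = e) (se : star e = 1 - e).

Let ef : e * (1 - e) = 0. Proof. by rewrite mulrBr mulr1 ee subrr. Qed.
Let fe : (1 - e) * e = 0. Proof. by rewrite mulrBl mul1r ee subrr. Qed.

Let e0 : e != 0.
Proof.
apply/eqP => e0; move: se; rewrite e0 (star0 starI) subr0 => /esym/eqP.
by rewrite oner_eq0.
Qed.

Lemma corner_scalar u : exists a : F, e * u * e = a *: e.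
Proof.
have [a aE] := trace (e * u); exists a.
have := congr1 (fun w => e * w * e) aE.
rewrite (starM starI) se mulrDr mulrDl !mulrA ee -(mulrA _ (1 - e) e) fe mulr0 addr0 => ->.
by rewrite mulr_algr -scalerAl ee.
Qed.

(** The element and its image under [star] are both in the component
    [e * A * (1 - e)], which contains no nonzero scalar. *)
Lemma off_diagonal_skew u : star (e * u * (1 - e)) = - (e * u * (1 - e)).
Proof.
have sf : star (1 - e) = e by rewrite -{1}se (starK starI).
have [a aE] := trace (e * u * (1 - e)); rewrite (star_trace aE).
suff -> : a%:A = 0 :> A by rewrite sub0r.
have: star (e * u * (1 - e)) = e * star u * (1 - e).
  by rewrite !(starM starI) sf se mulrA.
move=> E; move: aE; rewrite E => aE.
have := congr1 (fun w => w * e) aE.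
rewrite mulrDl -!mulrA fe !mulr0 addr0 mulr_algl => /esym/eqP.
by rewrite scaler_eq0 (negPf e0) orbF => /eqP ->; rewrite scale0r.
Qed.

End Idempotent.

(** By [off_diagonal_skew] the involution negates [z] and [z'], so it maps
    [z * z' = e] to [z' * z = 1 - e]. *)
Lemma matrix_units e : e * e = e -> star e = 1 - e -> exists z z', [/\ e * z = z /\ z * (1 - e) = z,
  (1 - e) * z' = z' /\ z' * e = z', z * z' = e & [/\ z' * z = 1 - e, star z = - z & star z' = - z']].
Proof.
move=> ee se; have sf : star (1 - e) = 1 - (1 - e).
  by rewrite -{1}se (starK starI) subKr.
have ff : (1 - e) * (1 - e) = 1 - e by rewrite mulrBl mul1r mulrBr mulr1 ee subrr subr0.
have e0 : e != 0.
  apply/eqP => e0; move: se; rewrite e0 (star0 starI) subr0 => /esym/eqP.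
  by rewrite oner_eq0.
have f0 : 1 - e != 0.
  by rewrite -se; apply: contra_neq e0 => E; rewrite -(starK starI e) E (star0 starI).
have [s z0] := local_prime e0 f0; set z := e * s * (1 - e) in z0.
have ez : e * z = z by rewrite /z !mulrA ee.
have zf : z * (1 - e) = z by rewrite /z -mulrA ff.
clearbody z; have [t zt] := local_prime z0 e0.
have [a aE] := corner_scalar ee se (z * t).
have a0 : a != 0.
  by apply: contra_neq zt => a0; rewrite -[z]ez -(mulrA e z) aE a0 scale0r.
pose z' := a^-1 *: ((1 - e) * t * e).
have fz' : (1 - e) * z' = z' by rewrite /z' -scalerAr !mulrA ff.
have z'e : z' * e = z' by rewrite /z' -scalerAl -!mulrA ee.
have zz' : z * z' = e.
  by rewrite /z' -scalerAr !mulrA zf -{1}ez -(mulrA e z) aE scalerA mulVf // scale1r.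
have sz : star z = - z by rewrite -zf -ez; exact: (off_diagonal_skew ee se).
have sz' : star z' = - z'.
  have {1 2}-> : z' = (1 - e) * z' * (1 - (1 - e)) by rewrite subKr fz' z'e.
  exact: (off_diagonal_skew ff sf).
exists z, z'; split=> //; split=> //.
by rewrite -se -zz' (starM starI) sz sz' mulrNN.
Qed.

Lemma matrix_structure e : e * e = e -> star e = 1 - e ->
  exists phi : {rmorphism A -> 'M[F^o]_2}, [/\ bijective phi,
    forall a : F, phi a%:A = ((a%:A : F^o)%:M) &
    forall x, phi (star x) = symplectic2 (phi x)].
Proof.
move=> ee se; have [z [z' [[ez zf] [fz' z'e] zz' [z'z sz sz']]]] := matrix_units ee se.
have se' := se; set f := 1 - e in se zf fz' z'z.
have ff : f * f = f by rewrite /f mulrBl mul1r mulrBr mulr1 ee subrr subr0.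
have ef : e * f = 0 by rewrite /f mulrBr mulr1 ee subrr.
have fe : f * e = 0 by rewrite /f mulrBl mul1r ee subrr.
have sf : star f = e by rewrite -se (starK starI).
have e1 : e + f = 1 by rewrite addrC subrK.
have corner_f u : exists a : F, f * u * f = a *: f.
  have sf1 : star f = 1 - f by rewrite sf /f subKr.
  have [a aE] := corner_scalar ff sf1 u; by exists a.
clearbody f.
have fz : f * z = 0 by rewrite -ez mulrA fe mul0r.
have ze : z * e = 0 by rewrite -zf -mulrA fe mulr0.
have ez' : e * z' = 0 by rewrite -fz' mulrA ef mul0r.
have z'f : z' * f = 0 by rewrite -z'e -mulrA ef mulr0.
have z0 : z * z = 0 by rewrite -{1}zf -mulrA fz mulr0.
have z'0 : z' * z' = 0 by rewrite -{1}z'e -mulrA ez' mulr0.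
pose psi (M : 'M[F^o]_2) : A := M 0 0 *: e + M 0 1 *: z + M 1 0 *: z' + M 1 1 *: f.
have psiB M N : psi (M - N) = psi M - psi N.
  by rewrite /psi !mxE !scalerBl; ncring.
have psiM M N : psi (M *m N) = psi M * psi N.
  have sum2 i j : (M *m N) i j = M i 0 * N 0 j + M i 1 * N 1 j.
    by rewrite mxE !big_ord_recl big_ord0 addr0; congr (_ + M i _ * N _ j); exact/val_inj.
  rewrite /psi !sum2 !mulrDl !mulrDr -!scalerAl -!scalerAr !scalerA !scalerDl.
  rewrite ee ez ez' ef ze z0 zz' zf z'e z'z z'0 z'f fe fz fz' ff !scaler0 !addr0 !add0r.
  by ncring.
have psi1 : psi 1%:M = 1.
  by rewrite /psi !mxE /= !mulr1n !mulr0n !scale0r !scale1r !addr0.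
have psi_star M : star (psi M) = psi (symplectic2 M).
  rewrite /psi !(starD starI) !(starZ centerA starI star1) se sz sz' sf !mxE /=.
  by rewrite !scaleNr !scalerN; ncring.
have e0 : e != 0.
  apply/eqP => e0; move: e1 sf; rewrite e0 add0r => ->.
  by rewrite (star_one centerA star1) => /eqP; rewrite oner_eq0.
have psi0 M : psi M = 0 -> M = 0.
  move=> E.
  have coef u v c : u * psi M * v = c *: e -> c = 0.
    rewrite E mulr0 mul0r => /esym/eqP; rewrite scaler_eq0 (negPf e0) orbF => /eqP //.
  have M00 : M 0 0 = 0.
    apply: (coef e e); rewrite /psi !mulrDr !mulrDl -!scalerAr -!scalerAl.
    by rewrite !(ee, ez, ez', ef, ze, mul0r, scaler0, addr0).
  have M01 : M 0 1 = 0.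
    apply: (coef e z'); rewrite /psi !mulrDr !mulrDl -!scalerAr -!scalerAl.
    by rewrite !(ee, ez, ez', ef, zz', mul0r, scaler0, addr0, add0r).
  have M10 : M 1 0 = 0.
    apply: (coef z e); rewrite /psi !mulrDr !mulrDl -!scalerAr -!scalerAl.
    by rewrite !(ee, ze, z0, zz', zf, mul0r, scaler0, addr0, add0r).
  have M11 : M 1 1 = 0.
    apply: (coef z z'); rewrite /psi !mulrDr !mulrDl -!scalerAr -!scalerAl.
    by rewrite !(ee, ez', ze, z0, zz', zf, mul0r, scaler0, addr0, add0r).
  apply/matrixP => i j; rewrite mxE.
  have I2 (k : 'I_2) : k = 0 \/ k = 1.
    by case: k => -[|[|//]] k2; [left|right]; exact/val_inj.
  by case: (I2 i) => ->; case: (I2 j) => ->.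
have psi_inj : injective psi by move=> M N E; apply/subr0_eq/psi0; rewrite psiB E subrr.
have psi_surj u : exists M, psi M = u.
  have [a aE] := corner_scalar ee se' u; have [d dE] := corner_f u.
  have [b bE] := corner_scalar ee se' (u * z'); have [c cE] := corner_scalar ee se' (z * u).
  exists (\matrix_(i, j) nth 0 (nth [::] [:: [:: a; b]; [:: c; d]] i) j).
  rewrite /psi !mxE /=.
  have -> : u = e * u * e + e * u * f + f * u * e + f * u * f.
    have fE : f = 1 - e by rewrite -e1 addrAC subrr add0r.
    by rewrite fE; ncring.
  rewrite aE dE; congr (_ + _ + _ + _).
  - transitivity (e * (u * z') * e * z); first by rewrite bE -scalerAl ez.
    by rewrite -(mulrA _ e z) ez -!mulrA z'z.
  - transitivity (z' * (e * (z * u) * e)); first by rewrite cE -scalerAr z'e.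
    by rewrite !mulrA z'e z'z.
pose g u := sval (cid (psi_surj u)); have gE u : psi (g u) = u := svalP (cid (psi_surj u)).
have gB : zmod_morphism g by move=> u v; apply: psi_inj; rewrite psiB !gE.
have gM : monoid_morphism g.
  by split=> [|u v]; apply: psi_inj; [rewrite gE -psi1 | rewrite [g u * g v]/(g u *m g v) psiM !gE].
pose phi : {rmorphism A -> 'M[F^o]_2} :=
  HB.pack g (GRing.isZmodMorphism.Build _ _ g gB) (GRing.isMonoidMorphism.Build _ _ g gM).
exists phi; split.
- by exists psi => u; [exact: gE | apply: psi_inj; exact: gE].
- move=> a; apply: psi_inj; rewrite gE /psi !mxE /= !mulr1n !mulr0n !scale0r !addr0.
  by rewrite -scalerDr e1 [a *: (1 : F^o)]mulr1.
- by move=> u; apply: psi_inj; rewrite -psi_star !gE.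
Qed.

End MatrixUnits.

(** * The equivalence and the structure theorem *)

Lemma traces_of_subnormal_norms (F : fieldType) (A : unitAlgType F) (star : A -> A)
    (centerA : center A = range (in_alg A)) (alsaA : almost_locally_simple_artinian A)
    (cardF : exists s : seq F, uniq s /\ size s = 4%N)
    (starI : involution star) (star1 : first_kind star)
    (G : set A) (subnG : subnormal_unit_subgroup G) (nabG : nonabelian G) :
  norms star G `<=` range (in_alg A) -> traces star setT `<=` range (in_alg A).
Proof.
move=> normsG; have [r [H [HG Hr subH normH]]] := subnG; rewrite -HG in nabG normsG.
have [divA|ndiv] := pselect (division_ring A).
  exact: (division_traces divA centerA cardF starI star1 (And3 Hr subH normH) nabG normsG).
have [a [a0 ua]] : exists a : A, a != 0 /\ a \isn't a GRing.unit.
  apply: contrapT => no; apply: ndiv => a a0; apply: contrapT => /negP ua; apply: no.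
  by exists a.
exact: (nondivision_traces centerA alsaA cardF starI star1
  (And3 Hr subH normH) nabG normsG a0 ua).
Qed.

Lemma nonabelian_units (A : unitRingType) (G : set A) :
  subnormal_unit_subgroup G -> nonabelian G -> nonabelian (units A).
Proof.
move=> [r [H [HG _ subH _]]] [x [y [Gx Gy xy]]]; rewrite -HG in Gx Gy.
by exists x, y; split=> //; apply: (usubg_unit (subH 0%N (leq0n r))).
Qed.

Lemma field_centrally_finite (F : fieldType) : @centrally_finite F^o.
Proof.
split=> [x x0|]; first by rewrite unitfE.
exists [:: 1] => x; exists (fun=> x); split=> [_ y|]; first exact: mulrC.
by rewrite big_ord_recl big_ord0 addr0 mulr1.
Qed.

Theorem theorem5p3 (F : fieldType) (A : unitAlgType F)
    (centerA : center A = range (in_alg A))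
    (alsaA : almost_locally_simple_artinian A)
    (cardF : exists s : seq F, uniq s /\ size s = 4%N)
    (G : set A) (subnG : subnormal_unit_subgroup G) (nabG : nonabelian G)
    (star : A -> A) (starI : involution star) (star1 : first_kind star) :
  [<-> traces star G `<=` range (in_alg A);
       traces star setT `<=` range (in_alg A);
       norms star setT `<=` range (in_alg A);
       norms star G `<=` range (in_alg A)] /\
  ([\/ traces star G `<=` range (in_alg A),
       traces star setT `<=` range (in_alg A),
       norms star setT `<=` range (in_alg A) |
       norms star G `<=` range (in_alg A)] ->
   exists (n : nat) (D : unitAlgType F) (phi : {rmorphism A -> 'M[D]_n}),
     [/\ (0 < n)%N, centrally_finite D, bijective phi,
         forall a : F, phi a%:A = (a%:A)%:M &
         (n = 1%N /\ quaternion_division_algebra A) \/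
         (exists (n2 : n = 2%N) (f : {lrmorphism D -> F^o}),
            let psi x := map_mx f (castmx (n2, n2) (phi x)) in
            bijective f /\
            forall x, psi (star x) = symplectic2 (psi x))]).
Proof.
have NG_TA := traces_of_subnormal_norms centerA alsaA cardF starI star1 subnG nabG.
have TG_NG : traces star G `<=` range (in_alg A) -> norms star G `<=` range (in_alg A).
  have [r [H [HG _ subH _]]] := subnG; have sG := subH 0%N (leq0n r); rewrite HG in sG.
  by apply: (traces_norms centerA starI star1 (usubg1 sG)) => // x y; exact: usubgM.
have TA_TG : traces star setT `<=` range (in_alg A) -> traces star G `<=` range (in_alg A).
  by move=> TA _ [x _ <-]; apply: TA; exists x.
have NA_NG : norms star setT `<=` range (in_alg A) -> norms star G `<=` range (in_alg A).
  by move=> NA _ [x _ <-]; apply: NA; exists x.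
have TA_NA := traces_norms_setT centerA starI.
split.
  tfae.
  - by move/TG_NG/NG_TA.
  - exact: TA_NA.
  - exact: NA_NG.
  - by move/NG_TA/TA_TG.
move=> cases; have TA : traces star setT `<=` range (in_alg A).
  by case: cases => [/TG_NG/NG_TA|//|/NA_NG/NG_TA|/NG_TA].
have NA := TA_NA TA.
have nabA := nonabelian_units subnG nabG.
have [divA|ndiv] := pselect (division_ring A).
  have [quatA finA] := division_structure divA centerA cardF starI star1 nabA NA.
  exists 1%N, A, (@scalar_mx A 1); split=> //; last by left.
  exists (fun M : 'M_1 => M 0 0) => [x|M]; first by rewrite mxE.
  by apply/matrixP => i j; rewrite !ord1 mxE.
have [a [a0 ua]] : exists a : A, a != 0 /\ a \isn't a GRing.unit.
  apply: contrapT => no; apply: ndiv => a a0; apply: contrapT => /negP ua; apply: no.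
  by exists a.
have [x [y [_ _ /eqP xy]]] := nabA.
have [e [ee se]] := trace_one_idempotent centerA alsaA starI star1 TA NA a0 ua xy.
have [phi [phi_bij phi_scal phi_star]] := matrix_structure centerA alsaA starI star1 TA ee se.
exists 2%N, F^o, phi; split=> //; first exact: field_centrally_finite.
right; exists erefl, idfun; split=> [|u]; first by exists idfun.
by rewrite !castmx_id !map_mx_id // phi_star.
Qed.
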